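(* Let $n\geq 6$ and let $\phi_2\colon \operatorname{Aut}(P_{n-1})\to\operatorname{Aut}\left(\Gamma_2(\overline{P}_{n-1})/\Gamma_3(\overline{P}_{n-1})\right)$ be the induced homomorphism. For every $\alpha\in\operatorname{Aut}(P_{n-1})$, the automorphism $\phi_2(\alpha)$ has $1$ as an eigenvalue.
   Context: The Artin braid group $B_m$ is the group generated by $\sigma_1,\ldots,\sigma_{m-1}$ subject to the relations $\sigma_i\sigma_j=\sigma_j\sigma_i$ for $|i-j|\geq 2$ and $\sigma_{i+1}\sigma_i\sigma_{i+1}=\sigma_i\sigma_{i+1}\sigma_i$ for $1\leq i\leq m-2$. The pure Artin braid group $P_m$ is the kernel of the surjective homomorphism $B_m\to S_m$ sending $\sigma_i$ to the transposition $(i,i+1)$. Let $Z(P_m)$ be the center of $P_m$ and $\overline{P}_m=P_m/Z(P_m)$. For a group $G$, the lower central series is $\Gamma_1(G)=G$, $\Gamma_{i+1}(G)=[G,\Gamma_i(G)]$. Since $Z(P_m)$ and the $\Gamma_i$ are characteristic, every $\alpha\in\operatorname{Aut}(P_m)$ induces an automorphism of $\overline{P}_m$ and hence an automorphism $\phi_2(\alpha)$ of $\Gamma_2(\overline{P}_m)/\Gamma_3(\overline{P}_m)$. The latter group (which equals $\Gamma_2(P_m)/\Gamma_3(P_m)$) is free abelian of rank $\binom{m}{3}$; eigenvalues of $\phi_2(\alpha)$ are the eigenvalues of the integer matrix representing $\phi_2(\alpha)$ with respect to a $\mathbb{Z}$-basis. *)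

(* Defs.v *)
From HB Require Import structures.
From mathcomp Require Import all_boot all_order all_fingroup all_algebra.
From mathcomp Require Import all_field zify.
From mathcomp Require Import generic_quotient boolp.

Set Implicit Arguments.
Unset Strict Implicit.
Unset Printing Implicit Defensive.

Import GRing.Theory.
Local Open Scope group_scope.
Local Open Scope quotient_scope.

HB.mixin Record isConjClosed (G : groupType) (S : {pred G}) := {
  gpredJl : forall x y : G, x \in S -> x ^ y \in S
}.

#[short(type="normalClosed")]
HB.structure Definition NormalClosed (G : groupType) :=
  {S of isConjClosed G S & GroupClosed G S}.

Section SubGroupType.
Variables (G : groupType) (S : groupClosed G).

Definition subgrp := {x : G | x \in S}.

HB.instance Definition _ := SubChoice.on subgrp.

Fact subgrp_closed : group_closed (fun x : G => x \in S).
Proof. by split=> [|x y xS yS]; [apply: gpred1 | apply: gpredF]. Qed.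

HB.instance Definition _ :=
  SubChoice_isSubGroup.Build G (fun x : G => x \in S) subgrp subgrp_closed.

End SubGroupType.

Section QuotientGroup.
Variables (G : groupType) (N : normalClosed G).

Definition eqmodN (x y : G) : bool := x^-1 * y \in N.

Fact eqmodN_refl : reflexive eqmodN.
Proof. by move=> x; rewrite /eqmodN mulVg gpred1. Qed.

Fact eqmodN_sym : symmetric eqmodN.
Proof. by move=> x y; rewrite /eqmodN -gpredV invgM invgK. Qed.

Fact eqmodN_trans : transitive eqmodN.
Proof.
move=> y x z; rewrite /eqmodN => xy yz.
by rewrite -(mulVKg y z) mulgA gpredM.
Qed.

Canonical eqmodN_equiv := EquivRel eqmodN eqmodN_refl eqmodN_sym eqmodN_trans.

Definition quotg := {eq_quot eqmodN}.

HB.instance Definition _ := Choice.on quotg.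
HB.instance Definition _ := EqQuotient.on quotg.

Lemma quotgP (x y : G) : reflect (x = y %[mod quotg]) (x^-1 * y \in N).
Proof. exact: eqmodP. Qed.

Definition quotg_one : quotg := \pi_quotg 1.
Definition quotg_mul (x y : quotg) : quotg := \pi_quotg (repr x * repr y).
Definition quotg_inv (x : quotg) : quotg := \pi_quotg (repr x)^-1.

Lemma quotg_mulE (x y : G) : quotg_mul (\pi_quotg x) (\pi_quotg y) = \pi_quotg (x * y).
Proof.
apply/quotgP.
have /quotgP hx : repr (\pi_quotg x) = x %[mod quotg] by rewrite reprK.
have /quotgP hy : repr (\pi_quotg y) = y %[mod quotg] by rewrite reprK.
move: (repr (\pi_quotg x)) (repr (\pi_quotg y)) hx hy => a b hx hy.
suff -> : (a * b)^-1 * (x * y) = (a^-1 * x) ^ b * (b^-1 * y).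
  by rewrite gpredM // gpredJl.
by rewrite /conjg invgM !mulgA mulgK.
Qed.

Lemma quotg_invE (x : G) : quotg_inv (\pi_quotg x) = \pi_quotg x^-1.
Proof.
apply/quotgP.
have /quotgP hx : x = repr (\pi_quotg x) %[mod quotg] by rewrite reprK.
move: (repr (\pi_quotg x)) hx => a hx; rewrite invgK.
have -> : a * x^-1 = (x^-1 * a) ^ x^-1.
  by rewrite /conjg invgK !mulgA mulgV mul1g.
exact: gpredJl.
Qed.

Fact quotg_mulA : associative quotg_mul.
Proof.
elim/quotW=> x; elim/quotW=> y; elim/quotW=> z.
by rewrite (quotg_mulE y z) (quotg_mulE x y) (quotg_mulE x) (quotg_mulE _ z) mulgA.
Qed.
Fact quotg_mul1 : left_id quotg_one quotg_mul.
Proof. by elim/quotW=> x; rewrite quotg_mulE mul1g. Qed.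
Fact quotg_mulr1 : right_id quotg_one quotg_mul.
Proof. by elim/quotW=> x; rewrite quotg_mulE mulg1. Qed.
Fact quotg_mulV : left_inverse quotg_one quotg_inv quotg_mul.
Proof. by elim/quotW=> x; rewrite quotg_invE quotg_mulE mulVg. Qed.
Fact quotg_mulrV : right_inverse quotg_one quotg_inv quotg_mul.
Proof. by elim/quotW=> x; rewrite quotg_invE quotg_mulE mulgV. Qed.

HB.instance Definition _ := isGroup.Build quotg
  quotg_mulA quotg_mul1 quotg_mulr1 quotg_mulV quotg_mulrV.

Lemma quotg_piM (x y : G) : \pi_quotg (x * y) = \pi_quotg x * \pi_quotg y.
Proof. by rewrite -quotg_mulE. Qed.

End QuotientGroup.

Section Automorphisms.
Variable G : groupType.

Record autg := Autg {
  autg_val :> {multiplicative G -> G};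
  autg_bij : bijective autg_val
}.

HB.instance Definition _ := gen_eqMixin autg.
HB.instance Definition _ := gen_choiceMixin autg.

Definition mk_autg (f : G -> G) (fM : {morph f : x y / x * y})
    (fb : bijective f) : autg :=
  @Autg (HB.pack f (isMultiplicative.Build G G f fM)) fb.

Lemma autgP (f g : autg) : f =1 g -> f = g.
Proof.
case: f => [[f [[fM]]] fb]; case: g => [[g [[gM]]] gb] /= /funext efg.
rewrite /= in efg *; subst g.
by rewrite (Prop_irrelevance gM fM) (Prop_irrelevance gb fb).
Qed.

Lemma autg1 (f : autg) : f 1 = 1.
Proof. by apply: (@mulgI _ (f 1)); rewrite -gmulfM !mulg1. Qed.

Lemma autgV (f : autg) (x : G) : f x^-1 = (f x)^-1.
Proof. by apply: (@mulgI _ (f x)); rewrite -gmulfM !mulgV autg1. Qed.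

Lemma autgJ (f : autg) (x y : G) : f (x ^ y) = f x ^ f y.
Proof. by rewrite /conjg !gmulfM autgV. Qed.

Lemma autgR (f : autg) (x y : G) : f [~ x, y] = [~ f x, f y].
Proof. by rewrite /commg gmulfM autgV autgJ. Qed.

Definition autg_one : autg :=
  @mk_autg idfun (fun _ _ => erefl) (Bijective (frefl _) (frefl _)).

Fact autg_mul_morph (f g : autg) : {morph f \o g : x y / x * y}.
Proof. by move=> x y; rewrite /= !gmulfM. Qed.

Definition autg_mul (f g : autg) : autg :=
  mk_autg (@autg_mul_morph f g) (bij_comp (autg_bij f) (autg_bij g)).

Lemma autg_inv_sig (f : autg) : {g : G -> G | cancel f g /\ cancel g f}.
Proof. by apply: cid; case: (autg_bij f) => g; exists g. Qed.

Definition autg_invf (f : autg) : G -> G := sval (autg_inv_sig f).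

Lemma autg_invK (f : autg) : cancel f (autg_invf f).
Proof. by case: (svalP (autg_inv_sig f)). Qed.

Lemma autg_invKV (f : autg) : cancel (autg_invf f) f.
Proof. by case: (svalP (autg_inv_sig f)). Qed.

Definition autg_inv (f : autg) : autg :=
  mk_autg (can2_gmulfM (@autg_invK f) (@autg_invKV f))
    (Bijective (@autg_invKV f) (@autg_invK f)).

Fact autg_mulA : associative autg_mul.
Proof. by move=> f g h; apply: autgP. Qed.
Fact autg_mul1 : left_id autg_one autg_mul.
Proof. by move=> f; apply: autgP. Qed.
Fact autg_mulr1 : right_id autg_one autg_mul.
Proof. by move=> f; apply: autgP. Qed.
Fact autg_mulV : left_inverse autg_one autg_inv autg_mul.
Proof. by move=> f; apply: autgP => x; apply: autg_invK. Qed.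
Fact autg_mulrV : right_inverse autg_one autg_inv autg_mul.
Proof. by move=> f; apply: autgP => x; apply: autg_invKV. Qed.

HB.instance Definition _ := isGroup.Build autg
  autg_mulA autg_mul1 autg_mulr1 autg_mulV autg_mulrV.

Lemma autgM (f g : autg) (x : G) : (f * g) x = f (g x).
Proof. by []. Qed.

Lemma autgK (f : autg) : cancel f f^-1.
Proof. exact: autg_invK. Qed.

Lemma autgKV (f : autg) : cancel f^-1 f.
Proof. exact: autg_invKV. Qed.

Definition char_pred (S : {pred G}) :=
  forall (f : autg) (x : G), (f x \in S) = (x \in S).

Lemma char_predW (S : {pred G}) :
  (forall (f : autg) (x : G), x \in S -> f x \in S) -> char_pred S.
Proof.
move=> Sf f x; apply/idP/idP => [/(Sf f^-1)|/Sf //].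
by rewrite autgK.
Qed.

End Automorphisms.

Section InducedAutomorphisms.
Variables (G : groupType) (f : autg G).

Section Restriction.
Variables (S : groupClosed G) (fS : forall x, (f x \in S) = (x \in S)).

Definition sub_fun (u : subgrp S) : subgrp S :=
  exist _ (f (val u)) (etrans (fS (val u)) (valP u)).

Fact sub_fun_morph : {morph sub_fun : u v / u * v}.
Proof. by move=> u v; apply: val_inj; rewrite /= gmulfM. Qed.

Fact sub_fun_bij : bijective sub_fun.
Proof.
have fV (u : subgrp S) : f^-1 (val u) \in S.
  by rewrite -fS autgKV; apply: valP.
exists (fun u => exist _ (f^-1 (val u)) (fV u)) => u; apply: val_inj.
  exact: autgK.
exact: autgKV.
Qed.

Definition sub_autg : autg (subgrp S) := mk_autg sub_fun_morph sub_fun_bij.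

End Restriction.

Section Quotient.
Variables (N : normalClosed G) (fN : forall x, (f x \in N) = (x \in N)).

Definition quot_fun (u : quotg N) : quotg N := \pi_(quotg N) (f (repr u)).

Lemma quot_funE x : quot_fun (\pi_(quotg N) x) = \pi_(quotg N) (f x).
Proof.
apply/quotgP; rewrite -autgV -gmulfM fN; apply/quotgP.
by rewrite reprK.
Qed.

Fact quot_fun_morph : {morph quot_fun : u v / u * v}.
Proof.
elim/quotW=> x; elim/quotW=> y.
by rewrite -quotg_piM !quot_funE gmulfM quotg_piM.
Qed.

Fact quot_fun_bij : bijective quot_fun.
Proof.
have fV x y : \pi_(quotg N) x = \pi_(quotg N) y ->
    \pi_(quotg N) (f^-1 x) = \pi_(quotg N) (f^-1 y).
  by move/quotgP=> xy; apply/quotgP; rewrite -autgV -gmulfM -fN autgKV.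
exists (fun u => \pi_(quotg N) (f^-1 (repr u))); elim/quotW=> x; rewrite quot_funE.
  rewrite (fV _ (f x)) ?reprK //.
  by rewrite autgK.
by rewrite autgKV reprK.
Qed.

Definition quot_autg : autg (quotg N) := mk_autg quot_fun_morph quot_fun_bij.

Lemma quot_autgE x : quot_autg (\pi_(quotg N) x) = \pi_(quotg N) (f x).
Proof. exact: quot_funE. Qed.

End Quotient.

End InducedAutomorphisms.

Section GeneratedSubgroup.
Variables (G : groupType) (A : G -> Prop).

Definition gensub : {pred G} :=
  fun x => `[< forall H : groupClosed G, (forall a, A a -> a \in H) -> x \in H >].

Lemma gensubP (x : G) :
  reflect (forall H : groupClosed G, (forall a, A a -> a \in H) -> x \in H)
    (x \in gensub).
Proof. exact: asboolP. Qed.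

Lemma mem_gensub (x : G) : A x -> x \in gensub.
Proof. by move=> Ax; apply/gensubP => H; apply. Qed.

Fact gensub_mul : mulg_closed gensub.
Proof.
move=> x y /gensubP Hx /gensubP Hy; apply/gensubP => H AH.
by rewrite gpredM ?Hx ?Hy.
Qed.
Fact gensub_one : 1 \in gensub.
Proof. by apply/gensubP => H _; apply: gpred1. Qed.
Fact gensub_inv : invg_closed gensub.
Proof. by move=> x /gensubP Hx; apply/gensubP => H AH; rewrite gpredV Hx. Qed.

HB.instance Definition _ := isMulClosed.Build G gensub gensub_mul.
HB.instance Definition _ := isMul1Closed.Build G gensub gensub_one.
HB.instance Definition _ := isInvClosed.Build G gensub gensub_inv.

End GeneratedSubgroup.

Section PreimageSubgroup.
Variables (G H : groupType) (f : {multiplicative G -> H}) (S : groupClosed H).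

Definition preimg : {pred G} := fun x => f x \in S.

Lemma mem_preimg x : (x \in preimg) = (f x \in S). Proof. by []. Qed.

Let f1 : f 1 = 1.
Proof. by apply: (@mulgI _ (f 1)); rewrite -gmulfM !mulg1. Qed.

Let fV x : f x^-1 = (f x)^-1.
Proof. by apply: (@mulgI _ (f x)); rewrite -gmulfM !mulgV f1. Qed.

Fact preimg_mul : mulg_closed preimg.
Proof. by move=> x y; rewrite !mem_preimg gmulfM; apply: gpredM. Qed.
Fact preimg_one : 1 \in preimg.
Proof. by rewrite mem_preimg f1 gpred1. Qed.
Fact preimg_inv : invg_closed preimg.
Proof. by move=> x; rewrite !mem_preimg fV gpredV. Qed.

HB.instance Definition _ := isMulClosed.Build G preimg preimg_mul.
HB.instance Definition _ := isMul1Closed.Build G preimg preimg_one.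
HB.instance Definition _ := isInvClosed.Build G preimg preimg_inv.

End PreimageSubgroup.

Section Kernel.
Variables (G H : groupType) (f : {multiplicative G -> H}).

Definition kerg : {pred G} := fun x => f x == 1.

Lemma kergP (x : G) : reflect (f x = 1) (x \in kerg).
Proof. exact: eqP. Qed.

Fact kerg_mul : mulg_closed kerg.
Proof.
by move=> x y /kergP fx /kergP fy; apply/kergP; rewrite gmulfM fx fy mulg1.
Qed.
Fact kerg_one : 1 \in kerg.
Proof. by apply/kergP/(@mulgI _ (f 1)); rewrite -gmulfM !mulg1. Qed.
Fact kerg_inv : invg_closed kerg.
Proof.
move=> x /kergP fx; apply/kergP; rewrite -[LHS]mul1g -fx -gmulfM mulgV fx.
exact/kergP/kerg_one.
Qed.

HB.instance Definition _ := isMulClosed.Build G kerg kerg_mul.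
HB.instance Definition _ := isMul1Closed.Build G kerg kerg_one.
HB.instance Definition _ := isInvClosed.Build G kerg kerg_inv.

End Kernel.

Section Center.
Variable G : groupType.

Definition centerg : {pred G} := fun x => `[< forall y : G, commute x y >].

Lemma centergP (x : G) :
  reflect (forall y : G, commute x y) (x \in centerg).
Proof. exact: asboolP. Qed.

Fact centerg_mul : mulg_closed centerg.
Proof.
move=> x y /centergP Zx /centergP Zy; apply/centergP => z.
by apply/commute_sym/commuteM; apply/commute_sym.
Qed.
Fact centerg_one : 1 \in centerg.
Proof. by apply/centergP => y; rewrite /commute mul1g mulg1. Qed.
Fact centerg_inv : invg_closed centerg.
Proof.
move=> x /centergP Zx; apply/centergP => y.
by apply/commute_sym/commuteV/commute_sym.
Qed.
Fact centerg_conj (x y : G) : x \in centerg -> x ^ y \in centerg.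
Proof. by move=> Zx; rewrite /conjg (centergP _ Zx y) mulKg. Qed.

HB.instance Definition _ := isMulClosed.Build G centerg centerg_mul.
HB.instance Definition _ := isMul1Closed.Build G centerg centerg_one.
HB.instance Definition _ := isInvClosed.Build G centerg centerg_inv.
HB.instance Definition _ := isConjClosed.Build G centerg centerg_conj.

Lemma centerg_char : char_pred centerg.
Proof.
apply: char_predW => f x /centergP Zx; apply/centergP => y.
by rewrite -(autgKV f y) /commute -!gmulfM Zx.
Qed.

End Center.

Section LowerCentralSeries.
Variable G : groupType.

Definition commsub (A B : {pred G}) : {pred G} :=
  gensub (fun z => exists x y, [/\ x \in A, y \in B & z = [~ x, y]]).

(* lcs k is \Gamma_k(G), indexed from 1; the value at 0 is junk. *)
Fixpoint lcs (k : nat) : {pred G} :=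
  if k is (_.+1 as i).+1 then commsub predT (lcs i) else predT.

Fact lcs_closed (k : nat) :
  [/\ mulg_closed (lcs k), 1 \in lcs k & invg_closed (lcs k)].
Proof.
case: k => [|[|k]] //.
split; [exact: gensub_mul | exact: gensub_one | exact: gensub_inv].
Qed.

Fact lcs_mul (k : nat) : mulg_closed (lcs k).
Proof. by case: (lcs_closed k). Qed.
Fact lcs_one (k : nat) : 1 \in lcs k.
Proof. by case: (lcs_closed k). Qed.
Fact lcs_inv (k : nat) : invg_closed (lcs k).
Proof. by case: (lcs_closed k). Qed.

HB.instance Definition _ k := isMulClosed.Build G (lcs k) (@lcs_mul k).
HB.instance Definition _ k := isMul1Closed.Build G (lcs k) (@lcs_one k).
HB.instance Definition _ k := isInvClosed.Build G (lcs k) (@lcs_inv k).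

Lemma lcs_char (k : nat) : char_pred (lcs k).
Proof.
case: k => [//|k]; elim: k => [//|k IHk]; apply: char_predW => f x.
move=> /gensubP Hx; rewrite -mem_preimg; apply: Hx => _ [y [z [_ zk ->]]].
rewrite mem_preimg autgR; apply: mem_gensub; exists (f y), (f z); split=> //.
by rewrite (IHk f).
Qed.

Fact conjg_morph (y : G) : {morph conjg^~ y : u v / u * v}.
Proof. by move=> u v; rewrite /conjg !mulgA mulgK. Qed.

Fact conjg_bij (y : G) : bijective (conjg^~ y).
Proof.
by exists (conjg^~ y^-1) => x; rewrite /conjg !invgK !mulgA ?mulgK;
  rewrite ?mulgV ?mulVg mul1g ?mulgVK ?mulgK.
Qed.

Fact lcs_conj (k : nat) (x y : G) : x \in lcs k -> x ^ y \in lcs k.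
Proof.
by move=> xk; rewrite (lcs_char k (mk_autg (@conjg_morph y) (@conjg_bij y))).
Qed.

HB.instance Definition _ k := isConjClosed.Build G (lcs k) (@lcs_conj k).

(* \Gamma_{k+1}(G) as a subset of the group \Gamma_k(G). *)
Definition lcs_next (k : nat) : {pred subgrp (lcs k)} :=
  fun u => val u \in lcs k.+1.

Fact lcs_next_mul (k : nat) : mulg_closed (@lcs_next k).
Proof. by move=> u v; apply: gpredM. Qed.
Fact lcs_next_one (k : nat) : 1 \in @lcs_next k.
Proof. exact: gpred1. Qed.
Fact lcs_next_inv (k : nat) : invg_closed (@lcs_next k).
Proof. by move=> u; apply: gpredVr. Qed.
Fact lcs_next_conj (k : nat) (u v : subgrp (lcs k)) :
  u \in @lcs_next k -> u ^ v \in @lcs_next k.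
Proof. exact: gpredJl. Qed.

HB.instance Definition _ k :=
  isMulClosed.Build (subgrp (lcs k)) (@lcs_next k) (@lcs_next_mul k).
HB.instance Definition _ k :=
  isMul1Closed.Build (subgrp (lcs k)) (@lcs_next k) (@lcs_next_one k).
HB.instance Definition _ k :=
  isInvClosed.Build (subgrp (lcs k)) (@lcs_next k) (@lcs_next_inv k).
HB.instance Definition _ k :=
  isConjClosed.Build (subgrp (lcs k)) (@lcs_next k) (@lcs_next_conj k).

Definition lcs_quot (k : nat) := quotg (@lcs_next k).

HB.instance Definition _ k := Group.on (lcs_quot k).

Definition lcs_autg (k : nat) (f : autg G) : autg (lcs_quot k) :=
  @quot_autg (subgrp (lcs k)) (sub_autg (@lcs_char k f)) (@lcs_next k)
    (fun u => @lcs_char k.+1 f (val u)).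

Lemma lcs_autgE (k : nat) (f : autg G) (u : subgrp (lcs k)) :
  lcs_autg k f (\pi_(quotg (@lcs_next k)) u) =
  \pi_(quotg (@lcs_next k)) (sub_autg (@lcs_char k f) u).
Proof. exact: quot_autgE. Qed.

Lemma lcs_autgM (k : nat) : {morph @lcs_autg k : f g / f * g}.
Proof.
move=> f g; apply: autgP; elim/quotW=> u; rewrite autgM.
rewrite (lcs_autgE g) (lcs_autgE f) (lcs_autgE (f * g)).
by congr (\pi_(quotg _) _); apply: val_inj.
Qed.

End LowerCentralSeries.

Section CentralQuotient.
Variable G : groupType.

(* G / Z(G), isomorphic to the group of inner automorphisms of G. *)
Definition inng := quotg (@centerg G).

HB.instance Definition _ := Group.on inng.

Definition inng_autg (f : autg G) : autg inng :=
  @quot_autg G f (@centerg G) (@centerg_char G f).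

Lemma inng_autgE (f : autg G) (x : G) :
  inng_autg f (\pi_(quotg (@centerg G)) x) = \pi_(quotg (@centerg G)) (f x).
Proof. exact: quot_autgE. Qed.

Lemma inng_autgM : {morph inng_autg : f g / f * g}.
Proof.
move=> f g; apply: autgP; elim/quotW=> x; rewrite autgM.
by rewrite (inng_autgE g) (inng_autgE f) (inng_autgE (f * g)) autgM.
Qed.

End CentralQuotient.

Section Presentation.
Variable X : choiceType.

(* The letter (x, b) stands for x if b = false and for x^-1 if b = true. *)
Definition word := seq (X * bool).

Definition gen_word : seq X -> word := map (fun x => (x, false)).

Variable R : seq X -> seq X -> Prop.

Inductive pres_eq : word -> word -> Prop :=
| pres_refl u : pres_eq u u
| pres_sym u v : pres_eq u v -> pres_eq v u
| pres_trans u v w : pres_eq u v -> pres_eq v w -> pres_eq u w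
| pres_cat u u' v v' :
    pres_eq u u' -> pres_eq v v' -> pres_eq (u ++ v) (u' ++ v')
| pres_cancel x b : pres_eq [:: (x, b); (x, ~~ b)] [::]
| pres_rel r s : R r s -> pres_eq (gen_word r) (gen_word s).

Definition pres_eqb (u v : word) : bool := `[< pres_eq u v >].

Fact pres_eqb_refl : reflexive pres_eqb.
Proof. by move=> u; apply/asboolP; apply: pres_refl. Qed.
Fact pres_eqb_sym : symmetric pres_eqb.
Proof. by move=> u v; apply/asboolP/asboolP; apply: pres_sym. Qed.
Fact pres_eqb_trans : transitive pres_eqb.
Proof.
by move=> v u w /asboolP uv /asboolP vw; apply/asboolP; apply: pres_trans vw.
Qed.

Canonical pres_equiv :=
  EquivRel pres_eqb pres_eqb_refl pres_eqb_sym pres_eqb_trans.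

Definition presg := {eq_quot pres_eqb}.

HB.instance Definition _ := Choice.on presg.
HB.instance Definition _ := EqQuotient.on presg.

Lemma presgP (u v : word) : reflect (u = v %[mod presg]) `[< pres_eq u v >].
Proof. exact: eqmodP. Qed.

Lemma pres_repr (u : word) : pres_eq (repr (\pi_presg u)) u.
Proof. by apply/asboolP/presgP; rewrite reprK. Qed.

Definition winv (u : word) : word := rev [seq (p.1, ~~ p.2) | p <- u].

Lemma winvK : involutive winv.
Proof.
move=> u; rewrite /winv map_rev revK -map_comp map_id_in // => -[x b] _ /=.
by rewrite negbK.
Qed.

Lemma winv_cat (u v : word) : winv (u ++ v) = winv v ++ winv u.
Proof. by rewrite /winv map_cat rev_cat. Qed.

Lemma pres_catV (u : word) : pres_eq (u ++ winv u) [::].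
Proof.
elim: u => [|[x b] u IHu]; first exact: pres_refl.
rewrite -cat1s winv_cat -catA (catA u).
apply: pres_trans (pres_cancel x b).
apply: (pres_cat (pres_refl [:: (x, b)])).
exact: (pres_cat IHu (pres_refl [:: (x, ~~ b)])).
Qed.

Lemma pres_Vcat (u : word) : pres_eq (winv u ++ u) [::].
Proof. by rewrite -{2}(winvK u); apply: pres_catV. Qed.

Lemma pres_winv (u v : word) : pres_eq u v -> pres_eq (winv u) (winv v).
Proof.
move=> uv; apply: (@pres_trans _ (winv u ++ v ++ winv v)).
  rewrite -{1}(cats0 (winv u)); apply: pres_cat (pres_refl _) _.
  exact/pres_sym/pres_catV.
rewrite catA -{2}(cat0s (winv v)); apply: pres_cat (pres_refl _).
apply: pres_trans (pres_Vcat u).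
exact: pres_cat (pres_refl _) (pres_sym uv).
Qed.

Definition presg_one : presg := \pi_presg [::].
Definition presg_mul (x y : presg) : presg := \pi_presg (repr x ++ repr y).
Definition presg_inv (x : presg) : presg := \pi_presg (winv (repr x)).

Lemma presg_mulE (u v : word) :
  presg_mul (\pi_presg u) (\pi_presg v) = \pi_presg (u ++ v).
Proof. by apply/presgP/asboolP/pres_cat; apply: pres_repr. Qed.

Lemma presg_invE (u : word) : presg_inv (\pi_presg u) = \pi_presg (winv u).
Proof. by apply/presgP/asboolP/pres_winv; apply: pres_repr. Qed.

Fact presg_mulA : associative presg_mul.
Proof.
elim/quotW=> u; elim/quotW=> v; elim/quotW=> w.
by rewrite (presg_mulE v w) (presg_mulE u v) (presg_mulE u) (presg_mulE _ w) catA.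
Qed.
Fact presg_mul1 : left_id presg_one presg_mul.
Proof. by elim/quotW=> u; rewrite presg_mulE. Qed.
Fact presg_mulr1 : right_id presg_one presg_mul.
Proof. by elim/quotW=> u; rewrite presg_mulE cats0. Qed.
Fact presg_mulV : left_inverse presg_one presg_inv presg_mul.
Proof.
elim/quotW=> u; rewrite presg_invE presg_mulE.
by apply/presgP/asboolP/pres_Vcat.
Qed.
Fact presg_mulrV : right_inverse presg_one presg_inv presg_mul.
Proof.
elim/quotW=> u; rewrite presg_invE presg_mulE.
by apply/presgP/asboolP/pres_catV.
Qed.

HB.instance Definition _ := isGroup.Build presg
  presg_mulA presg_mul1 presg_mulr1 presg_mulV presg_mulrV.

Definition presg_gen (x : X) : presg := \pi_presg [:: (x, false)].

Section Lift.
Variables (H : groupType) (f : X -> H).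
Hypothesis fR : forall r s, R r s ->
  \prod_(x <- r) f x = \prod_(x <- s) f x.

Definition weval (u : word) : H :=
  \prod_(p <- u) (if p.2 then (f p.1)^-1 else f p.1).

Lemma weval_eq (u v : word) : pres_eq u v -> weval u = weval v.
Proof.
elim=> {u v} [||u v w _ -> _ ->|u u' v v' _ uu' _ vv'|x b|r s /fR rs] //.
- by rewrite /weval !big_cat /=; congr (_ * _).
- rewrite /weval big_cons big_seq1 big_nil /=.
  by case: b; rewrite ?mulVg ?mulgV.
- by rewrite /weval !big_map.
Qed.

Definition presg_lift_fun (x : presg) : H := weval (repr x).

Fact presg_lift_morph : {morph presg_lift_fun : x y / x * y}.
Proof.
move=> x y; rewrite /presg_lift_fun (weval_eq (pres_repr _)).
by rewrite /weval big_cat.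
Qed.

Definition presg_lift : {multiplicative presg -> H} :=
  HB.pack presg_lift_fun
    (isMultiplicative.Build presg H presg_lift_fun presg_lift_morph).

Lemma presg_lift_gen (x : X) : presg_lift (presg_gen x) = f x.
Proof.
by rewrite /= /presg_lift_fun (weval_eq (pres_repr _)) /weval big_seq1.
Qed.

End Lift.

End Presentation.

Section Braids.
Variable m : nat.

(* The ordinal i stands for the generator \sigma_{i+1} of B_m. *)
Inductive braid_rel : seq 'I_m.-1 -> seq 'I_m.-1 -> Prop :=
| braid_far (i j : 'I_m.-1) :
    (i.+2 <= j)%N \/ (j.+2 <= i)%N -> braid_rel [:: i; j] [:: j; i]
| braid_adj (i j : 'I_m.-1) :
    j = i.+1 :> nat -> braid_rel [:: j; i; j] [:: i; j; i].

Definition braid := presg braid_rel.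

HB.instance Definition _ := Group.on braid.

Fact strand_subproof (i : 'I_m.-1) : (i.+1 < m)%N.
Proof. by rewrite -ltn_predRL. Qed.

Definition strand_l (i : 'I_m.-1) : 'I_m := Ordinal (ltnW (strand_subproof i)).
Definition strand_r (i : 'I_m.-1) : 'I_m := Ordinal (strand_subproof i).

Definition braid_tperm (i : 'I_m.-1) : 'S_m := tperm (strand_l i) (strand_r i).

Fact braid_tperm_rel r s : braid_rel r s ->
  \prod_(i <- r) braid_tperm i = \prod_(i <- s) braid_tperm i.
Proof.
have neq_ord (a b : 'I_m) : (a : nat) <> b -> a != b.
  by move=> ab; apply/eqP => /(congr1 val).
case=> [i j ij|i j ij]; rewrite !big_cons !big_nil !mulg1 /braid_tperm.
  apply/commute_sym/commgP/conjg_fixP; rewrite tpermJ !tpermD //;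
    by apply: neq_ord => /=; case: ij; lia.
have ejl : strand_l j = strand_r i by apply: val_inj.
have hlr : strand_l i != strand_r i by apply: neq_ord => /=; lia.
have hlj : strand_l i != strand_r j by apply: neq_ord => /=; lia.
have hrj : strand_r i != strand_r j by apply: neq_ord => /=; lia.
rewrite ejl; set a := strand_l i in hlr hlj *; set b := strand_r i in hlr hrj *.
set c := strand_r j in hlj hrj *.
transitivity (tperm a c).
  rewrite -{1}[tperm b c]tpermV -/(conjg _ _) tpermJ tpermL tpermD //;
    by rewrite eq_sym.
rewrite -{1}[tperm a b]tpermV -/(conjg _ _) tpermJ tpermR tpermD //;
  by rewrite eq_sym.
Qed.

(* Products in 'S_m compose from left to right, unlike in autg; the kernel does
   not depend on this. *)
Definition braid_perm : {multiplicative braid -> 'S_m} :=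
  presg_lift braid_tperm_rel.

Definition pure_braid := subgrp (kerg braid_perm).

HB.instance Definition _ := Group.on pure_braid.

End Braids.

Section Phi2.
Variable m : nat.

Definition phi2_fun (f : autg (pure_braid m)) :
    autg (lcs_quot (inng (pure_braid m)) 2) :=
  lcs_autg 2 (inng_autg f).

Fact phi2_morph : {morph phi2_fun : f g / f * g}.
Proof. by move=> f g; rewrite /phi2_fun inng_autgM lcs_autgM. Qed.

Definition phi2 : {multiplicative autg (pure_braid m) ->
    autg (lcs_quot (inng (pure_braid m)) 2)} :=
  HB.pack phi2_fun (isMultiplicative.Build _ _ phi2_fun phi2_morph).

End Phi2.

Section Eigenvalue.
Variable A : groupType.

Definition intexp (x : A) (z : int) : A :=
  match z with Posz n => x ^+ n | Negz n => x ^- n.+1 end.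

Definition lincomb (r : nat) (b : 'I_r -> A) (c : 'rV[int]_r) : A :=
  \prod_(i < r) intexp (b i) (c ord0 i).

Definition zbasis (r : nat) (b : 'I_r -> A) : Prop :=
  (forall x y : A, commute x y) /\ bijective (lincomb b).

(* The action of f on an abelian group is written in row-vector convention:
   row i of M holds the coordinates of f (b i).  Changing the basis conjugates
   M by an invertible integer matrix, and transposing M does not change its
   eigenvalues, so neither choice matters. *)
Definition aut_eigenvalue (f : autg A) (a : algC) : Prop :=
  exists (r : nat) (b : 'I_r -> A) (M : 'M[int]_r),
    [/\ zbasis b,
        forall i, f (b i) = lincomb b (row i M)
      & eigenvalue (map_mx intr M : 'M[algC]_r) a].

End Eigenvalue.

(* Main.v *)
(* The group P = P_m modulo its center is the pure mapping class group of the
   sphere with n = m + 1 punctures, and an integer homomorphism on it is a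
   symmetric weight on pairs of punctures with vanishing row sums.  If two such
   homomorphisms a, b satisfy a x * b y = a y * b x for all commuting x, y, then,
   because twists about disjoint pairs commute, they are proportional or both
   supported on a set of four punctures.  The planes of homomorphisms supported
   on four punctures are therefore permuted by every automorphism alpha of P.
   Three of these planes are linearly dependent exactly when the three sets lie in
   a set of five punctures, and a permutation of the 4-subsets that preserves
   this relation comes from a permutation s of the punctures.  It follows that
   alpha acts on the homomorphisms as +s or -s, and that on Gamma_2/Gamma_3 the
   functionals omega i j k l induced by the 4-subsets are permuted by s without
   sign.  The sum of the omegas over the orbit of one well chosen tuple (i, j, k,
   l) is then invariant, and nonzero as soon as n >= 6; it gives an eigenvector
   for the eigenvalue 1 of the transpose.

   The functionals omega come from homomorphisms P_3 -> F_2 followed by a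
   nilpotent quotient of F_2, and the classes of [A_ij, A_jk], i < j < k, form
   a basis of Gamma_2/Gamma_3 dual to some of them. *)

Require Import Defs.
From HB Require Import structures.
From mathcomp Require Import all_boot all_order all_fingroup all_algebra all_field.
From mathcomp Require Import zify ring generic_quotient boolp.

Set Implicit Arguments.
Unset Strict Implicit.
Unset Printing Implicit Defensive.

Import GRing.Theory Num.Theory.

(** The functionals omega are alternating in the four punctures and linearly dependent across
    4-subsets, so an orbit sum may cancel: a 4-subset on which s induces an odd permutation
    contributes 0. The tuple is therefore chosen for positivity: evaluated at the twists of i, j and
    of j, k, every term of the sum is 0 or 1. The sign in +s or -s disappears because omega is
    quadratic in the homomorphisms. A homomorphism on P itself need not kill the center, so its
    weight need not have row sum zero at the additional puncture; for a non-proportional pair this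
    is a consequence of the commutation condition. Homomorphisms out of P are produced from the
    presentation of the braid group, as crossing weights with values in a wreath product. A
    Heisenberg quotient would suffice to define omega on P, but omega has to descend modulo the
    center, whence the longer nilpotent quotient. Twists enter only through their classes in the
    abelianization, since all that is evaluated is homomorphisms and classes of commutators. *)

Ltac neqs := rewrite /= ?inE ?negb_or; repeat match goal with
  | H : is_true (?x != ?y) |- _ =>
      rewrite ?(negPf H) ?[y == x]eq_sym ?(negPf H); clear H end; by [].

Ltac split_uniq u := rewrite /= ?inE ?negb_or ?andbT in u;
  repeat match goal with H : is_true (andb _ _) |- _ =>
    let h1 := fresh in let h2 := fresh in case/andP: H => h1 h2 end.

(** * Maps on 4-subsets induced by permutations *)

Section SubsetMaps.
Variable T : finType.
Implicit Types (A B C U V D : {set T}) (f g : {set T} -> {set T}).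

(** Three distinct, pairwise adjacent k-subsets either share k-1 points or lie in a common
    (k+1)-set, never both; the size of the triple union tells the two cases apart. *)
Lemma star_cards k A B C : #|A| = k -> #|B| = k -> #|C| = k ->
    #|A :|: B| = k.+1 -> C != A -> C != B ->
  (A :&: B \subset C) =
  [&& #|A :|: C| == k.+1, #|B :|: C| == k.+1 & #|A :|: B :|: C| != k.+1].
Proof.
move=> cA cB cC cAB nCA nCB.
have cI : #|A :&: B| = k.-1 by have := cardsUI A B; lia.
have k0 : 0 < k.
  by rewrite lt0n; apply: contraNneq nCA => k0;
    rewrite (cards0_eq (etrans cA k0)) (cards0_eq (etrans cC k0)).
have meet (X Y : {set T}) : #|X| = k -> #|Y| = k -> X != Y -> #|X :&: Y| < k.
  move=> cX cY nXY; rewrite -cX ltn_neqAle subset_leq_card ?subsetIl // andbT.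
  apply: contra nXY => /eqP e; have sXY : X :&: Y \subset X by apply: subsetIl.
  have /eqP eI : X :&: Y == X by rewrite eqEcard sXY e leqnn.
  by rewrite eqEcard cX cY leqnn andbT -eI subsetIr.
apply/idP/and3P => [sC|[/eqP cAC /eqP cBC nABC]].
- have lAC := meet _ _ cC cA nCA; have lBC := meet _ _ cC cB nCB.
  have sA : A :&: B \subset C :&: A by rewrite subsetI sC subsetIl.
  have sB : A :&: B \subset C :&: B by rewrite subsetI sC subsetIr.
  have eA : A :&: B = C :&: A.
    by apply/eqP; rewrite eqEcard sA /=; move: lAC; lia.
  have eB : A :&: B = C :&: B.
    by apply/eqP; rewrite eqEcard sB /=; move: lBC; lia.
  split.
  + by have := cardsUI A C; rewrite setIC -eA; lia.
  + by have := cardsUI B C; rewrite setIC -eB; lia.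
  + apply/eqP => cABC; have := cardsUI (A :|: B) C.
    by rewrite setIC setIUr -eA -eB setUid; lia.
- have cAC' : #|A :&: C| = k.-1 by have := cardsUI A C; lia.
  have cBC' : #|B :&: C| = k.-1 by have := cardsUI B C; lia.
  have lU : #|(A :|: B) :&: C| <= k.-1.
    have := cardsUI (A :|: B) C.
    have : #|A :|: B| <= #|A :|: B :|: C| by rewrite subset_leq_card ?subsetUl.
    lia.
  have eA : A :&: C = (A :|: B) :&: C.
    by apply/eqP; rewrite eqEcard setSI ?subsetUl //= cAC'.
  have eB : B :&: C = (A :|: B) :&: C.
    by apply/eqP; rewrite eqEcard setSI ?subsetUr //= cBC'.
  have : A :&: C \subset A :&: B.
    by rewrite subsetI subsetIl eA -eB subsetIl.
  move=> s; have /eqP <- : A :&: C == A :&: B by rewrite eqEcard s cAC' cI leqnn.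
  exact: subsetIr.
Qed.

(** The case [B = C] records adjacency in the Johnson graph; proper triples single out one of its
    two kinds of triangles. This excludes taking complements when [#|T|] is 2k, which preserves
    adjacency alone. *)
Definition preserves_triples k f :=
  [/\ forall A, #|A| = k -> #|f A| = k,
      forall A B, #|A| = k -> #|B| = k -> f A = f B -> A = B &
      forall A B C, #|A| = k -> #|B| = k -> #|C| = k ->
        (#|A :|: B :|: C| == k.+1) = (#|f A :|: f B :|: f C| == k.+1)].

Lemma preserves_triples_star k f A B C : preserves_triples k f ->
    #|A| = k -> #|B| = k -> #|C| = k -> #|A :|: B| = k.+1 ->
  (A :&: B \subset C) = (f A :&: f B \subset f C).
Proof.
move=> [fc fi ft] cA cB cC cAB.
have [->|nCA] := eqVneq C A; first by rewrite !subsetIl.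
have [->|nCB] := eqVneq C B; first by rewrite !subsetIr.
have adj (X Y : {set T}) : #|X| = k -> #|Y| = k ->
    (#|X :|: Y| == k.+1) = (#|f X :|: f Y| == k.+1).
  by move=> cX cY; have := ft X Y Y cX cY cY; rewrite -!setUA !setUid.
rewrite (@star_cards k) // (@star_cards k) ?fc //.
- by rewrite (adj A C) // (adj B C) // (ft A B C).
- by apply/eqP; rewrite -adj ?cAB.
- by apply: contra nCA => /eqP/fi ->.
- by apply: contra nCB => /eqP/fi ->.
Qed.

Lemma preserves_triples_onto k f A : preserves_triples k f -> #|A| = k ->
  exists2 B : {set T}, #|B| = k & f B = A.
Proof.
move=> [fc fi _] cA; pose K := [set B : {set T} | #|B| == k].
have fK : f @: K \subset K.
  by apply/subsetP => _ /imsetP[B + ->]; rewrite !inE => /eqP/fc ->.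
have : A \in f @: K.
  suff /eqP -> : f @: K == K by rewrite inE cA.
  rewrite eqEcard fK card_in_imset ?leqnn // => X Y; rewrite !inE => /eqP cX /eqP cY.
  exact: fi.
by case/imsetP => B; rewrite inE => /eqP cB ->; exists B.
Qed.

(** The k-sets that contain a given (k-1)-set [U] are mapped to the k-sets that contain one
    (k-1)-set, recovered here as an intersection. *)
Definition descend k f (U : {set T}) : {set T} :=
  \bigcap_(A : {set T} | (U \subset A) && (#|A| == k)) f A.

Lemma two_extensions k U : k.+1 < #|T| -> #|U| = k ->
  exists A B : {set T}, [/\ #|A| = k.+1, #|B| = k.+1, #|A :|: B| = k.+2 & A :&: B = U].
Proof.
move=> kT cU.
have /set0Pn[x] : ~: U != set0.
  by rewrite -cards_eq0; have := cardsC U; lia.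
rewrite inE => xU.
have /set0Pn[y] : ~: (x |: U) != set0.
  by rewrite -cards_eq0; have := cardsC (x |: U); rewrite cardsU1 xU; lia.
rewrite !inE negb_or => /andP[yx yU].
have e : (x |: U) :&: (y |: U) = U.
  rewrite -setUIl; apply/setUidPr/subsetP => z.
  rewrite !inE => /andP[/eqP -> /eqP e]; by rewrite e eqxx in yx.
exists (x |: U), (y |: U); split=> //; try by rewrite cardsU1 ?xU ?yU cU.
by have := cardsUI (x |: U) (y |: U); rewrite e !cardsU1 xU yU cU; lia.
Qed.

Lemma descend_subset k f U A : k.+1 < #|T| -> preserves_triples k.+1 f ->
    #|U| = k -> #|A| = k.+1 ->
  #|descend k.+1 f U| = k /\ (U \subset A) = (descend k.+1 f U \subset f A).
Proof.
move=> kT pf cU cA; have [B [C [cB cC cBC eBC]]] := two_extensions kT cU.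
(* Two adjacent extensions of [U] already give the intersection: [f D] contains [f B :&: f C] as
   soon as [D] contains [B :&: C]. *)
have -> : descend k.+1 f U = f B :&: f C.
  apply/eqP; rewrite eqEsubset; apply/andP; split.
    by rewrite subsetI; apply/andP; split; apply: bigcap_inf;
      rewrite -eBC ?subsetIl ?subsetIr ?cB ?cC eqxx.
  apply/bigcapsP => D /andP[sD /eqP cD].
  by rewrite -(preserves_triples_star pf cB cC cD cBC) eBC.
split; last by rewrite -(preserves_triples_star pf cB cC cA cBC) eBC.
have [fc _ ft] := pf.
have := ft B C C cB cC cC; rewrite -!setUA !setUid cBC eqxx => /esym/eqP.
by have := cardsUI (f B) (f C); rewrite !fc //; lia.
Qed.

Lemma descend_preserves_triples k f : k.+1 < #|T| ->
  preserves_triples k.+1 f -> preserves_triples k (descend k.+1 f).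
Proof.
move=> kT pf; set g := descend k.+1 f.
have gc U : #|U| = k -> #|g U| = k.
  move=> cU; have [A [_ [cA _ _ _]]] := two_extensions kT cU.
  by have [] := descend_subset kT pf cU cA.
have gs U A : #|U| = k -> #|A| = k.+1 -> (U \subset A) = (g U \subset f A).
  by move=> cU cA; have [] := descend_subset kT pf cU cA.
have gi (U V : {set T}) : #|U| = k -> #|V| = k -> g U = g V -> U = V.
  move=> cU cV e; have [A [B [cA cB _ eU]]] := two_extensions kT cU.
  apply/esym/eqP; rewrite eqEcard cU cV leqnn andbT -eU subsetI.
  by rewrite (gs V A) // (gs V B) // -e -!gs // -eU subsetIl subsetIr.
have sub3 (X Y Z : {set T}) : [/\ X \subset X :|: Y :|: Z,
    Y \subset X :|: Y :|: Z & Z \subset X :|: Y :|: Z].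
  by split; apply/subsetP => z zX; rewrite !inE zX ?orbT.
have eq3 (X Y Z : {set T}) : #|X| = k -> #|Y| = k -> #|Z| = k -> #|X :|: Y :|: Z| = k ->
    X = Y /\ X = Z.
  move=> cX cY cZ cU.
  have [sX sY sZ] := sub3 X Y Z.
  have eX : X = X :|: Y :|: Z by apply/eqP; rewrite eqEcard sX cU cX leqnn.
  rewrite -eX in sY sZ.
  by split; apply/esym/eqP; rewrite eqEcard cX ?cY ?cZ leqnn andbT.
have ge3 (X Y Z : {set T}) : #|X| = k -> k <= #|X :|: Y :|: Z|.
  by move=> <-; rewrite subset_leq_card //; have [] := sub3 X Y Z.
split=> // A B C cA cB cC; apply/eqP/eqP => cU.
- have sU : g A :|: g B :|: g C \subset f (A :|: B :|: C).
    by have [sA sB sC] := sub3 A B C; rewrite !subUset -!gs // sA sB.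
  have [fc _ _] := pf.
  have := subset_leq_card sU; rewrite fc // => le1.
  have := ge3 (g A) (g B) (g C) (gc _ cA); rewrite leq_eqVlt => /orP[/eqP e|].
    have [/gi eAB /gi eAC] := eq3 _ _ _ (gc _ cA) (gc _ cB) (gc _ cC) (esym e).
    by move: cU; rewrite -eAB // -eAC // !setUid cA; lia.
  by move=> lt1; lia.
- have [D cD eD] := preserves_triples_onto pf cU.
  have sD : A :|: B :|: C \subset D.
    have [sA sB sC] := sub3 (g A) (g B) (g C).
    by rewrite !subUset (gs A) ?(gs B) ?(gs C) // eD sA sB.
  have := subset_leq_card sD; rewrite cD => le1.
  have := ge3 A B C cA; rewrite leq_eqVlt => /orP[/eqP e|lt1]; last by lia.
  have [eAB eAC] := eq3 _ _ _ cA cB cC (esym e).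
  by move: cU; rewrite -eAB -eAC !setUid gc //; lia.
Qed.

(** Descending from 4-sets to singletons produces the permutation. Inclusions survive at each level,
    so a flag of subsets from the singleton of [x] up to [A] puts [s x] into [f A]. *)
Lemma preserves_triples_perm f : 4 < #|T| -> preserves_triples 4 f ->
  exists s : {perm T}, forall A, #|A| = 4 -> f A = s @: A.
Proof.
move=> T4 p4.
have p3 := descend_preserves_triples T4 p4.
have p2 := descend_preserves_triples (ltnW T4) p3.
have p1 := descend_preserves_triples (ltnW (ltnW T4)) p2.
set f3 := descend 4 f in p3; set f2 := descend 3 f3 in p2.
set f1 := descend 2 f2 in p1.
have s4 U A : #|U| = 3 -> #|A| = 4 -> U \subset A -> f3 U \subset f A.
  by move=> cU cA; have [_ ->] := descend_subset T4 p4 cU cA.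
have s3 U A : #|U| = 2 -> #|A| = 3 -> U \subset A -> f2 U \subset f3 A.
  by move=> cU cA; have [_ ->] := descend_subset (ltnW T4) p3 cU cA.
have s2 U A : #|U| = 1 -> #|A| = 2 -> U \subset A -> f1 U \subset f2 A.
  by move=> cU cA; have [_ ->] := descend_subset (ltnW (ltnW T4)) p2 cU cA.
have /fin_all_exists[h hE] x : exists y, f1 [set x] = [set y].
  by apply/cards1P; have [-> //] := p1; rewrite cards1.
have h_inj : injective h.
  move=> x y e; apply: set1_inj; have [_ fi _] := p1.
  by apply: fi; rewrite ?cards1 // !hE e.
exists (perm h_inj) => A cA; apply/esym/eqP.
have [fc _ _] := p4.
rewrite eqEcard fc // card_imset ?cA //=; last exact: perm_inj.
rewrite andbT; apply/subsetP => _ /imsetP[x xA ->]; rewrite permE -sub1set -hE.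
have [y yA yx] : exists2 y, y \in A & y != x.
  have /set0Pn[y] : A :\ x != set0.
    by rewrite -cards_eq0; have := cardsD1 x A; rewrite xA cA; lia.
  by rewrite !inE => /andP[? ?]; exists y.
have [z zA /andP[zx zy]] : exists2 z, z \in A & (z != x) && (z != y).
  have /set0Pn[z] : A :\ x :\ y != set0.
    rewrite -cards_eq0; have := cardsD1 x A; rewrite xA cA.
    by have := cardsD1 y (A :\ x); rewrite !inE yx yA; lia.
  by rewrite !inE => /and3P[zy zx zA]; exists z; rewrite ?zx.
have c2 : #|[set x; y]| = 2 by rewrite cards2 eq_sym yx.
have c3 : #|z |: [set x; y]| = 3.
  by rewrite cardsU1 c2 !inE negb_or zx zy.
apply: subset_trans (s2 _ _ (cards1 x) c2 _) _.
  by rewrite sub1set !inE eqxx.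
apply: subset_trans (s3 _ _ c2 c3 _) (s4 _ _ c3 cA _); first exact: subsetUr.
by rewrite !subUset !sub1set xA yA zA.
Qed.

End SubsetMaps.

(** * Resonance for weights on pairs *)

Section Weights.
Local Open Scope ring_scope.
Variable T : finType.
Implicit Types (a b v w : T -> T -> int) (S : {set T}).

Definition balanced v :=
  [/\ forall p q, v p q = v q p, forall p, v p p = 0
    & forall p, \sum_q v p q = 0].

Definition supported v S := forall p q, p \notin S -> v p q = 0.

Lemma sum_except2 (F : T -> int) (u w : T) : u != w ->
  (forall q, q != u -> q != w -> F q = 0) -> \sum_q F q = F u + F w.
Proof.
move=> uw F0; rewrite (bigD1 u) //= (bigD1 w) 1?eq_sym //= big1 ?addr0 //.
by move=> q /andP[qu qw]; apply: F0.
Qed.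

Lemma card_set4 (i j k l : T) : uniq [:: i; j; k; l] -> #|[set i; j; k; l]| = 4%N.
Proof.
move=> u; have <- : size [:: i; j; k; l] = 4%N by [].
rewrite -(card_uniqP u) -cardsE; apply: eq_card => x.
by rewrite !inE -!orbA.
Qed.

Section Resonance.
Variables a b : T -> T -> int.
Hypotheses (ba : balanced a) (bb : balanced b).

Let D p q r s := a p q * b r s - a r s * b p q.
Hypothesis D0 : forall p q r s, uniq [:: p; q; r; s] -> D p q r s = 0.

Let aC : forall p q, a p q = a q p. Proof. by case: ba. Qed.
Let bC : forall p q, b p q = b q p. Proof. by case: bb. Qed.
Let add : forall p, a p p = 0. Proof. by case: ba. Qed.
Let bdd : forall p, b p p = 0. Proof. by case: bb. Qed.
Let DN p q r s : D p q r s = - D r s p q. Proof. by rewrite /D; ring. Qed.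
Let DC p q r s : D p q r s = D p q s r. Proof. by rewrite /D [a r s]aC [b r s]bC. Qed.
Let DCl p q r s : D p q r s = D q p r s.
Proof. by rewrite /D [a p q]aC [b p q]bC. Qed.
Let Ddd p q r : D p q r r = 0. Proof. by rewrite /D add bdd; ring. Qed.
Let Dee p q : D p q p q = 0. Proof. by rewrite /D; ring. Qed.
Let Dsum p q r : \sum_s D p q r s = 0.
Proof.
rewrite /D sumrB -mulr_sumr -mulr_suml.
by case: ba => _ _ ->; case: bb => _ _ ->; rewrite mulr0 mul0r subr0.
Qed.

(** [D] lists the 2x2 minors of the two-row matrix (a, b) with columns indexed by edges. Row sums
    carry the nonzero minor around the triangle x, y, z and force a fourth vertex; a Plücker
    relation shows that it is unique. *)
Lemma resonance_at x y z : x != y -> x != z -> y != z -> D x y x z != 0 ->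
  exists S : {set T}, [/\ #|S| = 4%N, supported a S & supported b S].
Proof.
move=> xy xz yz d0.
have far r s : r != x -> r != y -> s != x -> s != y -> D x y r s = 0.
  move=> rx ry sx sy; have [->|rs] := eqVneq r s; first exact: Ddd.
  by apply: D0; neqs.
have far' r s : r != x -> r != z -> s != x -> s != z -> D x z r s = 0.
  move=> rx rz sx sz; have [->|rs] := eqVneq r s; first exact: Ddd.
  by apply: D0; neqs.
have yx : y != x by rewrite eq_sym.
have zx : z != x by rewrite eq_sym.
have zy : z != y by rewrite eq_sym.
(* Cramer's rule: the columns of the edges xy and xz are independent. *)
have vanish r s : D x y r s = 0 -> D x z r s = 0 -> a r s = 0 /\ b r s = 0.
  rewrite /D => e1 e2; split; apply/eqP; rewrite -(mulIr_eq0 _ (mulIf d0)) /D.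
    suff -> : a r s * (a x y * b x z - a x z * b x y) =
      a x z * (a x y * b r s - a r s * b x y)
      - a x y * (a x z * b r s - a r s * b x z) by rewrite e1 e2 !mulr0 subr0.
    by ring.
  suff -> : b r s * (a x y * b x z - a x z * b x y) =
    b x z * (a x y * b r s - a r s * b x y)
    - b x y * (a x z * b r s - a r s * b x z) by rewrite e1 e2 !mulr0 subr0.
  by ring.
have e1 : D x z y z = D x y x z.
  have : D x z y x + D x z y z = 0.
    rewrite -(Dsum x z y); apply/esym/sum_except2 => // q qx qz.
    exact: far'.
  by rewrite (DN x z y x) [D y x x z]DCl => /eqP; rewrite addrC subr_eq0 => /eqP.
have e2 : D x y y z = - D x y x z.
  have : D x y z x + D x y z y = 0.
    rewrite -(Dsum x y z); apply/esym/sum_except2 => // q qx qy.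
    exact: far.
  by rewrite (DC x y z x) (DC x y z y) addrC => /eqP; rewrite addr_eq0 => /eqP.
(* In the row sum at [y], the term at [x] is 0 and the term at [z] is not, so another vertex must
   compensate. *)
have [k /and4P[kx ky kz dk]] : exists k, [&& k != x, k != y, k != z & D x y y k != 0].
  apply/existsP; apply: contraTT isT => /existsPn nk.
  have := Dsum x y y; rewrite (@sum_except2 _ x z) //.
    by rewrite (DC x y y x) Dee add0r e2 => /eqP; rewrite oppr_eq0 (negPf d0).
  move=> q qx qz; have [->|qy] := eqVneq q y; first exact: Ddd.
  by have := nk q; rewrite qx qy qz /= negbK => /eqP.
have [l /and4P[lx ly lz dl]] : exists l, [&& l != x, l != y, l != z & D x z z l != 0].
  apply/existsP; apply: contraTT isT => /existsPn nk.
  have := Dsum x z z; rewrite (@sum_except2 _ x y) //.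
    by rewrite (DC x z z x) Dee add0r (DC x z z y) e1 => /eqP; rewrite (negPf d0).
  move=> q qx qy; have [->|qz] := eqVneq q z; first exact: Ddd.
  by have := nk q; rewrite qx qy qz /= negbK => /eqP.
(* Plücker relation; both products on its right contain a minor of disjoint edges. *)
have pl r s : r != x -> r != y -> r != z -> s != x -> s != y -> s != z ->
    r != s -> D x y y r * D x z z s = 0.
  move=> rx ry rz sx sy sz rs.
  have h1 : D y r z s = 0.
    by apply: D0; neqs.
  have h2 : D x y z s = 0 by apply: far.
  have h3 : D x z y r = 0 by apply: far'.
  have -> : D x y y r * D x z z s = D x y x z * D y r z s + D x y z s * D x z y r.
    by rewrite /D; ring.
  by rewrite h1 h2 mulr0 mul0r addr0.
have ekl : k = l.
  apply/eqP; apply: contraT => kl.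
  by have /eqP := pl k l kx ky kz lx ly lz kl; rewrite mulf_eq0 (negPf dk) (negPf dl).
rewrite -{}ekl in lx ly lz dl.
have z1 r : r != x -> r != y -> r != z -> r != k -> D x y y r = 0.
  move=> rx ry rz rk.
  by have /eqP := pl r k rx ry rz kx ky kz rk; rewrite mulf_eq0 (negPf dl) orbF => /eqP.
have z2 r : r != x -> r != y -> r != z -> r != k -> D x z z r = 0.
  move=> rx ry rz rk; rewrite eq_sym in rk.
  by have /eqP := pl k r kx ky kz rx ry rz rk; rewrite mulf_eq0 (negPf dk) => /eqP.
pose S := [set x; y; z; k].
have vS p q : p \notin S -> q != x -> a p q = 0 /\ b p q = 0.
  rewrite !inE !negb_or -!andbA => /and4P[px py pz pk] qx.
  have [->|qy] := eqVneq q y.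
    apply: vanish; rewrite DC; first exact: z1.
    by apply: far'.
  have [->|qz] := eqVneq q z.
    apply: vanish; rewrite DC; last exact: z2.
    by apply: far.
  by apply: vanish; [apply: far | apply: far'].
have vx v p : balanced v -> (forall q, q != x -> v p q = 0) -> v p x = 0.
  move=> [_ _ rs] h; have := rs p; rewrite (bigD1 x) //= big1 ?addr0 //.
exists S; split.
- by apply: card_set4; neqs.
- move=> p q pS; have [->|qx] := eqVneq q x; last by case: (vS p q pS qx).
  by apply: vx ba _ => r rx; case: (vS p r pS rx).
- move=> p q pS; have [->|qx] := eqVneq q x; last by case: (vS p q pS qx).
  by apply: vx bb _ => r rx; case: (vS p r pS rx).
Qed.

(** Minors of disjoint edges vanish, so the nonzero one belongs to two edges with a common vertex;
    the symmetries of [D] move that vertex to the first places. *)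
Lemma resonance p q r s : D p q r s != 0 ->
  exists S : {set T}, [/\ #|S| = 4%N, supported a S & supported b S].
Proof.
move=> d0; have [e|pq] := eqVneq p q.
  by rewrite e DN Ddd oppr0 eqxx in d0.
have [e|rs] := eqVneq r s; first by rewrite e Ddd eqxx in d0.
have sp x y z : x != y -> x != z -> D x y x z != 0 ->
    exists S : {set T}, [/\ #|S| = 4%N, supported a S & supported b S].
  move=> xy xz d1; have [e|yz] := eqVneq y z; last exact: resonance_at d1.
  by rewrite e Dee eqxx in d1.
have [e|pr] := eqVneq p r; first by subst r; apply: sp d0.
have [e|ps] := eqVneq p s.
  by subst s; apply: (@sp p q r) => //; rewrite -DC.
have [e|qr] := eqVneq q r.
  by subst r; apply: (@sp q p s); [neqs | | rewrite DCl].
have [e|qs] := eqVneq q s.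
  by subst s; apply: (@sp q p r); [neqs | | rewrite DCl DC].
by rewrite D0 ?eqxx // in d0; neqs.
Qed.

End Resonance.

(* The symmetric product of (delta_i - delta_j) and (delta_k - delta_l).  The
   weights quad i j k l and quad i k j l span the pullback of H^1(M_{0,4}) along
   the map that forgets all punctures but i, j, k, l. *)
Definition quad (i j k l : T) : T -> T -> int := fun p q =>
  ((p == i)%:R - (p == j)%:R) * ((q == k)%:R - (q == l)%:R)
  + ((q == i)%:R - (q == j)%:R) * ((p == k)%:R - (p == l)%:R).

Lemma set4_of_card S : #|S| = 4%N ->
  exists i j k l : T, uniq [:: i; j; k; l] /\ S = [set i; j; k; l].
Proof.
move=> cS; have := enum_uniq S; have := mem_enum S.
rewrite cardE in cS; case: (enum S) cS => [|i [|j [|k [|l [|]]]]] //= _ eS u.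
by exists i, j, k, l; split=> //; apply/setP => x; rewrite -eS !inE -!orbA.
Qed.

Lemma sum_supported4 v (i j k l p : T) : uniq [:: i; j; k; l] -> balanced v ->
  supported v [set i; j; k; l] ->
  v p i + v p j + v p k + v p l = 0.
Proof.
move=> u [vC vd vs] sv; have <- := vs p.
rewrite (bigID [in [:: i; j; k; l]]) /= [X in _ = _ + X]big1.
  by rewrite -big_uniq //= !big_cons big_nil; ring.
by move=> q; rewrite !inE => h; rewrite vC sv // !inE -!orbA.
Qed.

(** On the complete graph with four vertices the row sums leave two parameters: opposite edges
    agree, and the values of the three perfect matchings add up to zero. *)
Lemma supported4_values v (i j k l : T) : uniq [:: i; j; k; l] -> balanced v ->
    supported v [set i; j; k; l] ->
  [/\ v k l = v i j, v j l = v i k, v j k = - v i j - v i k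
    & v i l = - v i j - v i k].
Proof.
move=> u bv sv; have [vC vd _] := bv.
have := (sum_supported4 i u bv sv, sum_supported4 j u bv sv,
  sum_supported4 k u bv sv, sum_supported4 l u bv sv).
rewrite !vd (vC j i) (vC k i) (vC k j) (vC l i) (vC l j) (vC l k).
by case=> [] [] [] h1 h2 h3 h4; split; lia.
Qed.

(** [quad i j k l] is 1 at (i, k) and 0 at (i, j), and [quad i k j l] the other way round; this
    gives the coefficients. *)
Lemma supported4_quad v (i j k l : T) : uniq [:: i; j; k; l] -> balanced v ->
    supported v [set i; j; k; l] ->
  forall p q, v p q = v i k * quad i j k l p q + v i j * quad i k j l p q.
Proof.
move=> u bv sv p q; have [vC vd _] := bv.
have [h1 h2 h3 h4] := supported4_values u bv sv.
have [pS|pS] := boolP (p \in [set i; j; k; l]); last first.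
  rewrite sv //; move: pS; rewrite !inE !negb_or -!andbA => /and4P[pi pj pk pl].
  by rewrite /quad (negPf pi) (negPf pj) (negPf pk) (negPf pl); ring.
have [qS|qS] := boolP (q \in [set i; j; k; l]); last first.
  rewrite vC sv //; move: qS; rewrite !inE !negb_or -!andbA => /and4P[pi pj pk pl].
  by rewrite /quad (negPf pi) (negPf pj) (negPf pk) (negPf pl); ring.
move: u; rewrite /= !inE !negb_or !andbT -!andbA.
case/and5P=> ij ik il jk /andP[jl kl]; move: pS qS; rewrite !inE -!orbA.
by case/or4P=> /eqP ->; case/or4P=> /eqP ->; rewrite /quad !eqxx
  ?[j == i]eq_sym ?[k == i]eq_sym ?[l == i]eq_sym ?[k == j]eq_sym
  ?[l == j]eq_sym ?[l == k]eq_sym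
  ?(negPf ij) ?(negPf ik) ?(negPf il) ?(negPf jk) ?(negPf jl) ?(negPf kl)
  ?vd ?[v j i]vC ?[v k i]vC ?[v l i]vC ?[v k j]vC ?[v l j]vC ?[v l k]vC
  ?h1 ?h2 ?h3 ?h4 /=; ring.
Qed.


Lemma supported4_vanish v S p q r : #|S| = 4%N -> balanced v ->
    supported v S -> p \in S -> q \in S -> r \in S -> uniq [:: p; q; r] ->
    v p q = 0 -> v p r = 0 -> forall x y, v x y = 0.
Proof.
move=> cS bv sv pS qS rS u vq vr.
have /set0Pn[s] : S :\: [set p; q; r] != set0.
  rewrite -cards_eq0; have := cardsID [set p; q; r] S.
  have : (#|S :&: [set p; q; r]| <= 3)%N.
    apply: leq_trans (subset_leq_card (subsetIr _ _)) _.
    by rewrite setUC cardsU1 cards2; case: (r \notin _); case: (p != q).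
  by lia.
rewrite !inE !negb_or -!andbA => /and4P[sp sq sr sS] x y.
have u4 : uniq [:: p; q; r; s].
  by move: u; rewrite /= !inE !negb_or !andbT => /andP[/andP[? ?] ?]; neqs.
have eS : S = [set p; q; r; s].
  apply/esym/eqP; rewrite eqEcard cS card_set4 // leqnn andbT.
  by rewrite !subUset !sub1set pS qS rS.
rewrite eS in sv; rewrite (supported4_quad u4 bv sv) vq vr.
by rewrite !mul0r addr0.
Qed.

Lemma supported4_full v S p : #|S| = 4%N -> balanced v -> supported v S ->
  (exists x y, v x y != 0) -> p \in S -> exists q, v p q != 0.
Proof.
move=> cS bv sv [x [y vxy]] pS; apply/existsP; apply: contraTT isT => /existsPn h.
have v0 q : v p q = 0 by apply/eqP; have := h q; rewrite negbK.
have c1 : #|S :\ p| = 3%N by have := cardsD1 p S; rewrite pS cS => -[].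
have /set0Pn[q qS1] : S :\ p != set0 by rewrite -cards_eq0 c1.
have c2 : #|S :\ p :\ q| = 2%N.
  by have := cardsD1 q (S :\ p); rewrite qS1 c1 => -[].
have /set0Pn[r] : S :\ p :\ q != set0 by rewrite -cards_eq0 c2.
move: qS1; rewrite !inE => /andP[qp qS] /and3P[rq rp rS].
rewrite (@supported4_vanish v S p q r) ?eqxx // in vxy.
by neqs.
Qed.

(** A nonzero weight of this kind has a nonzero edge at each of its four points, so the planes of
    distinct 4-sets meet only in 0. *)
Lemma supported4_inj v S S' : #|S| = 4%N -> #|S'| = 4%N -> balanced v ->
    supported v S -> supported v S' -> (exists x y, v x y != 0) -> S = S'.
Proof.
move=> cS cS' bv sv sv' nv; apply/eqP; rewrite eqEcard cS cS' leqnn andbT.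
apply/subsetP => p pS; have [q] := supported4_full cS bv sv nv pS.
by apply: contraNT => pS'; rewrite sv'.
Qed.

Lemma supported4_dependent v1 v2 v3 S1 S2 S3 :
    #|S1| = 4%N -> #|S2| = 4%N -> #|S3| = 4%N -> S1 != S2 -> S1 != S3 ->
    balanced v1 -> balanced v2 -> balanced v3 ->
    supported v1 S1 -> supported v2 S2 -> supported v3 S3 ->
    (exists x y, v1 x y != 0) -> (forall x y, v1 x y = v2 x y + v3 x y) ->
  #|S1 :|: S2 :|: S3| = 5%N.
Proof.
move=> c1 c2 c3 n12 n13 b1 b2 b3 s1 s2 s3 nv e.
have [v1C _ _] := b1; have [v2C _ _] := b2; have [v3C _ _] := b3.
have in23 p : p \in S1 -> (p \in S2) || (p \in S3).
  move=> pS; have [q] := supported4_full c1 b1 s1 nv pS.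
  apply: contraNT; rewrite negb_or => /andP[p2 p3].
  by rewrite e s2 // s3 // addr0.
have nz3 : exists x y, v3 x y != 0.
  have [x [y n1]] := nv; have [h|h] := boolP [exists x, exists y, v3 x y != 0].
    by have /existsP[x' /existsP[y' ?]] := h; exists x', y'.
  have v30 x' y' : v3 x' y' = 0.
    apply/eqP; apply: contraNT h => h; apply/existsP; exists x'.
    by apply/existsP; exists y'.
  case/eqP: n12; apply: (supported4_inj c1 c2 b1 s1 _ nv) => p q p2.
  by rewrite e v30 s2 // addr0.
have sub3 : S3 \subset S1 :|: S2.
  apply/subsetP => p p3; have [q] := supported4_full c3 b3 s3 nz3 p3.
  apply: contraNT; rewrite inE negb_or => /andP[p1 p2].
  by have := e p q; rewrite s1 // s2 // add0r => <-.
have diff S S' : #|S| = 4%N -> #|S'| = 4%N -> S != S' -> exists2 p, p \in S & p \notin S'.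
  move=> cS cS'; rewrite eqEcard cS cS' leqnn andbT => /subsetPn[p pS pS'].
  by exists p.
(* Given [p] in [S1] outside [S3] and two points [q], [r] of [S1] outside [S2], both summands vanish
   on the edges pq and pr, which forces [v1] to be 0. *)
have d1 : #|S1 :\: S2| = 1%N.
  have [p p1 p3] := diff _ _ c1 c3 n13.
  have p2 : p \in S2 by have := in23 _ p1; rewrite (negPf p3) orbF.
  have [q q1 q2] := diff _ _ c1 c2 n12.
  apply/eqP/cards1P; exists q; apply/eqP; rewrite eqEsubset.
  apply/andP; split; last by rewrite sub1set inE q1 q2.
  apply/subsetP => r; rewrite !inE => /andP[r2 r1].
  apply: contraT => rq; have [x [y]] := nv.
  rewrite (@supported4_vanish v1 S1 p q r) ?eqxx //.
  - rewrite /= !inE andbT negb_or [q == r]eq_sym rq andbT.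
    by apply/andP; split; apply: contraTneq p2 => ->.
  - by rewrite e v2C s2 // s3 // addr0.
  - by rewrite e v2C s2 // s3 // addr0.
have /setUidPl -> := sub3.
by have := cardsUI S1 S2; have := cardsID S2 S1; lia.
Qed.

Lemma balanced_quad (i j k l : T) : uniq [:: i; j; k; l] ->
  balanced (quad i j k l).
Proof.
move=> u; split=> [p q|p|p]; first by rewrite /quad addrC.
  move: u; rewrite /= !inE !negb_or !andbT -!andbA.
  case/and5P=> ij ik il jk /andP[jl kl]; rewrite /quad.
  have [->|pi] := eqVneq p i.
    by rewrite (negPf ik) (negPf il); ring.
  have [->|pj] := eqVneq p j; first by rewrite (negPf jk) (negPf jl); ring.
  by ring.
have sum1 x : \sum_q ((q == x)%:R : int) = 1.
  by rewrite (bigD1 x) //= eqxx big1 ?addr0 // => q /negPf ->.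
by rewrite /quad big_split /= -mulr_sumr -mulr_suml !sumrB !sum1; ring.
Qed.

Lemma supported_quad (i j k l : T) : supported (quad i j k l) [set i; j; k; l].
Proof.
move=> p q; rewrite !inE !negb_or -!andbA => /and4P[pi pj pk pl].
by rewrite /quad (negPf pi) (negPf pj) (negPf pk) (negPf pl); ring.
Qed.

End Weights.

(** * Tuples isolated in their orbit *)

Section OrbitTuples.
Variable T : finType.
Implicit Types (s : {perm T}) (f : T -> T) (A : {set T}).

Definition rotates f (i j k : T) :=
  [\/ [/\ f i = i, f j = j & f k = k], [/\ f i = j, f j = k & f k = i]
    | [/\ f i = k, f j = i & f k = j]].

(* Makes all the terms nonnegative in the sum, over the orbit of (i, j, k, l)
   under s, of omega evaluated at the twists of i, j and of j, k. *)
Definition isolated_tuple s (i j k l : T) := forall t : nat,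
  {subset [:: i; j; k] <= map (iter t s) [:: i; j; k; l]} ->
  rotates (iter t s) i j k.

Lemma exists_notin (u : seq T) : (size u < #|T|)%N -> exists x, x \notin u.
Proof.
move=> lt; apply/existsP; apply: contraTT lt => /existsPn h.
rewrite -leqNgt; apply: leq_trans (card_size u); apply/subset_leq_card/subsetP => x _.
by have := h x; rewrite negbK.
Qed.

(** The translates of [l] avoid the orbit of [i], so the power of [s] maps the arc i, s i, s (s i)
    onto itself: it fixes the arc pointwise, or the orbit is a 3-cycle that it rotates. *)
Lemma isolated_off_orbit s i l : s (s i) != i -> l \notin porbit s i ->
  uniq [:: i; s i; s (s i); l] /\ isolated_tuple s i (s i) (s (s i)) l.
Proof.
move=> ssi lo.
have si : s i != i by apply: contraNneq ssi => e; rewrite !e.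
have notl t e : iter t s i != iter e s l.
  apply: contraNneq lo; rewrite -!permX => h.
  rewrite -eq_porbit_mem -(porbit_perm s t i) h porbit_perm; exact: eqxx.
split.
  have i0 := notl 0 0; have i1 := notl 1 0; have i2 := notl 2 0; rewrite /= in i0 i1 i2.
  by rewrite /= !inE !negb_or eq_sym si [i == _]eq_sym ssi i0 i1 i2
    (inj_eq perm_inj) eq_sym si.
move=> t sub.
have shift x : iter t s (s x) = s (iter t s x) by rewrite -iterSr.
have mem x : x \in [:: i; s i; s (s i)] ->
    [|| x == iter t s i, x == s (iter t s i) | x == s (s (iter t s i))].
  move=> xi; have := sub x xi; rewrite /= !shift !inE => /or4P[->|->|->|] //; rewrite ?orbT //.
  have [e ->] : exists e, x = iter e s i.
    by move: xi; rewrite !inE => /or3P[] /eqP ->; [exists 0|exists 1|exists 2].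
  by rewrite (negPf (notl _ _)).
rewrite /rotates !shift.
have := mem i; rewrite inE eqxx => /(_ isT)/or3P[] /eqP ei.
- by apply: Or31; rewrite -ei.
- apply: Or33; have := mem (s (s i)); rewrite !inE eqxx !orbT => /(_ isT).
  rewrite -ei (negPf ssi) (inj_eq perm_inj) (negPf si) !orbF => /eqP ey.
  have e3 : s (s (s i)) = i by rewrite ey -ei.
  by rewrite -ey ?e3.
- apply: Or32; have := mem (s i); rewrite !inE eqxx !orbT => /(_ isT).
  rewrite -ei (negPf si) orbF (inj_eq perm_inj) => /orP[] /eqP ey.
    have e3 : s (s (s i)) = i by rewrite ey -ei.
    by rewrite -ey ?e3.
  by rewrite -ey in ei; rewrite -ei eqxx in ssi.
Qed.

(** The tuple occupies the places 0, 1, 3, 2 of the cycle. Modulo N > 5, four consecutive residues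
    contain 0, 1 and 3 only if they start at 0. With 0, 1, 2 as first three places, the window
    starting at -1 would qualify as well and enter with sign -1. *)
Lemma isolated_cycle s i : (5 < #|porbit s i|)%N ->
  exists j k l : T, uniq [:: i; j; k; l] /\ isolated_tuple s i j k l.
Proof.
set N := #|porbit s i| => N5.
have inj a b : (a < N)%N -> (b < N)%N -> iter a s i = iter b s i -> a = b.
  move=> aN bN e; apply/eqP.
  rewrite -(nth_uniq i _ _ (uniq_traject_porbit s i)) ?size_traject //.
  by rewrite !nth_traject // e.
have wrap a : iter a s i = iter (a %% N) s i.
  rewrite {1}(divn_eq a N) addnC iterD; congr iter.
  by elim: (a %/ N) => //= q IH; rewrite mulSn iterD IH iter_porbit.
have injm a b : (b < N)%N -> iter a s i = iter b s i -> (a %% N)%N = b.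
  by move=> bN; rewrite wrap => /inj -> //; rewrite ltn_mod; lia.
exists (s i), (iter 3 s i), (iter 2 s i).
have ne a b : (a < N)%N -> (b < N)%N -> a != b -> iter a s i != iter b s i.
  by move=> aN bN; apply: contraNneq => /inj ->.
split.
  have := (ne 0 1, ne 0 2, ne 0 3, ne 1 2, ne 1 3, ne 2 3).
  rewrite /= !inE !negb_or => [] [] [] [] [] [] h1 h2 h3 h4 h5 h6.
  rewrite h1 ?h2 ?h3 ?h4 ?h5 1?eq_sym ?h6 //; lia.
move=> t sub; have mem a : a \in [:: 0; 1; 3]%N ->
    [|| (a == (t %% N))%N, a == ((t + 1) %% N)%N, a == ((t + 3) %% N)%N
      | a == ((t + 2) %% N)%N].
  move=> ha; have aN : (a < N)%N by move: ha; rewrite !inE => /or3P[] /eqP ->; lia.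
  have : iter a s i \in map (iter t s) [:: i; s i; iter 3 s i; iter 2 s i].
    by apply: sub; move: ha; rewrite !inE => /or3P[] /eqP ->; rewrite eqxx ?orbT.
  have e : map (iter t s) [:: i; s i; iter 3 s i; iter 2 s i] =
     [:: iter t s i; iter (t + 1) s i; iter (t + 3) s i; iter (t + 2) s i].
    by rewrite /= !iterD.
  rewrite e !inE.
  by case/or4P=> /eqP/esym/injm -> //; rewrite eqxx ?orbT.
have t0 : (t %% N = 0)%N.
  have := (mem 0, mem 1, mem 3); rewrite !inE /= => [] [] [] /(_ isT) m0 /(_ isT) m1 /(_ isT) m3.
  have red r e : (r < N)%N -> (e < 4)%N ->
      ((r + e) %% N = r + e \/ (r + e) %% N + N = r + e)%N.
    move=> rN e4; case: (ltnP (r + e) N) => h; first by left; rewrite modn_small.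
    have lt : (r + e - N < N)%N by lia.
    by right; rewrite -{1}(subnKC h) modnDl modn_small // subnK.
  have N0 : (0 < N)%N by lia.
  have := red _ 3%N (ltn_pmod t N0) isT; have := red _ 2%N (ltn_pmod t N0) isT.
  have := red _ 1%N (ltn_pmod t N0) isT; rewrite !modnDml => r1 r2 r3.
  move: m0 m1 m3 r1 r2 r3; move: (t %% N)%N ((t + 1) %% N)%N ((t + 2) %% N)%N ((t + 3) %% N)%N.
  clear -N5; move: N N5 => N N5 a b c d.
  move=> /or4P[] /eqP h0 /or4P[] /eqP h1 /or4P[] /eqP h2 r1 r2 r3; lia.
have it e : iter t s (iter e s i) = iter e s i.
  by rewrite -iterD addnC iterD (wrap t) t0.
by apply: Or31; split; [apply: (it 0) | apply: (it 1) | apply: (it 3)].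
Qed.

(** Four fixed points form a suitable tuple. Otherwise there are two distinct 2-cycles, and the
    tuple i, s i, k, l is taken with [s k] left out, so that its image under an odd power misses
    [k]. *)
Lemma isolated_involution s : (5 < #|T|)%N -> (forall x, s (s x) = x) ->
  exists i j k l, uniq [:: i; j; k; l] /\ isolated_tuple s i j k l.
Proof.
move=> T5 ss; have it t x : iter t s x = if odd t then s x else x.
  by elim: t => //= t ->; case: (odd t).
have [f4|f4] := leqP 4 #|[set x | s x == x]|.
  have := mem_enum [set x | s x == x]; have := enum_uniq [set x | s x == x].
  rewrite cardE in f4; move: f4; case: (enum _) => [|i [|j [|k [|l u]]]] //= _ uq fx.
  exists i, j, k, l; split.
    move: uq; rewrite !inE !negb_or -!andbA.
    case/andP=> ij /andP[ik /andP[il /andP[_ /andP[jk /andP[jl /andP[_ /andP[kl _]]]]]]].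
    by neqs.
  have fix_ x : x \in [:: i, j, k, l & u] -> s x = x.
    by rewrite fx inE => /eqP.
  move=> t _; apply: Or31; rewrite !it.
  by split; case: ifP => // _; apply: fix_; rewrite !inE eqxx ?orbT.
have [i mi] : exists i, s i != i.
  apply/existsP; apply: contraTT f4 => /existsPn h; rewrite -leqNgt.
  have -> : [set x | s x == x] = setT by apply/setP => x; rewrite !inE; have := h x; rewrite negbK.
  by rewrite cardsT; lia.
have [k mk /andP[ki ksi]] : exists2 k, s k != k & (k != i) && (k != s i).
  have : ~: ([set x | s x == x] :|: [set i; s i]) != set0.
    rewrite -cards_eq0; have := cardsC ([set x | s x == x] :|: [set i; s i]).
    have := leq_card_setU [set x | s x == x] [set i; s i] => -[+ _].
    by rewrite cards2; case: (i != s i); lia.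
  by case/set0Pn => k; rewrite !inE !negb_or => /andP[? ?]; exists k.
have [l] := @exists_notin [:: i; s i; k; s k] (ltnW T5).
rewrite !inE !negb_or => /and4P[li lsi lk lsk].
exists i, (s i), k, l; split; first by neqs.
move=> t /(_ k); rewrite !inE eqxx !orbT /= !it => /(_ isT).
case: ifP => [_|ot _]; last by apply: Or31; rewrite !it ot.
rewrite ss (negPf ki) (negPf ksi) ![k == s k]eq_sym (negPf mk) /= => /eqP ek.
by rewrite ek ss eqxx in lsk.
Qed.

Lemma exists_isolated_tuple s : (5 < #|T|)%N ->
  exists i j k l, uniq [:: i; j; k; l] /\ isolated_tuple s i j k l.
Proof.
move=> T5; have [/existsP[i ssi]|h] := boolP [exists i, s (s i) != i]; last first.
  apply: isolated_involution => // x; apply/eqP; apply: contraNT h => h.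
  by apply/existsP; exists x.
have [/existsP[l lo]|h] := boolP [exists l, l \notin porbit s i].
  by exists i, (s i), (s (s i)), l; apply: isolated_off_orbit.
have [|j [k [l h']]] := @isolated_cycle s i; last by exists i, j, k, l.
rewrite (_ : porbit s i = setT) ?cardsT //; apply/setP => x; rewrite inE.
by apply: contraNT h => h; apply/existsP; exists x.
Qed.

End OrbitTuples.

Local Open Scope group_scope.
Local Open Scope quotient_scope.

(** * The second lower central quotient *)

Lemma gensub_ind (G : groupType) (A Q : G -> Prop) :
    (forall a, A a -> Q a) -> Q 1 -> (forall x y, Q x -> Q y -> Q (x * y)) ->
    (forall x, Q x -> Q x^-1) ->
  forall x, x \in gensub A -> Q x.
Proof.
move=> QA Q1 QM QV; pose S : {pred G} := fun x => `[< Q x >].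
have Smul : mulg_closed S.
  by move=> x y /asboolP Qx /asboolP Qy; apply/asboolP/QM.
have Sone : 1 \in S by apply/asboolP.
have Sinv : invg_closed S by move=> x /asboolP Qx; apply/asboolP/QV.
pose m1 := isMulClosed.Build G S Smul.
pose m2 := isMul1Closed.Build G S Sone.
pose m3 := isInvClosed.Build G S Sinv.
pose H : groupClosed G := HB.pack S m1 m2 m3.
move=> x /gensubP/(_ H) xH; suff /asboolP : x \in H by [].
by apply: xH => a Aa; apply/asboolP/QA.
Qed.

Section MultiplicativeMaps.
Variables (G H : groupType) (f : {multiplicative G -> H}).

Lemma multf1 : f 1 = 1.
Proof. by apply: (@mulgI _ (f 1)); rewrite -gmulfM !mulg1. Qed.

Lemma multfV : {morph f : x / x^-1}.
Proof. by move=> x; apply: (@mulgI _ (f x)); rewrite -gmulfM !mulgV multf1. Qed.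

Lemma multfJ : {morph f : x y / x ^ y}.
Proof. by move=> x y; rewrite /conjg !gmulfM multfV. Qed.

End MultiplicativeMaps.

Section LowerCentralQuotients.
Variable G : groupType.

Lemma commg_lcs2 (x y : G) : [~ x, y] \in @lcs G 2.
Proof. by apply: mem_gensub; exists x, y. Qed.

Lemma commg_lcs3 (x u : G) : u \in @lcs G 2 -> [~ x, u] \in @lcs G 3.
Proof. by move=> u2; apply: mem_gensub; exists x, u. Qed.

Lemma lcs2_ind (Q : G -> Prop) :
    (forall x y, Q [~ x, y]) -> Q 1 -> (forall x y, Q x -> Q y -> Q (x * y)) ->
    (forall x, Q x -> Q x^-1) ->
  forall x, x \in @lcs G 2 -> Q x.
Proof. by move=> Qc; apply: gensub_ind => _ [x [y [_ _ ->]]]. Qed.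

Lemma lcs3_lcs2 (x : G) : x \in @lcs G 3 -> x \in @lcs G 2.
Proof.
move: x; apply: gensub_ind => [_ [a [b [_ _ ->]]]|||]; first exact: commg_lcs2.
- exact: gpred1.
- by move=> a b; apply: gpredM.
- by move=> a; rewrite gpredV.
Qed.

(** The default value 1 makes the class a total function on bare elements of [G]. *)
Definition lcs2_class (x : G) : lcs_quot G 2 :=
  if insub x is Some u then \pi_(quotg (@lcs_next G 2)) (u : subgrp (@lcs G 2))
  else 1.

Lemma lcs2_classE (x : G) (x2 : x \in @lcs G 2) :
  lcs2_class x = \pi_(quotg (@lcs_next G 2)) (exist _ x x2 : subgrp (@lcs G 2)).
Proof. by rewrite /lcs2_class insubT. Qed.

Lemma lcs2_classM (x y : G) : x \in @lcs G 2 -> y \in @lcs G 2 ->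
  lcs2_class (x * y) = lcs2_class x * lcs2_class y.
Proof.
move=> x2 y2; rewrite (lcs2_classE x2) (lcs2_classE y2).
rewrite (lcs2_classE (gpredM _ _ x2 y2)) -quotg_piM.
by congr (\pi_(quotg _) _); apply: val_inj.
Qed.

Lemma lcs2_class_eq (x y : G) : x \in @lcs G 2 -> y \in @lcs G 2 ->
  lcs2_class x = lcs2_class y <-> x^-1 * y \in @lcs G 3.
Proof.
move=> x2 y2; rewrite (lcs2_classE x2) (lcs2_classE y2).
by split=> [/(@quotgP _ (@lcs_next G 2))|h]; last apply/(@quotgP _ (@lcs_next G 2)).
Qed.

Lemma lcs2_class_surj (u : lcs_quot G 2) :
  exists2 x, x \in @lcs G 2 & u = lcs2_class x.
Proof.
elim/quotW: u => -[x x2]; exists x => //.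
by rewrite (lcs2_classE x2).
Qed.

Lemma lcs2_class1 : lcs2_class 1 = 1.
Proof.
apply: (@mulgI _ (lcs2_class 1)).
by rewrite -lcs2_classM ?gpred1 // !mulg1.
Qed.

Lemma lcs2_classV (x : G) : x \in @lcs G 2 -> lcs2_class x^-1 = (lcs2_class x)^-1.
Proof.
move=> x2; apply: (@mulgI _ (lcs2_class x)).
by rewrite -lcs2_classM ?gpredV // !mulgV lcs2_class1.
Qed.

Lemma lcs2_classJ (x y : G) : x \in @lcs G 2 -> lcs2_class (x ^ y) = lcs2_class x.
Proof.
move=> x2; apply/esym; apply/lcs2_class_eq => //; first exact: gpredJl.
by rewrite -commgEl -invgR gpredV commg_lcs3.
Qed.

Lemma lcs2_classC (u v : lcs_quot G 2) : commute u v.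
Proof.
have [x x2 ->] := lcs2_class_surj u; have [y y2 ->] := lcs2_class_surj v.
rewrite /commute -!lcs2_classM //; apply/lcs2_class_eq; try exact: gpredM.
have -> : (x * y)^-1 * (y * x) = [~ y, x].
  by rewrite /commg /conjg !invgM !mulgA.
exact: commg_lcs3.
Qed.

Lemma lcs2_class_commMl (x y z : G) :
  lcs2_class [~ x * y, z] = lcs2_class [~ x, z] * lcs2_class [~ y, z].
Proof.
have -> : [~ x * y, z] = [~ x, z] ^ y * [~ y, z].
  by rewrite /commg /conjg !invgM !mulgA !mulgK.
rewrite lcs2_classM ?gpredJl ?commg_lcs2 // lcs2_classJ //.
exact: commg_lcs2.
Qed.

Lemma lcs2_class_commC (x y : G) :
  lcs2_class [~ x, y] = (lcs2_class [~ y, x])^-1.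
Proof. by rewrite -invgR lcs2_classV ?commg_lcs2. Qed.

Lemma lcs2_class_commMr (x y z : G) :
  lcs2_class [~ x, y * z] = lcs2_class [~ x, y] * lcs2_class [~ x, z].
Proof.
rewrite lcs2_class_commC lcs2_class_commMl invgM -!lcs2_class_commC.
exact: lcs2_classC.
Qed.

Lemma lcs2_class_commVl (x z : G) :
  lcs2_class [~ x^-1, z] = (lcs2_class [~ x, z])^-1.
Proof.
apply: (@mulgI _ (lcs2_class [~ x, z])).
by rewrite -lcs2_class_commMl !mulgV comm1g lcs2_class1.
Qed.

Lemma lcs2_class_commVr (x z : G) :
  lcs2_class [~ x, z^-1] = (lcs2_class [~ x, z])^-1.
Proof. by rewrite lcs2_class_commC lcs2_class_commVl -lcs2_class_commC. Qed.

Lemma lcs2_class_comm_lcs2 (x u : G) : u \in @lcs G 2 -> lcs2_class [~ x, u] = 1.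
Proof.
move=> u2; rewrite -lcs2_class1; apply/esym; apply/lcs2_class_eq.
- exact: gpred1.
- exact: commg_lcs2.
- by rewrite invg1 mul1g commg_lcs3.
Qed.

End LowerCentralQuotients.

(** * Lower central classes modulo the center *)

Section ModuloCenter.
Variable G : groupType.

Local Notation pz := (\pi_(quotg (@centerg G))).

Definition inng_pi (x : G) : inng G := pz x.

Lemma inng_piM : {morph inng_pi : x y / x * y}.
Proof. by move=> x y; apply: quotg_piM. Qed.

Lemma inng_pi1 : inng_pi 1 = 1.
Proof. by apply: (@mulgI _ (inng_pi 1)); rewrite -inng_piM !mulg1. Qed.

Lemma inng_piV : {morph inng_pi : x / x^-1}.
Proof.
by move=> x; apply: (@mulgI _ (inng_pi x)); rewrite -inng_piM !mulgV inng_pi1.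
Qed.

Lemma inng_piR : {morph inng_pi : x y / [~ x, y]}.
Proof. by move=> x y; rewrite /commg /conjg !inng_piM !inng_piV. Qed.

Lemma inng_pi_surj (u : inng G) : exists x, u = inng_pi x.
Proof. by elim/quotW: u => x; exists x. Qed.

Lemma inng_pi_eq (x y : G) : inng_pi x = inng_pi y <-> x^-1 * y \in @centerg G.
Proof. by split=> [/quotgP|h]; last apply/quotgP. Qed.

Lemma inng_pi_lcs2 (x : G) : x \in @lcs G 2 -> inng_pi x \in @lcs (inng G) 2.
Proof.
move: x; apply: lcs2_ind.
- by move=> x y; rewrite inng_piR commg_lcs2.
- by rewrite inng_pi1 gpred1.
- by move=> x y ? ?; rewrite inng_piM gpredM.
- by move=> x ?; rewrite inng_piV gpredV.
Qed.

Lemma lcs2_inng_lift (u : inng G) : u \in @lcs (inng G) 2 ->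
  exists2 x, x \in @lcs G 2 & u = inng_pi x.
Proof.
move: u; apply: lcs2_ind.
- move=> u v; have [x ->] := inng_pi_surj u; have [y ->] := inng_pi_surj v.
  by exists [~ x, y]; rewrite ?inng_piR ?commg_lcs2.
- by exists 1; rewrite ?inng_pi1 ?gpred1.
- move=> _ _ [x x2 ->] [y y2 ->].
  by exists (x * y); rewrite ?inng_piM ?gpredM.
- by move=> _ [x x2 ->]; exists x^-1; rewrite ?inng_piV ?gpredV.
Qed.

Lemma lcs3_inng_lift (u : inng G) : u \in @lcs (inng G) 3 ->
  exists2 x, x \in @lcs G 3 & u = inng_pi x.
Proof.
move: u; apply: gensub_ind.
- move=> _ [u [v [_ v2 ->]]]; have [x ->] := inng_pi_surj u.
  have [y y2 ->] := lcs2_inng_lift v2.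
  by exists [~ x, y]; rewrite ?inng_piR ?commg_lcs3.
- by exists 1; rewrite ?inng_pi1 ?gpred1.
- move=> _ _ [x x2 ->] [y y2 ->].
  by exists (x * y); rewrite ?inng_piM ?gpredM.
- by move=> _ [x x2 ->]; exists x^-1; rewrite ?inng_piV ?gpredV.
Qed.

Definition inng_class (x : G) : lcs_quot (inng G) 2 := lcs2_class (inng_pi x).

Lemma inng_class_surj (u : lcs_quot (inng G) 2) :
  exists2 x, x \in @lcs G 2 & u = inng_class x.
Proof.
have [v v2 ->] := lcs2_class_surj u.
by have [x x2 ->] := lcs2_inng_lift v2; exists x.
Qed.

Lemma inng_classM (x y : G) : x \in @lcs G 2 -> y \in @lcs G 2 ->
  inng_class (x * y) = inng_class x * inng_class y.
Proof. by move=> *; rewrite /inng_class inng_piM lcs2_classM ?inng_pi_lcs2. Qed.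

Lemma inng_class_ind (Q : lcs_quot (inng G) 2 -> Prop) :
    (forall x y : G, Q (inng_class [~ x, y])) -> Q 1 ->
    (forall u v, Q u -> Q v -> Q (u * v)) -> (forall u, Q u -> Q u^-1) ->
  forall u, Q u.
Proof.
move=> Qc Q1 QM QV u; have [x x2 ->] := inng_class_surj u.
suff [] : x \in @lcs G 2 /\ Q (inng_class x) by [].
move: x x2; apply: lcs2_ind.
- by move=> x y; rewrite commg_lcs2.
- by rewrite gpred1 /inng_class inng_pi1 lcs2_class1.
- move=> x y [x2 Qx] [y2 Qy]; rewrite gpredM // inng_classM //.
  by split=> //; apply: QM.
- move=> x [x2 Qx]; rewrite gpredV x2 /inng_class inng_piV.
  by rewrite lcs2_classV ?inng_pi_lcs2 //; split=> //; apply: QV.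
Qed.

Lemma inng_class_autg (f : autg G) (x : G) : x \in @lcs G 2 ->
  lcs_autg 2 (inng_autg f) (inng_class x) = inng_class (f x).
Proof.
move=> x2; have fx2 : f x \in @lcs G 2 by rewrite (lcs_char 2 f).
rewrite /inng_class (lcs2_classE (inng_pi_lcs2 x2)).
rewrite (lcs2_classE (inng_pi_lcs2 fx2)) lcs_autgE.
by congr (\pi_(quotg _) _); apply: val_inj; apply: inng_autgE.
Qed.

(** The kernel of the map from the second lower central term of [G] to the class group of [inng G]
    is the product of the third term with the central elements of the second, and [phi] kills both
    factors. *)
Lemma lcs2_inng_functional (phi : G -> int) :
    (forall x y, x \in @lcs G 2 -> y \in @lcs G 2 ->
       phi (x * y) = (phi x + phi y)%R) ->
    (forall x, x \in @lcs G 3 -> phi x = 0%R) ->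
    (forall x, x \in @lcs G 2 -> x \in @centerg G -> phi x = 0%R) ->
  exists F : lcs_quot (inng G) 2 -> int,
    (forall u v, F (u * v) = (F u + F v)%R) /\
    (forall x, x \in @lcs G 2 -> F (inng_class x) = phi x).
Proof.
move=> phiM phi3 phiZ.
have phiV x : x \in @lcs G 2 -> phi x^-1 = (- phi x)%R.
  move=> x2; apply/eqP; rewrite -addr_eq0 -phiM ?gpredV // mulVg.
  by rewrite phi3 // gpred1.
pose F u := phi (s2val (cid2 (inng_class_surj u))).
have FE x : x \in @lcs G 2 -> F (inng_class x) = phi x.
  move=> x2; rewrite /F; case: cid2 => y /= y2 e.
  have : (inng_pi y)^-1 * inng_pi x \in @lcs (inng G) 3.
    by apply/lcs2_class_eq => //; apply: inng_pi_lcs2.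
  rewrite -inng_piV -inng_piM => /lcs3_inng_lift[w w3 /inng_pi_eq z].
  have w2 := lcs3_lcs2 w3.
  have yV2 : y^-1 \in @lcs G 2 by rewrite gpredV.
  have yx2 : y^-1 * x \in @lcs G 2 by apply: gpredM.
  have yxV2 : (y^-1 * x)^-1 \in @lcs G 2 by rewrite gpredV.
  have := phiZ _ (gpredM _ _ yxV2 w2) z.
  by rewrite phiM // phiV // phiM // phiV // (phi3 w) //; lia.
exists F; split; last exact: FE.
move=> u v.
have [x x2 ->] := inng_class_surj u; have [y y2 ->] := inng_class_surj v.
by rewrite -inng_classM // !FE ?phiM //; apply: gpredM.
Qed.

End ModuloCenter.

(** * Generators of the pure braid group *)

Lemma perm_of_uniq (T : finType) (u v : seq T) :
  size u = size v -> uniq u -> uniq v -> exists s : {perm T}, map s u = v.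
Proof.
elim: u v => [|x u IH] [|y v] //= => [_ _ _|[e] /andP[xu uu] /andP[yv uv]].
  by exists 1.
have [s es] := IH v e uu uv; exists (s * tperm (s x) y).
rewrite permM tpermL; congr (_ :: _); rewrite -es.
apply/eq_in_map => z zu; rewrite permM tpermD //.
  by apply: contraNneq xu => /perm_inj ->.
by apply: contraNneq yv => ->; rewrite -es map_f.
Qed.

Section BraidGenerators.
Variable m : nat.

Definition bperm (x : braid m) : 'S_m := braid_perm m x.

Lemma bperm1 : bperm 1 = 1. Proof. exact: multf1. Qed.

Lemma bpermM (x y : braid m) : bperm (x * y) = bperm x * bperm y.
Proof. exact: gmulfM. Qed.

Lemma bpermV (x : braid m) : bperm x^-1 = (bperm x)^-1.
Proof. exact: multfV. Qed.

Lemma bpermJ (x y : braid m) : bperm (x ^ y) = bperm x ^ bperm y.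
Proof. exact: multfJ. Qed.

(* sigma i is the generator \sigma_{i+1}, and 1 when i is out of range. *)
Definition sigma (i : nat) : braid m :=
  if insub i is Some o then presg_gen (@braid_rel m) o else 1.

Lemma sigma_ord (i : 'I_m.-1) : sigma i = presg_gen (@braid_rel m) i.
Proof. by rewrite /sigma valK. Qed.

Lemma sigma_out (i : nat) : (m.-1 <= i)%N -> sigma i = 1.
Proof. by move=> mi; rewrite /sigma insubF // ltnNge mi. Qed.

Lemma presg_rel (X : choiceType) (R : seq X -> seq X -> Prop) r s : R r s ->
  \prod_(x <- r) presg_gen R x = \prod_(x <- s) presg_gen R x.
Proof.
have piE (t : seq X) : \prod_(x <- t) presg_gen R x = \pi_(presg R) (gen_word t).
  elim: t => [|x t IH]; first by rewrite big_nil.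
  by rewrite big_cons IH -[LHS]/(presg_mul _ _) /presg_gen presg_mulE.
by move=> rs; rewrite !piE; apply/presgP/asboolP/pres_rel.
Qed.

Lemma sigma_far (i j : nat) : (i.+2 <= j)%N -> commute (sigma i) (sigma j).
Proof.
move=> ij; have [jm|jm] := ltnP j m.-1; last first.
  by rewrite (sigma_out jm); apply: commute1.
have im : (i < m.-1)%N by lia.
have := presg_rel (@braid_far m (Ordinal im) (Ordinal jm) (or_introl ij)).
by rewrite !big_cons !big_nil !mulg1 -!sigma_ord.
Qed.

Lemma sigma_adj (i : nat) : (i.+1 < m.-1)%N ->
  sigma i.+1 * sigma i * sigma i.+1 = sigma i * sigma i.+1 * sigma i.
Proof.
move=> im.
have := presg_rel (@braid_adj m (Ordinal (ltnW im)) (Ordinal im) erefl).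
by rewrite !big_cons !big_nil !mulg1 -!sigma_ord !mulgA.
Qed.

Lemma braid_ind (Q : braid m -> Prop) :
    Q 1 -> (forall x y, Q x -> Q y -> Q (x * y)) -> (forall x, Q x -> Q x^-1) ->
    (forall i, (i < m.-1)%N -> Q (sigma i)) ->
  forall x, Q x.
Proof.
move=> Q1 QM QV Qs; elim/quotW; elim=> [//|[i b] u IH].
have -> : \pi_(braid m) ((i, b) :: u) = \pi_(braid m) [:: (i, b)] * \pi_(braid m) u.
  by rewrite -[RHS]/(presg_mul _ _) presg_mulE.
apply: QM => //; case: b.
  have -> : \pi_(braid m) [:: (i, true)] = (sigma i)^-1.
    by rewrite sigma_ord -[RHS]/(presg_inv _) presg_invE.
  by apply/QV/Qs.
by have := Qs i (ltn_ord i); rewrite sigma_ord.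
Qed.

Definition swap (i x : nat) : nat :=
  if x == i then i.+1 else if x == i.+1 then i else x.

Lemma bperm_sigma (i : nat) (x : 'I_m) : (i < m.-1)%N ->
  bperm (sigma i) x = swap i x :> nat.
Proof.
move=> im; rewrite /bperm -[i]/(nat_of_ord (Ordinal im)) sigma_ord presg_lift_gen.
rewrite /braid_tperm permE /= -!val_eqE /= /swap.
by case: ifP => // _; case: ifP.
Qed.

Lemma bperm_sigma_ord (i : 'I_m.-1) : bperm (sigma i) = braid_tperm i.
Proof. by rewrite /bperm sigma_ord presg_lift_gen. Qed.

Definition tail_braids (k : nat) : {pred braid m} :=
  gensub (fun z => exists2 i, (k <= i)%N & z = sigma i).

Definition squares : {pred braid m} :=
  gensub (fun z => exists i g, z = (sigma i * sigma i) ^ g).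

HB.instance Definition _ k := GroupClosed.on (tail_braids k).
HB.instance Definition _ := GroupClosed.on squares.

Lemma squaresJ (x g : braid m) : x \in squares -> x ^ g \in squares.
Proof.
move: x; apply: gensub_ind.
- by move=> _ [i [h ->]]; rewrite -conjgM; apply: mem_gensub; exists i, (h * g).
- by rewrite conj1g gpred1.
- by move=> x y ? ?; rewrite conjMg gpredM.
- by move=> x ?; rewrite conjVg gpredV.
Qed.

Lemma tail_fix k (b : braid m) (x : 'I_m) : (x < k)%N -> b \in tail_braids k ->
  bperm b x = x.
Proof.
move=> xk; move: b; apply: gensub_ind.
- move=> _ [i ki ->]; have [im|im] := ltnP i m.-1; last first.
    by rewrite (sigma_out im) bperm1 perm1.
  by apply: val_inj; rewrite /= bperm_sigma // /swap; do 2?case: eqP => //; lia.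
- by rewrite bperm1 perm1.
- by move=> a b ea eb; rewrite bpermM permM ea eb.
- by move=> a ea; rewrite bpermV -{1}ea permK.
Qed.

Lemma squares_perm (n : braid m) : n \in squares -> bperm n = 1.
Proof.
move: n; apply: gensub_ind.
- move=> _ [i [g ->]]; rewrite bpermJ bpermM.
  have -> : bperm (sigma i) * bperm (sigma i) = 1.
    have [im|im] := ltnP i m.-1; last by rewrite (sigma_out im) bperm1 mulg1.
    by rewrite -[i]/(nat_of_ord (Ordinal im)) bperm_sigma_ord tperm2.
  by rewrite conj1g.
- by rewrite bperm1.
- by move=> a b ea eb; rewrite bpermM ea eb mulg1.
- by move=> a ea; rewrite bpermV ea invg1.
Qed.

(** A braid that moves position k to position j. Such braids lift the usual coset representatives of
    the symmetric group on the positions beyond k in the one on the positions from k on. *)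
Definition sweep (k j : nat) : braid m := \prod_(k <= t < j) sigma t.

Lemma sweepS k j : (k <= j)%N -> sweep k j.+1 = sweep k j * sigma j.
Proof. exact: big_nat_recr. Qed.

Lemma sweep_perm k j (x : 'I_m) : (k <= j)%N -> (j < m)%N -> x = k :> nat ->
  bperm (sweep k j) x = j :> nat.
Proof.
move=> kj jm xk; elim: j kj jm => [|j IH] kj jm.
  by rewrite /sweep big_geq // bperm1 perm1; lia.
have [e|ne] := eqVneq k j.+1.
  by rewrite /sweep e big_geq // bperm1 perm1 -e.
rewrite sweepS; last by lia.
by rewrite bpermM permM bperm_sigma ?IH /swap ?eqxx //; lia.
Qed.

Lemma sweep_commute k j i : (j < i)%N \/ (i.+1 < k)%N ->
  commute (sweep k j) (sigma i).
Proof.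
move=> h; rewrite /sweep big_nat; apply/commute_sym; elim/big_ind: _.
- exact: commute1.
- by move=> x y; apply: commuteM.
- by move=> t kt; case: h => h; [apply: commute_sym|]; apply: sigma_far; lia.
Qed.

Lemma sweep_sigma k j i : (k <= j)%N -> (j < m)%N -> (k <= i)%N -> (i < m.-1)%N ->
  exists b j' n, [/\ b \in tail_braids k.+1, n \in squares,
    (k <= j')%N && (j' < m)%N & sweep k j * sigma i = b * sweep k j' * n].
Proof.
move=> kj jm ki im.
have sigT t : (k.+1 <= t)%N -> sigma t \in tail_braids k.+1.
  by move=> kt; apply: mem_gensub; exists t.
have sq : sigma i * sigma i \in squares.
  by apply: mem_gensub; exists i, 1; rewrite conjg1.
case: (ltngtP i j) => [ij|ji|e].
- have [e|ne] := eqVneq i.+1 j.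
    exists 1, i, (sigma i * sigma i); split; rewrite ?gpred1 //; first by lia.
    by rewrite mul1g -e sweepS // -!mulgA.
  exists (sigma i.+1), j, 1; split; rewrite ?gpred1 ?sigT //; first by lia.
  (* By the braid relation, [sigma i] slides leftwards through [sigma i * sigma i.+1] and comes out
     as [sigma i.+1]. *)
  have -> : sweep k j = sweep k i * (sigma i * sigma i.+1) * sweep i.+2 j.
    have ij1 : (i.+1 < j)%N by rewrite ltn_neqAle ne.
    rewrite /sweep (big_cat_nat ki (ltnW ij)) /= (big_ltn ij) (big_ltn ij1).
    by rewrite !mulgA.
  rewrite mulg1 -!mulgA (sweep_commute (or_intror (ltnSn _))) !mulgA.
  rewrite -(sweep_commute (or_introl (ltnSn _))); congr (_ * _).
  by rewrite -!mulgA; congr (_ * _); rewrite !mulgA sigma_adj //; lia.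
- exists (sigma i), j, 1; split; rewrite ?gpred1 ?sigT //; try lia.
  by rewrite mulg1; apply: sweep_commute; left.
- subst j; exists 1, i.+1, 1; split; rewrite ?gpred1 //; first by lia.
  by rewrite mul1g mulg1 sweepS.
Qed.

Definition in_coset k (g : braid m) := exists b j n,
  [/\ b \in tail_braids k.+1, n \in squares, (k <= j)%N && (j < m)%N
    & g = b * sweep k j * n].

Lemma in_coset_squares k g n : in_coset k g -> n \in squares ->
  in_coset k (g * n).
Proof.
move=> [b [j [n' [bT n'S kj ->]]]] nS; exists b, j, (n' * n); split=> //.
  exact: gpredM.
by rewrite mulgA.
Qed.

Lemma in_coset_sigma k i g : (k <= i)%N -> in_coset k g -> in_coset k (g * sigma i).
Proof.
move=> ki ug; have [im|im] := ltnP i m.-1; last by rewrite (sigma_out im) mulg1.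
case: ug => b [j [n [bT nS /andP[kj jm] ->]]].
have [b' [j' [n' [b'T n'S kj' e]]]] := sweep_sigma kj jm ki im.
exists (b * b'), j', (n' * n ^ sigma i); split=> //.
- exact: gpredM.
- by apply: gpredM => //; apply: squaresJ.
by rewrite -!mulgA (conjgC n) (mulgA (sweep k j)) e !mulgA.
Qed.

Lemma tail_in_coset k g : (k < m)%N -> g \in tail_braids k -> in_coset k g.
Proof.
move=> km; suff h : forall g, g \in tail_braids k -> forall u, in_coset k u ->
    in_coset k (u * g) /\ in_coset k (u * g^-1).
  move=> gT; rewrite -[g]mul1g; have [] // := h g gT 1.
  exists 1, k, 1; rewrite !gpred1 leqnn km; split=> //.
  by rewrite /sweep big_geq // !mulg1.
apply: gensub_ind.
- move=> _ [i ki ->] u uU; split; first exact: in_coset_sigma.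
  (* Modulo squares a generator equals its inverse, so the positive case suffices. *)
  have -> : (sigma i)^-1 = sigma i * (sigma i * sigma i)^-1.
    by rewrite invgM mulgA mulgV mul1g.
  rewrite mulgA; apply: in_coset_squares; first exact: in_coset_sigma.
  by rewrite gpredV; apply: mem_gensub; exists i, 1; rewrite conjg1.
- by move=> u uU; rewrite invg1 mulg1.
- move=> x y hx hy u uU; rewrite invgM !mulgA.
  by split; [case: (hy _ (hx u uU).1) | case: (hx _ (hy u uU).2)].
- by move=> x hx u uU; rewrite invgK; case: (hx u uU).
Qed.

(** One strand at a time: modulo squares, an element of [tail_braids k] is an element of
    [tail_braids k.+1] times a sweep, and fixing position k makes the sweep trivial. The case k = m
    shows that squares generate the pure braids. *)
Lemma fixing_braid k (g : braid m) : (k <= m)%N ->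
    (forall x : 'I_m, (x < k)%N -> bperm g x = x) ->
  exists b n, [/\ b \in tail_braids k, n \in squares & g = b * n].
Proof.
elim: k => [|k IH] km fg.
  exists g, 1; rewrite gpred1 mulg1; split=> //; move: g {fg}; apply: braid_ind.
  - exact: gpred1.
  - by move=> x y; apply: gpredM.
  - by move=> x ?; rewrite gpredV.
  - by move=> i _; apply: mem_gensub; exists i.
have [||b [n [bT nS e]]] := IH; first by lia.
  by move=> x xk; apply: fg; lia.
have [b' [j [n' [b'T n'S /andP[kj jm] e']]]] := tail_in_coset km bT.
have fk := fg (Ordinal km) (ltnSn k).
rewrite e e' !bpermM !permM (squares_perm nS) (squares_perm n'S) !perm1 in fk.
rewrite (@tail_fix k.+1 b' (Ordinal km) (ltnSn k) b'T) in fk.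
have ejk : j = k.
  by have := congr1 val fk; rewrite /= (sweep_perm kj).
exists b', (n' * n); split=> //; first exact: gpredM.
by rewrite e e' ejk /sweep big_geq // mulg1 mulgA.
Qed.

Lemma pure_squares (g : braid m) : bperm g = 1 -> g \in squares.
Proof.
move=> g1; have [||b [n [bT nS ->]]] := @fixing_braid m g => //.
  by move=> x _; rewrite g1 perm1.
(* All generators of [tail_braids m] are out of range, hence trivial. *)
suff -> : b = 1 by rewrite mul1g.
move: b bT; apply: gensub_ind => //.
- by move=> _ [i mi ->]; rewrite sigma_out //; lia.
- by move=> x y -> ->; rewrite mulg1.
- by move=> x ->; rewrite invg1.
Qed.

Lemma braid_perm_surj (s : 'S_m) : exists g, bperm g = s.
Proof.
have adj (i j : 'I_m) : (i < j)%N -> exists g, bperm g = tperm i j.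
  case: j => j jm /=; elim: j jm => [//|j IH] jm ij.
  have jm1 : (j < m.-1)%N by lia.
  pose o := Ordinal jm1; have er : strand_r o = Ordinal jm by apply: val_inj.
  have go : bperm (sigma j) = braid_tperm o.
    by rewrite -[j]/(nat_of_ord o) bperm_sigma_ord.
  have [e|ne] := eqVneq (i : nat) j.
    exists (sigma j); rewrite go /braid_tperm er; congr tperm.
    by apply: val_inj; rewrite /= e.
  have [|g eg] := IH (ltnW jm); first by rewrite /=; lia.
  exists (g ^ sigma j); rewrite bpermJ eg go tpermJ /braid_tperm er.
  rewrite (_ : Ordinal (ltnW jm) = strand_l o); last exact: val_inj.
  rewrite tpermL tpermD //; last by rewrite -val_eqE /=; lia.
  by rewrite -val_eqE /=; lia.
have [ts -> _] := prod_tpermP s; elim: ts => [|[i j] ts [g eg]].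
  by exists 1; rewrite big_nil bperm1.
rewrite big_cons /=.
have [h eh] : exists h, bperm h = tperm i j.
  case: (ltngtP i j) => [/adj //|/adj|/val_inj ->]; first by rewrite tpermC.
  by exists 1; rewrite tperm1 bperm1.
by exists (h * g); rewrite bpermM eg eh.
Qed.

End BraidGenerators.

(** * Twists and their classes in the abelianization *)

Section PureBraidClasses.
Variable m : nat.
Local Notation P := (pure_braid m).

Lemma kerg_bperm (x : braid m) : (x \in kerg (braid_perm m)) = (bperm x == 1).
Proof. by []. Qed.

Lemma pure_bperm (x : P) : bperm (val x) = 1.
Proof. by apply/eqP; rewrite -kerg_bperm; apply: (valP x). Qed.

Fact pconj_subproof (g : braid m) (x : P) : val x ^ g \in kerg (braid_perm m).
Proof. by rewrite kerg_bperm bpermJ pure_bperm conj1g. Qed.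

Definition pconj (g : braid m) (x : P) : P := exist _ (val x ^ g) (pconj_subproof g x).

Fact pconj_morph (g : braid m) : {morph pconj g : x y / x * y}.
Proof. by move=> x y; apply: val_inj; rewrite /= conjMg. Qed.

Fact pconj_bij (g : braid m) : bijective (pconj g).
Proof.
by exists (pconj g^-1) => x; apply: val_inj; rewrite /= ?conjgK ?conjgKV.
Qed.

Lemma pconj_lcs k (g : braid m) (x : P) :
  (pconj g x \in @lcs P k) = (x \in @lcs P k).
Proof. exact: (lcs_char k (mk_autg (@pconj_morph g) (pconj_bij g))). Qed.

Lemma pconjV (g : braid m) (x : P) : pconj g x^-1 = (pconj g x)^-1.
Proof. by apply: val_inj; rewrite /= conjVg. Qed.

Lemma pconjM (g h : braid m) (x : P) : pconj (g * h) x = pconj h (pconj g x).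
Proof. by apply: val_inj; rewrite /= conjgM. Qed.

(* Equality in the abelianization. *)
Definition abeq (x y : P) : Prop := x^-1 * y \in @lcs P 2.

Lemma abeq_sym x y : abeq x y -> abeq y x.
Proof. by rewrite /abeq -gpredV invgM invgK. Qed.

Lemma abeqM x x' y y' : abeq x x' -> abeq y y' -> abeq (x * y) (x' * y').
Proof.
rewrite /abeq => xx yy.
have -> : (x * y)^-1 * (x' * y') = (x^-1 * x') ^ y * (y^-1 * y').
  by rewrite /conjg invgM !mulgA mulgK.
by apply: gpredM => //; apply: gpredJl.
Qed.

Lemma abeq_pconj (g : braid m) x y : abeq x y -> abeq (pconj g x) (pconj g y).
Proof. by rewrite /abeq -pconjV -pconj_morph pconj_lcs. Qed.

Lemma abeq_conj (p x : P) : abeq x (x ^ p).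
Proof. by rewrite /abeq -commgEl commg_lcs2. Qed.

Fact sq_subproof (i : nat) : sigma m i * sigma m i \in kerg (braid_perm m).
Proof.
rewrite kerg_bperm; apply/eqP/squares_perm/mem_gensub.
by exists i, 1; rewrite conjg1.
Qed.

Definition sq (i : nat) : P := exist _ (sigma m i * sigma m i) (sq_subproof i).

Lemma pure_braid_ind (Q : P -> Prop) :
    Q 1 -> (forall x y, Q x -> Q y -> Q (x * y)) -> (forall x, Q x -> Q x^-1) ->
    (forall g i, (i < m.-1)%N -> Q (pconj g (sq i))) ->
  forall x, Q x.
Proof.
move=> Q1 QM QV Qs x.
suff h : forall z, z \in @squares m -> exists2 y : P, Q y & val y = z.
  have [y Qy e] := h (val x) (pure_squares (pure_bperm x)).
  by rewrite -(val_inj e).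
apply: gensub_ind.
- move=> _ [i [g ->]]; have [im|im] := ltnP i m.-1.
    by exists (pconj g (sq i)); first exact: Qs.
  by exists 1; rewrite // sigma_out // mulg1 conj1g.
- by exists 1.
- by move=> _ _ [y Qy <-] [z Qz <-]; exists (y * z) => //; apply: QM.
- by move=> _ [y Qy <-]; exists y^-1 => //; apply: QV.
Qed.

Lemma bperm_sigma_tperm (i : nat) (x y : 'I_m) : x = i :> nat -> y = i.+1 :> nat ->
  bperm (sigma m i) = tperm x y.
Proof.
move=> xi yi; have im : (i < m.-1)%N by have := ltn_ord y; lia.
rewrite -[i]/(nat_of_ord (Ordinal im)) bperm_sigma_ord /braid_tperm.
by congr tperm; apply: val_inj; rewrite /= ?xi ?yi.
Qed.

Lemma bperm_sigmaJ (i : nat) (x y : 'I_m) (g : braid m) :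
  x = i :> nat -> y = i.+1 :> nat ->
  bperm (sigma m i ^ g) = tperm (bperm g x) (bperm g y).
Proof. by move=> xi yi; rewrite bpermJ (bperm_sigma_tperm xi yi) tpermJ. Qed.

(** Such a braid is a tail braid, which commutes with [sigma m 0], times a pure braid, whose
    conjugation is invisible in the abelianization. *)
Lemma sq0_fixing (k : braid m) (x y : 'I_m) : x = 0%N :> nat -> y = 1%N :> nat ->
  bperm k x = x -> bperm k y = y -> abeq (pconj k (sq 0)) (sq 0).
Proof.
move=> x0 y1 kx ky; have m2 : (2 <= m)%N by have := ltn_ord y; lia.
have [|b [n [bT nS e]]] := fixing_braid (g := k) m2.
  move=> z z2; have [z0|z0] := eqVneq (z : nat) 0%N.
    by rewrite (_ : z = x) //; apply: val_inj; rewrite /= z0 x0.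
  by rewrite (_ : z = y) //; apply: val_inj; rewrite /= y1; lia.
have bs : commute (sigma m 0) b.
  move: b bT {e}; apply: gensub_ind.
  - by move=> _ [i i2 ->]; apply: sigma_far.
  - exact: commute1.
  - by move=> ? ?; apply: commuteM.
  - by move=> ?; apply: commuteV.
have n1 : n \in kerg (braid_perm m) by rewrite kerg_bperm squares_perm.
have -> : pconj k (sq 0) = sq 0 ^ (exist _ n n1 : P).
  apply: val_inj; rewrite /= e conjgM; congr (_ ^ _).
  by rewrite /conjg -(commuteM (commute_sym bs) (commute_sym bs)) mulKg.
exact/abeq_sym/abeq_conj.
Qed.

Lemma pconj_sq0_abeq (g h : braid m) : (2 <= m)%N ->
  bperm (sigma m 0 ^ g) = bperm (sigma m 0 ^ h) ->
  abeq (pconj g (sq 0)) (pconj h (sq 0)).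
Proof.
move=> m2; have m0 : (0 < m)%N by lia.
pose x := Ordinal m0; pose y := Ordinal m2.
have xy : x != y by [].
set k := h * g^-1.
have eh : h = k * g by rewrite /k mulgVK.
rewrite eh => e; clearbody k.
have {}e : tperm (bperm k x) (bperm k y) = tperm x y.
  have := e; rewrite !bpermJ bpermM conjgM => /conjg_inj.
  by rewrite (@bperm_sigma_tperm 0 x y) // tpermJ.
rewrite pconjM; apply: abeq_pconj; apply: abeq_sym.
have kxy : bperm k x != bperm k y by rewrite (inj_eq perm_inj).
have [kx|kx] := eqVneq (bperm k x) x.
  apply: (@sq0_fixing k x y) => //.
  by have := tpermL x (bperm k y); rewrite -{1}kx e tpermL.
have ky : bperm k x = y.
  apply/eqP; apply: contraNT kxy => ky.
  by have := tpermL (bperm k x) (bperm k y); rewrite e tpermD 1?eq_sym // => <-.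
have kx' : bperm k y = x.
  by have := tpermL (bperm k x) (bperm k y); rewrite e ky tpermR => <-.
(* Here [k] exchanges the two strands; multiplying by the inverse of [sigma m 0], which commutes
   with [sq 0], makes it fix both. *)
have -> : pconj k (sq 0) = pconj ((sigma m 0)^-1 * k) (sq 0).
  rewrite pconjM; congr pconj; apply: val_inj => /=.
  by rewrite /conjg invgK !mulgA mulgK.
apply: (@sq0_fixing _ x y) => //; rewrite bpermM bpermV permM
  (@bperm_sigma_tperm 0 x y) // tpermV.
  by rewrite tpermL.
by rewrite tpermR.
Qed.

Lemma sigma_conj0 i : (i < m.-1)%N -> exists w, sigma m i = sigma m 0 ^ w.
Proof.
elim: i => [|i IH] im; first by exists 1; rewrite conjg1.
have [w ew] := IH (ltnW im); exists (w * (sigma m i.+1 * sigma m i)).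
rewrite conjgM -ew; apply: (@mulgI _ (sigma m i.+1 * sigma m i)).
by rewrite -conjgC mulgA sigma_adj // !mulgA.
Qed.

Lemma pconj_sq_abeq (i j : nat) (g h : braid m) :
  (i < m.-1)%N -> (j < m.-1)%N -> bperm (sigma m i ^ g) = bperm (sigma m j ^ h) ->
  abeq (pconj g (sq i)) (pconj h (sq j)).
Proof.
move=> im jm; have [w ew] := sigma_conj0 im; have [v ev] := sigma_conj0 jm.
have sqw k u : sigma m k = sigma m 0 ^ u -> sq k = pconj u (sq 0).
  by move=> e; apply: val_inj; rewrite /= conjMg e.
rewrite (sqw i w) // (sqw j v) // ew ev -!conjgM -!pconjM.
by apply: pconj_sq0_abeq; lia.
Qed.

(** A chosen representative of the generator A_pq when [t] exchanges p and q; only its class in the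
    abelianization is canonical. Indexing by the permutation gives symmetry in p and q, and the
    default 1 serves the case p = q. *)
Definition twist (t : 'S_m) : P :=
  if pselect (exists g : braid m, bperm (sigma m 0 ^ g) = t) is left h
  then pconj (projT1 (cid h)) (sq 0) else 1.

Lemma twist_abeq (i : nat) (g : braid m) (t : 'S_m) :
  (i < m.-1)%N -> bperm (sigma m i ^ g) = t -> abeq (pconj g (sq i)) (twist t).
Proof.
move=> im e; rewrite /twist; case: pselect => [h|[]].
  case: cid => g' /= e'; apply: pconj_sq_abeq => //; first by lia.
  by rewrite e e'.
have [w ew] := sigma_conj0 im; exists (w * g).
by rewrite conjgM -ew.
Qed.

Lemma twist1 : (2 <= m)%N -> twist 1 = 1.
Proof.
move=> m2; rewrite /twist; case: pselect => // -[g e]; exfalso.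
have m0 : (0 < m)%N by lia.
move: e; rewrite (@bperm_sigmaJ 0 (Ordinal m0) (Ordinal m2)) // => /permP.
move/(_ (bperm g (Ordinal m0))); rewrite tpermL perm1 => /perm_inj.
by move/(congr1 val).
Qed.

Lemma exists_braid_map (u v : seq 'I_m) : size u = size v -> uniq u -> uniq v ->
  exists g : braid m, map (bperm g) u = v.
Proof.
move=> e uu uv; have [s es] := perm_of_uniq e uu uv.
by have [g eg] := braid_perm_surj s; exists g; rewrite eg.
Qed.

Lemma uniq_size_ord (u : seq 'I_m) : uniq u -> (size u <= m)%N.
Proof. by move/card_uniqP <-; rewrite -[m in leqRHS]card_ord max_card. Qed.

(** One braid conjugates the squares of [sigma m 0] and [sigma m 2] to commuting representatives;
    the chosen twists themselves may fail to commute. *)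
Lemma twist_far (p q r s : 'I_m) : uniq [:: p; q; r; s] -> exists x y : P,
  [/\ commute x y, abeq x (twist (tperm p q)) & abeq y (twist (tperm r s))].
Proof.
move=> u; have m4 := uniq_size_ord u; rewrite /= in m4.
have h i : (i < 4)%N -> (i < m)%N by lia.
pose o i (i4 : (i < 4)%N) := Ordinal (h i i4).
have [|||g [g0 g1 g2 g3]] :=
  @exists_braid_map [:: o 0%N isT; o 1%N isT; o 2%N isT; o 3%N isT] [:: p; q; r; s] => //.
exists (pconj g (sq 0)), (pconj g (sq 2)); split.
- rewrite /commute -!pconj_morph; congr pconj; apply: val_inj.
  have c : commute (sigma m 0) (sigma m 2) by apply: sigma_far.
  have c' := commuteM c c; apply/commute_sym/commuteM; exact/commute_sym.
- apply: twist_abeq; first by lia.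
  by rewrite (@bperm_sigmaJ 0 (o 0%N isT) (o 1%N isT)) // g0 g1.
- apply: twist_abeq; first by lia.
  by rewrite (@bperm_sigmaJ 2 (o 2%N isT) (o 3%N isT)) // g2 g3.
Qed.

(* \sigma_1 commutes with the full twist on the first three strands, which is
   \sigma_1^2 . \sigma_2 \sigma_1^2 \sigma_2^-1 . \sigma_2^2. *)
Lemma twist_triple (p q r : 'I_m) : uniq [:: p; q; r] -> exists x y : P,
  [/\ commute x y, abeq x (twist (tperm p q)) &
    abeq y (twist (tperm p q) * twist (tperm p r) * twist (tperm q r))].
Proof.
move=> u; have m3 := uniq_size_ord u; rewrite /= in m3.
have h i : (i < 3)%N -> (i < m)%N by lia.
pose o i (i3 : (i < 3)%N) := Ordinal (h i i3).
have [|||g [g0 g1 g2]] :=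
  @exists_braid_map [:: o 0%N isT; o 1%N isT; o 2%N isT] [:: p; q; r] => //.
exists (pconj g (sq 0)), (pconj g (sq 0 * pconj (sigma m 1)^-1 (sq 0) * sq 1)).
have a01 : sigma m 1 * sigma m 0 * sigma m 1 = sigma m 0 * sigma m 1 * sigma m 0.
  by apply: sigma_adj; lia.
split.
- set y := sq 0 * _ * _; rewrite /commute -!pconj_morph; congr pconj.
  have ey : val y = sigma m 0 * sigma m 1 * sigma m 0 * (sigma m 0 * sigma m 1 * sigma m 0).
    rewrite /= /conjg invgK !mulgA mulgVK.
    set a := sigma m 0 in a01 *; set b := sigma m 1 in a01 *.
    have -> : a * b * a * a * b * a = a * b * a * (a * b * a) by rewrite !mulgA.
    rewrite -{2}a01; have -> : a * b * a * (b * a * b) = a * (b * a * b) * (a * b).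
      by rewrite !mulgA.
    by rewrite a01 !mulgA.
  apply: val_inj; rewrite -[LHS]/(val (sq 0) * val y).
  rewrite -[RHS]/(val y * val (sq 0)) ey {y ey} /=.
  set a := sigma m 0 in a01 *; set b := sigma m 1 in a01 *.
  have c : commute (a * b * a * (a * b * a)) a.
    rewrite /commute -{2}a01 -!mulgA; congr (_ * _); rewrite !mulgA.
    by rewrite -a01 -!mulgA; congr (_ * _); rewrite !mulgA a01.
  by apply/commute_sym/commuteM.
- apply: twist_abeq; first by lia.
  by rewrite (@bperm_sigmaJ 0 (o 0%N isT) (o 1%N isT)) // g0 g1.
- rewrite !pconj_morph; apply: abeqM; first apply: abeqM.
  + apply: twist_abeq; first by lia.
    by rewrite (@bperm_sigmaJ 0 (o 0%N isT) (o 1%N isT)) // g0 g1.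
  + rewrite -pconjM; apply: twist_abeq; first by lia.
    rewrite (@bperm_sigmaJ 0 (o 0%N isT) (o 1%N isT)) // bpermM !permM bpermV.
    rewrite (@bperm_sigma_tperm 1 (o 1%N isT) (o 2%N isT)) // tpermV tpermL tpermD //.
    by rewrite g0 g2.
  + apply: twist_abeq; first by lia.
    by rewrite (@bperm_sigmaJ 1 (o 1%N isT) (o 2%N isT)) // g1 g2.
Qed.

End PureBraidClasses.

(** * Homomorphisms from crossing weights *)

Section Wreath.
Variables (m : nat) (G : groupType).

(** The braid group maps to this semidirect product by giving each crossing a weight that depends on
    the current positions of the strands, so only the braid relations have to be checked. On pure
    braids the coordinate at 1 is then a homomorphism to [G]. *)
Definition wreath := ({ffun 'S_m -> G} * 'S_m)%type.
HB.instance Definition _ := Choice.on wreath.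

Definition wr_mul (x y : wreath) : wreath :=
  ([ffun s => x.1 s * y.1 (s * x.2)], x.2 * y.2).
Definition wr_one : wreath := ([ffun=> 1], 1).
Definition wr_inv (x : wreath) : wreath := ([ffun s => (x.1 (s * x.2^-1))^-1], x.2^-1).

Fact wr_mulA : associative wr_mul.
Proof.
move=> x y z; congr (_, _); last by rewrite /= mulgA.
by apply/ffunP => s; rewrite !ffunE /= !mulgA.
Qed.
Fact wr_mul1 : left_id wr_one wr_mul.
Proof.
case=> f s; congr (_, _); last by rewrite /= mul1g.
by apply/ffunP => t; rewrite !ffunE /= mul1g mulg1.
Qed.
Fact wr_mulr1 : right_id wr_one wr_mul.
Proof.
case=> f s; congr (_, _); last by rewrite /= mulg1.
by apply/ffunP => t; rewrite !ffunE /= mulg1.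
Qed.
Fact wr_mulV : left_inverse wr_one wr_inv wr_mul.
Proof.
case=> f s; congr (_, _); last by rewrite /= mulVg.
by apply/ffunP => t; rewrite !ffunE /= mulVg.
Qed.
Fact wr_mulrV : right_inverse wr_one wr_inv wr_mul.
Proof.
case=> f s; congr (_, _); last by rewrite /= mulgV.
by apply/ffunP => t; rewrite !ffunE /= mulgK mulgV.
Qed.
HB.instance Definition _ := isGroup.Build wreath
  wr_mulA wr_mul1 wr_mulr1 wr_mulV wr_mulrV.

Lemma wr_mul_fst (x y : wreath) s : (x * y).1 s = x.1 s * y.1 (s * x.2).
Proof. by rewrite ffunE. Qed.

Lemma wr_mul_snd (x y : wreath) : (x * y).2 = x.2 * y.2.
Proof. by []. Qed.

Lemma wr_inv_fst (x : wreath) s : (x^-1).1 s = (x.1 (s * x.2^-1))^-1.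
Proof. by rewrite ffunE. Qed.

Lemma wr_inv_snd (x : wreath) : (x^-1).2 = x.2^-1.
Proof. by []. Qed.

Variable w : 'S_m -> 'I_m.-1 -> G.
Hypothesis w_far : forall s (i j : 'I_m.-1), (i.+2 <= j)%N ->
  w s i * w (s * braid_tperm i) j = w s j * w (s * braid_tperm j) i.
Hypothesis w_adj : forall s (i j : 'I_m.-1), j = i.+1 :> nat ->
  w s j * w (s * braid_tperm j) i * w (s * braid_tperm j * braid_tperm i) j =
  w s i * w (s * braid_tperm i) j * w (s * braid_tperm i * braid_tperm j) i.

Definition wr_gen (i : 'I_m.-1) : wreath := ([ffun s => w s i], braid_tperm i).

Fact wr_gen_rel r s : braid_rel r s ->
  \prod_(i <- r) wr_gen i = \prod_(i <- s) wr_gen i.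
Proof.
move=> rs; have := braid_tperm_rel rs.
case: {r s} rs => [i j ij|i j ij]; rewrite !big_cons !big_nil !mulg1 => e.
  congr (_, _); last exact: e.
  apply/ffunP => s; rewrite !ffunE /=; case: ij => [ij|ji]; first exact: w_far.
  exact/esym/w_far.
congr (_, _); last exact: e.
by apply/ffunP => s; rewrite !ffunE /= !mulgA w_adj.
Qed.

Definition wr_rep : {multiplicative braid m -> wreath} := presg_lift wr_gen_rel.

Lemma wr_rep_perm (x : braid m) : (wr_rep x).2 = bperm x.
Proof.
move: x; apply: braid_ind.
- by rewrite multf1 bperm1.
- by move=> x y ex ey; rewrite gmulfM bpermM -ex -ey.
- by move=> x ex; rewrite multfV bpermV -ex.
- move=> i im; rewrite -[i]/(nat_of_ord (Ordinal im)) bperm_sigma_ord sigma_ord.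
  by rewrite presg_lift_gen.
Qed.

Definition cocycle (x : pure_braid m) : G := (wr_rep (val x)).1 1.

Lemma cocycleM (x y : pure_braid m) : cocycle (x * y) = cocycle x * cocycle y.
Proof.
rewrite /cocycle [val (x * y)]/(val x * val y) gmulfM /= ffunE.
by rewrite wr_rep_perm pure_bperm mul1g.
Qed.

Lemma cocycle_sq (g : braid m) (i : 'I_m.-1) : exists u : G,
  cocycle (pconj g (sq m i)) =
    (w (bperm g)^-1 i * w ((bperm g)^-1 * braid_tperm i) i) ^ u.
Proof.
exists ((wr_rep g).1 (bperm g)^-1); rewrite /cocycle.
rewrite -[val (pconj _ _)]/((sigma m i * sigma m i) ^ g) multfJ gmulfM.
rewrite sigma_ord presg_lift_gen /conjg.
rewrite !(wr_mul_fst, wr_inv_fst, wr_mul_snd, wr_inv_snd) wr_rep_perm.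
rewrite -bpermV !mul1g !ffunE /=.
by rewrite /braid_tperm tperm2 !mulg1.
Qed.

End Wreath.

(* Unitriangular 4x4 matrices with superdiagonal (a, a, b), with d doubled to
   stay integral.  The coordinates a, b, c alone form a Heisenberg group; d
   forces c to vanish on central elements of the commutator subgroup. *)
Definition filiform := (int * int * int * int)%type.
HB.instance Definition _ := Choice.on filiform.

Section Filiform.
Implicit Types x y z : filiform.
Local Open Scope ring_scope.

Definition fil_a x : int := x.1.1.1.
Definition fil_b x : int := x.1.1.2.
Definition fil_c x : int := x.1.2.
Definition fil_d x : int := x.2.

Definition fil_mul x y : filiform :=
  (fil_a x + fil_a y, fil_b x + fil_b y, fil_c x + fil_c y + fil_a x * fil_b y,
   fil_d x + fil_d y + 2 * fil_a x * fil_c y + fil_a x ^+ 2 * fil_b y).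
Definition fil_one : filiform := (0, 0, 0, 0).
Definition fil_inv x : filiform :=
  (- fil_a x, - fil_b x, - fil_c x + fil_a x * fil_b x,
   - fil_d x + 2 * fil_a x * fil_c x - fil_a x ^+ 2 * fil_b x).

Fact fil_mulA : associative fil_mul.
Proof.
move=> [[[a b] c] d] [[[a' b'] c'] d'] [[[a'' b''] c''] d''].
by congr (_, _, _, _); rewrite /fil_a /fil_b /fil_c /fil_d /=; ring.
Qed.
Fact fil_mul1 : left_id fil_one fil_mul.
Proof.
move=> [[[a b] c] d]; congr (_, _, _, _);
by rewrite /fil_a /fil_b /fil_c /fil_d /=; ring.
Qed.
Fact fil_mulr1 : right_id fil_one fil_mul.
Proof.
move=> [[[a b] c] d]; congr (_, _, _, _);
by rewrite /fil_a /fil_b /fil_c /fil_d /=; ring.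
Qed.
Fact fil_mulV : left_inverse fil_one fil_inv fil_mul.
Proof.
move=> [[[a b] c] d]; congr (_, _, _, _);
by rewrite /fil_a /fil_b /fil_c /fil_d /=; ring.
Qed.
Fact fil_mulrV : right_inverse fil_one fil_inv fil_mul.
Proof.
move=> [[[a b] c] d]; congr (_, _, _, _);
by rewrite /fil_a /fil_b /fil_c /fil_d /=; ring.
Qed.
HB.instance Definition _ := isGroup.Build filiform
  fil_mulA fil_mul1 fil_mulr1 fil_mulV fil_mulrV.

Lemma fil_mulE x y : (x * y)%g = fil_mul x y. Proof. by []. Qed.

End Filiform.

Section TripleWeight.

Variables (G : groupType) (X C : G).

(* P_3 modulo its center is free on the twist X of strands 1, 2 and the twist C
   of strands 1, 3; the twist of strands 2, 3 is then (X C)^-1.  This is that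
   homomorphism spread over the single crossings of positions i, i+1, when the
   strands 1, 2, 3 occupy positions p1, p2, p3: a crossing contributes only when
   it brings the larger label to the right. *)
Definition crossing (p1 p2 p3 i : nat) : G :=
  if (p2 == i) && (p1 == i.+1) then X
  else if (p3 == i) && (p2 == i.+1) then (X * C)^-1
  else if (p3 == i) && (p1 == i.+1) then (if (p2 < i)%N then C ^ X^-1 else C)
  else 1.

Lemma crossing_swap_far (p1 p2 p3 i j : nat) :
    (i.+2 <= j)%N \/ (j.+2 <= i)%N ->
  crossing (swap i p1) (swap i p2) (swap i p3) j = crossing p1 p2 p3 j.
Proof.
move=> ij; have e p k : (i.+1 < k)%N \/ (k < i)%N -> (swap i p == k) = (p == k).
  by move=> ik; rewrite /swap; case: (p =P i) => h; [|case: (p =P i.+1) => h']; apply/eqP/eqP; lia.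
have lt p : (swap i p < j)%N = (p < j)%N.
  by rewrite /swap; case: (p =P i) => h; [|case: (p =P i.+1) => h']; apply/idP/idP; lia.
by rewrite /crossing lt !(e _ j) ?(e _ j.+1) //; lia.
Qed.

Lemma crossing_commute_far (p1 p2 p3 i j : nat) : (i.+2 <= j)%N ->
  commute (crossing p1 p2 p3 i) (crossing p1 p2 p3 j).
Proof.
move=> ij; have [h|h] := boolP [|| (p2 == i) && (p1 == i.+1),
    (p3 == i) && (p2 == i.+1) | (p3 == i) && (p1 == i.+1)]; last first.
  have -> : crossing p1 p2 p3 i = 1.
    rewrite /crossing; move: h.
    by do 3!case: (_ && _) => //.
  exact/commute_sym/commute1.
have -> : crossing p1 p2 p3 j = 1; last exact: commute1.
rewrite /crossing; do 3!(case: ifP => [h'|_]; first by exfalso; lia).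
by [].
Qed.

(** All that the braid relation at i, i+1 sees of a position is its place relative to i, i+1, i+2,
    so the check becomes finite. *)
Inductive slot := Below | At0 | At1 | At2 | Above.

Definition slot_of (i p : nat) : slot :=
  if (p < i)%N then Below else if p == i then At0 else if p == i.+1 then At1
  else if p == i.+2 then At2 else Above.

(** The case with the strands 3, 2, 1 at i, i+1, i+2 explains the conjugate in [crossing]: the left
    side is [X * C * (X * C)^-1], and the right side is also 1 because strands 1 and 3 cross there
    with strand 2 on their left, with weight [C ^ X^-1]. *)
Lemma crossing_adj (p1 p2 p3 i : nat) : p1 != p2 -> p1 != p3 -> p2 != p3 ->
  crossing p1 p2 p3 i.+1
    * crossing (swap i.+1 p1) (swap i.+1 p2) (swap i.+1 p3) i
    * crossing (swap i (swap i.+1 p1)) (swap i (swap i.+1 p2))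
        (swap i (swap i.+1 p3)) i.+1
  = crossing p1 p2 p3 i
    * crossing (swap i p1) (swap i p2) (swap i p3) i.+1
    * crossing (swap i.+1 (swap i p1)) (swap i.+1 (swap i p2))
        (swap i.+1 (swap i p3)) i.
Proof.
pose at0 s := if s is At0 then true else false.
pose at1 s := if s is At1 then true else false.
pose at2 s := if s is At2 then true else false.
pose lt0 s := if s is Below then true else false.
pose lt1 s := match s with Below | At0 => true | _ => false end.
pose sw0 s := match s with At0 => At1 | At1 => At0 | _ => s end.
pose sw1 s := match s with At1 => At2 | At2 => At1 | _ => s end.
have tests p : [/\ (p == i) = at0 (slot_of i p), (p == i.+1) = at1 (slot_of i p),
    (p == i.+2) = at2 (slot_of i p), (p < i)%N = lt0 (slot_of i p)
    & (p < i.+1)%N = lt1 (slot_of i p)].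
  rewrite /slot_of /at0 /at1 /at2 /lt0 /lt1; case: (ltngtP p i) => h.
  - by split; lia.
  - by case: eqP => h1; [|case: eqP => h2]; split; lia.
  - by split; lia.
have s0 : slot_of i i = At0 by rewrite /slot_of ltnn eqxx.
have s1 : slot_of i i.+1 = At1 by rewrite /slot_of ltnNge leqnSn /= gtn_eqF // eqxx.
have s2 : slot_of i i.+2 = At2.
  have h : (i.+2 == i) = false /\ (i.+2 == i.+1) = false by split; lia.
  by rewrite /slot_of ltnNge (leq_trans (leqnSn i)) //= h.1 h.2 eqxx.
have swap0 p : slot_of i (swap i p) = sw0 (slot_of i p).
  have [e0 e1 _ _ _] := tests p; rewrite /swap e0 e1 /at0 /at1 /sw0.
  by case E: (slot_of i p).
have swap1 p : slot_of i (swap i.+1 p) = sw1 (slot_of i p).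
  have [_ e1 e2 _ _] := tests p; rewrite /swap e1 e2 /at1 /at2 /sw1.
  by case E: (slot_of i p).
pose sep s s' := match s, s' with At0, At0 | At1, At1 | At2, At2 => false | _, _ => true end.
have sepP p q : p != q -> sep (slot_of i p) (slot_of i q).
  move=> pq; have [e0 e1 e2 _ _] := tests p; have [f0 f1 f2 _ _] := tests q.
  case: (slot_of i p) e0 e1 e2 => //= e0 e1 e2; case: (slot_of i q) f0 f1 f2 => //= f0 f1 f2;
    by move: pq; rewrite ?(eqP e0) ?(eqP e1) ?(eqP e2) ?(eqP f0) ?(eqP f1) ?(eqP f2) eqxx.
pose cr0 s1 s2 s3 := if at0 s2 && at1 s1 then X
  else if at0 s3 && at1 s2 then (X * C)^-1
  else if at0 s3 && at1 s1 then (if lt0 s2 then C ^ X^-1 else C) else 1.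
pose cr1 s1 s2 s3 := if at1 s2 && at2 s1 then X
  else if at1 s3 && at2 s2 then (X * C)^-1
  else if at1 s3 && at2 s1 then (if lt1 s2 then C ^ X^-1 else C) else 1.
have c0 q1 q2 q3 : crossing q1 q2 q3 i = cr0 (slot_of i q1) (slot_of i q2) (slot_of i q3).
  rewrite /crossing; have [-> -> _ -> _] := tests q2; have [_ -> _ _ _] := tests q1.
  by have [-> _ _ _ _] := tests q3.
have c1 q1 q2 q3 : crossing q1 q2 q3 i.+1 = cr1 (slot_of i q1) (slot_of i q2) (slot_of i q3).
  rewrite /crossing; have [_ -> -> _ ->] := tests q2; have [_ _ -> _ _] := tests q1.
  by have [_ -> _ _ _] := tests q3.
move=> /sepP + /sepP + /sepP; rewrite !c0 !c1 !(swap0, swap1).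
case: (slot_of i p1); case: (slot_of i p2) => //; case: (slot_of i p3) => // _ _ _;
  rewrite /= /cr0 /cr1 /= ?mulg1 ?mul1g //.
all: by rewrite /conjg ?invgM ?invgK !mulgA ?mulgK ?mulgVK ?mulgV ?mulVg ?mul1g.
Qed.

End TripleWeight.

Lemma braid_tperm_swap m (i : 'I_m.-1) (x : 'I_m) :
  braid_tperm i x = swap i x :> nat.
Proof. by rewrite -bperm_sigma_ord bperm_sigma. Qed.

Section IntegerHomomorphisms.
Variables (G : groupType) (a : G -> int).
Hypothesis aM : forall x y, a (x * y) = (a x + a y)%R.
Local Open Scope ring_scope.

Lemma int_hom1 : a 1%g = 0.
Proof. by have := aM 1 1; rewrite mulg1; lia. Qed.

Lemma int_homV x : a x^-1%g = - a x.
Proof. by have := aM x x^-1%g; rewrite mulgV int_hom1; lia. Qed.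

Lemma int_hom_lcs2 x : x \in @lcs G 2 -> a x = 0.
Proof.
move: x; apply: lcs2_ind.
- by move=> x y; rewrite /commg /conjg !aM !int_homV; lia.
- exact: int_hom1.
- by move=> x y ex ey; rewrite aM ex ey.
- by move=> x ex; rewrite int_homV ex.
Qed.

End IntegerHomomorphisms.

(** * The nilpotent quotient attached to three strands *)

Section TripleFunctionals.
Variables (m : nat) (i j k : 'I_m).
Hypothesis ijk : uniq [:: i; j; k].
Local Open Scope ring_scope.

Let X : filiform := (0, 1, 0, 0).
Let C : filiform := (1, 0, 0, 0).

Let weight (s : 'S_m) (t : 'I_m.-1) : filiform :=
  crossing X C (s i) (s j) (s k) t.

Let weight_swap s (t u : 'I_m.-1) : weight (s * braid_tperm t)%g u =
  crossing X C (swap t (s i)) (swap t (s j)) (swap t (s k)) u.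
Proof. by rewrite /weight !permM !braid_tperm_swap. Qed.

Let weight_far s (t u : 'I_m.-1) : (t.+2 <= u)%N ->
  (weight s t * weight (s * braid_tperm t) u =
   weight s u * weight (s * braid_tperm u) t)%g.
Proof.
move=> tu; rewrite !weight_swap !crossing_swap_far; try lia.
exact: crossing_commute_far.
Qed.

Let weight_adj s (t u : 'I_m.-1) : u = t.+1 :> nat ->
  (weight s u * weight (s * braid_tperm u) t
     * weight (s * braid_tperm u * braid_tperm t) u =
   weight s t * weight (s * braid_tperm t) u
     * weight (s * braid_tperm t * braid_tperm u) t)%g.
Proof.
move=> ut; rewrite /weight !permM !braid_tperm_swap ut.
have inj (x y : 'I_m) : x != y -> s x != s y :> nat.
  by move=> xy; rewrite val_eqE (inj_eq perm_inj).
move: ijk; rewrite /= !inE negb_or andbT => /andP[/andP[ij ik] jk].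
by apply: crossing_adj; apply: inj.
Qed.

Let rho := cocycle weight_far weight_adj.

Definition pair_ind (p q r s : 'I_m) : int :=
  (((p == r) && (q == s)) || ((p == s) && (q == r)))%:R.

Lemma triple_functionals : exists a b c : pure_braid m -> int,
  [/\ forall x y, a (x * y)%g = a x + a y, forall x y, b (x * y)%g = b x + b y,
      forall x y, c (x * y)%g = c x + c y + a x * b y,
      forall z, z \in @lcs (pure_braid m) 2 ->
        z \in @centerg (pure_braid m) -> c z = 0
    & forall p q, p != q ->
        a (twist (tperm p q)) = pair_ind p q i k - pair_ind p q j k
        /\ b (twist (tperm p q)) = pair_ind p q i j - pair_ind p q j k].
Proof.
have rhoM x y : rho (x * y)%g = fil_mul (rho x) (rho y) by apply: cocycleM.
pose a x := fil_a (rho x); pose b x := fil_b (rho x); pose c x := fil_c (rho x).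
have aM x y : a (x * y)%g = a x + a y by rewrite /a rhoM.
have bM x y : b (x * y)%g = b x + b y by rewrite /b rhoM.
have val p q : p != q ->
    a (twist (tperm p q)) = pair_ind p q i k - pair_ind p q j k
    /\ b (twist (tperm p q)) = pair_ind p q i j - pair_ind p q j k.
  move=> pq; have m2 : (1 < m)%N.
    by have := ltn_ord p; have := ltn_ord q; move: pq; rewrite -val_eqE /=; lia.
  have m0 : (0 < m)%N by lia.
  have m1 : (0 < m.-1)%N by lia.
  pose x0 := Ordinal m0; pose x1 := Ordinal m2; pose t := Ordinal m1.
  have [|||g [g0 g1]] := @exists_braid_map m [:: x0; x1] [:: p; q] => //.
    by rewrite /= inE pq.
  have e : abeq (pconj g (sq m t)) (twist (tperm p q)).
    by apply: twist_abeq => //; rewrite (@bperm_sigmaJ m 0 x0 x1) // g0 g1.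
  have ev (h : pure_braid m -> int) : (forall x y, h (x * y)%g = h x + h y) ->
      h (twist (tperm p q)) = h (pconj g (sq m t)).
    by move=> hM; have := int_hom_lcs2 hM e; rewrite hM (int_homV hM); lia.
  rewrite (ev _ aM) (ev _ bM) /a /b.
  have [u ->] : exists u, rho (pconj g (sq m t)) =
    ((weight (bperm g)^-1 t * weight ((bperm g)^-1 * braid_tperm t) t) ^ u)%g.
    exact: cocycle_sq.
  have abJ (x y : filiform) : fil_a (x ^ y)%g = fil_a x /\ fil_b (x ^ y)%g = fil_b x.
    by rewrite /conjg !fil_mulE /fil_mul /fil_inv /fil_a /fil_b /=; split; ring.
  rewrite !(abJ _ u).1 !(abJ _ u).2.
  have at0 l : ((bperm g)^-1%g l == 0%N :> nat) = (l == p).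
    by rewrite -[0%N]/(val x0) val_eqE -g0 -{2}(permKV (bperm g) l) (inj_eq perm_inj).
  have at1 l : ((bperm g)^-1%g l == 1%N :> nat) = (l == q).
    by rewrite -[1%N]/(val x1) val_eqE -g1 -{2}(permKV (bperm g) l) (inj_eq perm_inj).
  have sw0 n : (swap 0 n == 0%N) = (n == 1%N) by case: n => [|[|]].
  have sw1 n : (swap 0 n == 1%N) = (n == 0%N) by case: n => [|[|]].
  have cr P1 P2 P3 : P1 != P2 -> P1 != P3 -> P2 != P3 ->
      fil_a (crossing X C P1 P2 P3 0) =
        ((P3 == 0%N) && (P1 == 1%N))%:R - ((P3 == 0%N) && (P2 == 1%N))%:R
      /\ fil_b (crossing X C P1 P2 P3 0) =
        ((P2 == 0%N) && (P1 == 1%N))%:R - ((P3 == 0%N) && (P2 == 1%N))%:R.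
    rewrite /crossing ltn0.
    by case: P1 => [|[|P1]]; case: P2 => [|[|P2]]; case: P3 => [|[|P3]].
  have inj (s : 'S_m) (x y : 'I_m) : x != y -> s x != s y :> nat.
    by move=> xy; rewrite val_eqE (inj_eq perm_inj).
  move: ijk; rewrite /= !inE negb_or andbT => /andP[/andP[ij ik] jk].
  rewrite weight_swap /weight -![nat_of_ord t]/0%N !fil_mulE /fil_mul.
  rewrite -[fil_a (_, _, _, _)]/(_ + _) -[fil_b (_, _, _, _)]/(_ + _).
  have swinj x y : x != y -> swap 0 x != swap 0 y.
    by case: x => [|[|x]]; case: y => [|[|y]].
  have [-> ->] := cr _ _ _ (inj (bperm g)^-1%g _ _ ij) (inj _ _ _ ik) (inj _ _ _ jk).
  have [-> ->] := cr _ _ _ (swinj _ _ (inj (bperm g)^-1%g _ _ ij))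
    (swinj _ _ (inj _ _ _ ik)) (swinj _ _ (inj _ _ _ jk)).
  rewrite !(sw0, sw1) !(at0, at1) /pair_ind ![p == _]eq_sym ![q == _]eq_sym.
  have ne l : (l == p) && (l == q) = false.
    by apply: contraNF pq => /andP[/eqP <- /eqP <-].
  have ne2 (l l' r : 'I_m) : l != l' -> (l == r) && (l' == r) = false.
    by move=> ll; apply: contraNF ll => /andP[/eqP -> /eqP ->].
  move: (ne i) (ne j) (ne k) (ne2 i j p ij) (ne2 i j q ij) (ne2 i k p ik).
  move: (ne2 i k q ik) (ne2 j k p jk) (ne2 j k q jk).
  by case: (i == p); case: (i == q); case: (j == p); case: (j == q);
    case: (k == p); case: (k == q).
exists a, b, c; split=> //.
- by move=> x y; rewrite /c rhoM.
(* As [a] is 1 on the twist of i, k and both [a] and [b] kill [z], the last coordinates of the two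
   products differ by twice [c z]. *)
- move=> z z2 /centergP/(_ (twist (tperm i k)))/(congr1 rho); rewrite !rhoM.
  move/(congr1 fil_d); rewrite /fil_mul /= -/(a _) -/(a _) -/(b _) -/(b _) -/(c _) -/(c _).
  rewrite /= (int_hom_lcs2 aM z2) (int_hom_lcs2 bM z2).
  move: ijk; rewrite /= !inE negb_or andbT => /andP[/andP[ij ik] jk].
  have [-> _] := val i k ik; rewrite /pair_ind !eqxx (negPf ij) (negPf ik) /=.
  by move: (c z) (c _) (fil_d _) (fil_d _) (b _); lia.
Qed.

End TripleFunctionals.

Local Close Scope quotient_scope.
Local Close Scope group_scope.
Local Open Scope ring_scope.

(** * Integer homomorphisms as weights *)

Lemma sum_option (T : finType) (F : option T -> int) :
  \sum_p F p = F None + \sum_x F (Some x).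
Proof.
rewrite (bigD1 None) //=; congr (_ + _).
rewrite (reindex_omap Some id) //=; last by case.
by apply: eq_bigl => x; rewrite eqxx.
Qed.

Section HomomorphismWeights.
Variable m : nat.
Hypothesis m2 : (1 < m)%N.
Local Notation P := (pure_braid m).
Local Notation T := (option 'I_m).
Implicit Types a b : P -> int.

Definition int_hom a := forall x y, a (x * y)%g = a x + a y.

Lemma int_hom_abeq a x y : int_hom a -> abeq x y -> a x = a y.
Proof.
by move=> aM e; have := int_hom_lcs2 aM e; rewrite aM (int_homV aM); lia.
Qed.

Lemma int_hom_prod a (I : finType) (F : I -> P) : int_hom a ->
  a (\prod_i F i)%g = \sum_i a (F i).
Proof. by move=> aM; apply: big_morph; [exact: aM | exact: int_hom1]. Qed.

(* None is the additional puncture, for which the pure braid generators are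
   fixed by requiring the weights around every strand to sum to zero. *)
Definition edge_twist (p q : T) : P :=
  match p, q with
  | Some i, Some j => twist (tperm i j)
  | Some i, None | None, Some i => ((\prod_j twist (tperm i j))^-1)%g
  | None, None => 1%g
  end.

Definition weight a (p q : T) : int := a (edge_twist p q).

Lemma edge_twistC p q : edge_twist p q = edge_twist q p.
Proof. by case: p q => [i|] [j|] //=; rewrite tpermC. Qed.

Lemma edge_twist_diag p : edge_twist p p = 1%g.
Proof. by case: p => //= i; rewrite tperm1 twist1. Qed.

Lemma weightC a p q : weight a p q = weight a q p.
Proof. by rewrite /weight edge_twistC. Qed.

Lemma weight_diag a p : int_hom a -> weight a p p = 0.
Proof. by move=> aM; rewrite /weight edge_twist_diag int_hom1. Qed.

Lemma weight_None a i : int_hom a ->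
  weight a (Some i) None = - \sum_j weight a (Some i) (Some j).
Proof. by move=> aM; rewrite /weight /= (int_homV aM) int_hom_prod. Qed.

Lemma weight_row a i : int_hom a -> \sum_q weight a (Some i) q = 0.
Proof. by move=> aM; rewrite sum_option weight_None // addNr. Qed.

Lemma pconj_sq_twist (g : braid m) i : (i < m.-1)%N ->
  exists p q : 'I_m, p != q /\ abeq (pconj g (sq m i)) (twist (tperm p q)).
Proof.
move=> im; have i1 : (i.+1 < m)%N by lia.
pose x := Ordinal (ltnW i1); pose y := Ordinal i1.
exists (bperm g x), (bperm g y); split.
  by rewrite (inj_eq perm_inj) -val_eqE /=; lia.
by apply: twist_abeq => //; rewrite (@bperm_sigmaJ m i x y).
Qed.

Lemma int_hom_ext a b : int_hom a -> int_hom b ->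
  (forall i j : 'I_m, i != j -> weight a (Some i) (Some j) = weight b (Some i) (Some j)) ->
  a =1 b.
Proof.
move=> aM bM ab; apply: pure_braid_ind.
- by rewrite (int_hom1 aM) (int_hom1 bM).
- by move=> x y ex ey; rewrite aM bM ex ey.
- by move=> x ex; rewrite (int_homV aM) (int_homV bM) ex.
- move=> g i im; have [p [q [pq e]]] := pconj_sq_twist g im.
  by rewrite (int_hom_abeq aM e) (int_hom_abeq bM e); apply: ab.
Qed.

Lemma weight_ext a v : int_hom a -> balanced v ->
  (forall i j : 'I_m, i != j -> weight a (Some i) (Some j) = v (Some i) (Some j)) ->
  forall p q, weight a p q = v p q.
Proof.
move=> aM [vC vd vs] av.
have e i j : weight a (Some i) (Some j) = v (Some i) (Some j).
  have [->|ij] := eqVneq i j; first by rewrite weight_diag // vd.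
  exact: av.
have eN i : weight a (Some i) None = v (Some i) None.
  rewrite weight_None //; have := vs (Some i); rewrite sum_option.
  under eq_bigr do rewrite -e.
  by move=> h; apply/eqP; rewrite eq_sym -addr_eq0; apply/eqP.
case=> [i|] [j|] //.
- by rewrite weightC eN vC.
- by rewrite weight_diag // vd.
Qed.

(** Unlike a condition on weights, this one is visibly preserved by composition with an
    automorphism. *)
Definition resonant a b := forall x y, commute x y -> a x * b y = a y * b x.

Section ResonantPair.
Variables a b : P -> int.
Hypotheses (aM : int_hom a) (bM : int_hom b) (ab : resonant a b).

Let d x y := a x * b y - a y * b x.

Let dC x y : d x y = - d y x. Proof. by rewrite /d; ring. Qed.
Let dxx x : d x x = 0. Proof. by rewrite /d; ring. Qed.
Let dMl x y z : d (x * y)%g z = d x z + d y z.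
Proof. by rewrite /d aM bM; ring. Qed.
Let dMr x y z : d x (y * z)%g = d x y + d x z.
Proof. by rewrite /d aM bM; ring. Qed.
Let dVr x y : d x y^-1%g = - d x y.
Proof. by rewrite /d (int_homV aM) (int_homV bM); ring. Qed.
Let d_prod x (F : 'I_m -> P) : d x (\prod_i F i)%g = \sum_i d x (F i).
Proof.
by rewrite /d !int_hom_prod // mulr_sumr mulr_suml -sumrB.
Qed.
Let d_abeq x x' y y' : abeq x x' -> abeq y y' -> d x y = d x' y'.
Proof.
by move=> ex ey; rewrite /d !(int_hom_abeq aM ex, int_hom_abeq bM ex,
  int_hom_abeq aM ey, int_hom_abeq bM ey).
Qed.
Let d_commute x y : commute x y -> d x y = 0.
Proof. by move/ab => e; rewrite /d e subrr. Qed.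

Local Notation E i j := (edge_twist (Some i) (Some j)).

Let d_far (p q r s : 'I_m) : uniq [:: p; q; r; s] -> d (E p q) (E r s) = 0.
Proof.
move=> /twist_far[x [y [c ex ey]]].
by rewrite -(d_abeq ex ey) d_commute.
Qed.

Let d_triple (p q r : 'I_m) : p != q ->
  d (E p q) (E p r) + d (E p q) (E q r) = 0.
Proof.
move=> pq; have [->|pr] := eqVneq p r.
  by rewrite edge_twist_diag -[E q r]edge_twistC dxx addr0 /d (int_hom1 aM) (int_hom1 bM); ring.
have [->|qr] := eqVneq q r.
  by rewrite edge_twist_diag dxx add0r /d (int_hom1 aM) (int_hom1 bM); ring.
have [|x [y [c ex ey]]] := @twist_triple m p q r.
  by neqs.
by have := d_abeq ex ey; rewrite d_commute // !dMr dxx add0r => /esym.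
Qed.

(** Of the twists that make up the edge to [None], only those of p, r and of p, s can contribute,
    and these two cancel by [d_triple]. The additional puncture thus obeys the same rule for
    disjoint edges as the others. *)
Let d_far_None (p r s : 'I_m) : uniq [:: p; r; s] ->
  d (E r s) (edge_twist (Some p) None) = 0.
Proof.
move=> u; rewrite dVr d_prod.
rewrite (@sum_except2 _ _ r s); last first.
- move=> q qr qs; have [->|pq] := eqVneq p q.
    by rewrite -/(E q q) edge_twist_diag /d (int_hom1 aM) (int_hom1 bM); ring.
  apply: d_far; split_uniq u; neqs.
- by split_uniq u.
have rs : r != s by split_uniq u.
have := d_triple p rs; rewrite [E r p]edge_twistC [E s p]edge_twistC => ->.
by rewrite oppr0.
Qed.

Lemma resonant_disjoint p q r s : uniq [:: p; q; r; s] ->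
  weight a p q * weight b r s - weight a r s * weight b p q = 0.
Proof.
move=> u; rewrite -/(d (edge_twist p q) (edge_twist r s)).
have {}u : [/\ p != r, p != s, q != r & q != s] /\ [/\ p != q & r != s].
  by split_uniq u.
have neS (x y : 'I_m) : Some x != Some y -> x != y by [].
case: u; case: p => [p|]; case: q => [q|]; case: r => [r|]; case: s => [s|] //;
  move=> [h1 h2 h3 h4] [h5 h6]; try by [].
- by apply: d_far; move/neS: h1 => h1; move/neS: h2 => h2; move/neS: h3 => h3;
    move/neS: h4 => h4; move/neS: h5 => h5; move/neS: h6 => h6; neqs.
- apply: d_far_None; move/neS: h1 => h1; move/neS: h3 => h3; move/neS: h5 => h5; neqs.
- rewrite [edge_twist None _]edge_twistC; apply: d_far_None.
  move/neS: h2 => h2; move/neS: h4 => h4; move/neS: h5 => h5; neqs.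
- rewrite dC d_far_None ?oppr0 //.
  move/neS: h1 => h1; move/neS: h2 => h2; move/neS: h6 => h6; neqs.
- rewrite dC [edge_twist None _]edge_twistC d_far_None ?oppr0 //.
  move/neS: h3 => h3; move/neS: h4 => h4; move/neS: h6 => h6; neqs.
Qed.

(** [ta] and [tb] are -2 times the values of [a] and [b] on the full twist. As that is central,
    [ta * b] and [tb * a] should agree; here this follows by summing [d_triple]. For
    non-proportional [a] and [b] it forces [ta] and [tb] to vanish. *)
Lemma resonant_balanced x y : a x * b y - a y * b x != 0 ->
  balanced (weight a) /\ balanced (weight b).
Proof.
move=> dxy.
pose ta := \sum_i weight a (Some i) None; pose tb := \sum_i weight b (Some i) None.
have e1 k l : k != l -> ta * weight b (Some k) (Some l) = tb * weight a (Some k) (Some l).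
  move=> kl; apply/eqP; rewrite -subr_eq0 /ta /tb !mulr_suml -sumrB.
  have h' z : weight a z None * weight b (Some k) (Some l) -
      weight b z None * weight a (Some k) (Some l) = - d (E k l) (edge_twist z None).
    by rewrite dC opprK /d [weight b z None * _]mulrC.
  rewrite (@sum_except2 _ _ k l) // => [|i ik il]; last first.
    by rewrite h' d_far_None ?oppr0 //; neqs.
  rewrite !h' -opprD oppr_eq0 /= !dVr !d_prod -opprD oppr_eq0 -big_split /=.
  by rewrite big1 // => p _; apply: (d_triple p kl).
have e2 z : ta * b z = tb * a z.
  apply: (int_hom_ext (a := fun z => ta * b z) (b := fun z => tb * a z)).
  - by move=> u v; rewrite bM mulrDr.
  - by move=> u v; rewrite aM mulrDr.
  - by move=> i j; apply: e1.
have ta0 : ta = 0.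
  apply/eqP; rewrite -(mulIr_eq0 _ (mulIf dxy)) mulrBr.
  rewrite mulrCA e2 [ta * (a y * _)]mulrCA e2.
  by rewrite mulrCA [a y * (tb * _)]mulrCA [a y * _]mulrC subrr.
have tb0 : tb = 0.
  apply/eqP; rewrite -(mulIr_eq0 _ (mulIf dxy)) mulrBr !mulrA.
  by rewrite -!e2 mulrAC subrr.
have sumN c : int_hom c -> \sum_q weight c None q = \sum_i weight c (Some i) None.
  move=> cM; rewrite sum_option weight_diag // add0r.
  by apply: eq_bigr => i _; rewrite weightC.
split; split; try by [exact: weightC | move=> p; apply: weight_diag].
- by case=> [i|]; [apply: weight_row | rewrite sumN].
- by case=> [i|]; [apply: weight_row | rewrite sumN].
Qed.

Lemma resonant_support x y : a x * b y - a y * b x != 0 ->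
  [/\ balanced (weight a), balanced (weight b) &
    exists S : {set T}, [/\ #|S| = 4%N, supported (weight a) S & supported (weight b) S]].
Proof.
move=> dxy; have [ba bb] := resonant_balanced dxy; split=> //.
have [p [q [r [s npqrs]]]] : exists p q r s,
    weight a p q * weight b r s - weight a r s * weight b p q != 0.
  (* The minor is additive in each argument, so it vanishes everywhere once it vanishes on the
     twists. *)
  have [h|h] := pselect (exists p q r s,
    weight a p q * weight b r s - weight a r s * weight b p q != 0) => //.
  case/eqP: dxy.
  have d0 p q r s : d (E p q) (E r s) = 0.
    apply/eqP; apply: contra_notT h => h; exists (Some p), (Some q), (Some r), (Some s).
    exact: h.
  have d1 p q z : d (E p q) z = 0.
    move: z; apply: (@int_hom_ext (d (E p q)) (fun=> 0)) => // i j _.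
    exact: d0.
  move: x; apply: (@int_hom_ext (d^~ y) (fun=> 0)) => // i j _.
  exact: d1.
exact: (resonance ba bb resonant_disjoint npqrs).
Qed.

End ResonantPair.

End HomomorphismWeights.

(** * Functionals on commutators *)

Section CommutatorFunctionals.
Variable G : groupType.
Implicit Types (w : G -> G -> int) (F a b c : G -> int).

(* F descends to the second lower central quotient of G modulo its center. *)
Definition lcs2_functional F :=
  [/\ forall x y, x \in @lcs G 2 -> y \in @lcs G 2 -> F (x * y)%g = F x + F y,
      forall x, x \in @lcs G 3 -> F x = 0
    & forall x, x \in @lcs G 2 -> x \in @centerg G -> F x = 0].

Definition realizes F w :=
  lcs2_functional F /\ forall x y, F [~ x, y]%g = w x y.

Lemma realizesD F F' w w' : realizes F w -> realizes F' w' ->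
  realizes (fun x => F x + F' x) (fun x y => w x y + w' x y).
Proof.
move=> [[FM F3 FZ] Fw] [[FM' F3' FZ'] Fw']; split; last by move=> x y; rewrite Fw Fw'.
split=> [x y x2 y2|x x3|x x2 xZ]; first by rewrite FM // FM' //; ring.
  by rewrite F3 // F3'.
by rewrite FZ // FZ'.
Qed.

Lemma realizesN F w : realizes F w ->
  realizes (fun x => - F x) (fun x y => - w x y).
Proof.
move=> [[FM F3 FZ] Fw]; split; last by move=> x y; rewrite Fw.
split=> [x y x2 y2|x x3|x x2 xZ]; first by rewrite FM // opprD.
  by rewrite F3 // oppr0.
by rewrite FZ // oppr0.
Qed.

Lemma realizes0 : realizes (fun=> 0) (fun _ _ => 0).
Proof. by split=> //; split=> // x y _ _; rewrite addr0. Qed.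

Lemma realizes_ext F w w' : (forall x y, w x y = w' x y) -> realizes F w ->
  realizes F w'.
Proof. by move=> e [hF Fw]; split=> // x y; rewrite Fw. Qed.

(** The triple (a, b, c) is a homomorphism to the Heisenberg group; comparing [c] on x y and y x
    yields the minor as the value on the commutator. *)
Lemma realizes_heisenberg a b c :
    (forall x y, a (x * y)%g = a x + a y) -> (forall x y, b (x * y)%g = b x + b y) ->
    (forall x y, c (x * y)%g = c x + c y + a x * b y) ->
    (forall z, z \in @lcs G 2 -> z \in @centerg G -> c z = 0) ->
  realizes c (fun x y => a x * b y - a y * b x).
Proof.
move=> aM bM cM cZ.
have cw x y : c [~ x, y]%g = a x * b y - a y * b x.
  have := congr1 c (commgC x y); rewrite (cM x y) (cM (y * x)%g) (cM y x).
  rewrite (int_hom_lcs2 bM (commg_lcs2 x y)) mulr0 addr0 => e.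
  by apply: (addrI (c y + c x + a y * b x)); rewrite -e; ring.
have cM2 x y : x \in @lcs G 2 -> c (x * y)%g = c x + c y.
  by move=> x2; rewrite cM (int_hom_lcs2 aM x2) mul0r addr0.
split=> //; split=> // [x y x2 y2|x x3]; first exact: cM2.
suff [] : x \in @lcs G 2 /\ c x = 0 by [].
have c1 : c 1%g = 0 by have := cM2 1%g 1%g gpred1; rewrite mulg1; lia.
move: x x3; apply: gensub_ind.
- move=> _ [u [v [_ v2 ->]]]; rewrite commg_lcs2 cw.
  by rewrite (int_hom_lcs2 aM v2) (int_hom_lcs2 bM v2) mulr0 mul0r.
- by rewrite gpred1.
- by move=> u v [u2 cu] [v2 cv]; rewrite gpredM // cM2 // cu cv.
- move=> u [u2 cu]; rewrite gpredV u2; split=> //.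
  by have := cM2 u u^-1%g u2; rewrite mulgV cu c1; lia.
Qed.

End CommutatorFunctionals.

(** * Homomorphisms and functionals of four punctures *)

Section QuadHomomorphisms.
Variable m : nat.
Hypothesis m2 : (1 < m)%N.
Local Notation P := (pure_braid m).
Local Notation T := (option 'I_m).
Implicit Types (a b : P -> int) (i j k l : T).

Definition has_weight a (v : T -> T -> int) :=
  int_hom a /\ forall p q, weight a p q = v p q.

Lemma has_weight_unique a b v : has_weight a v -> has_weight b v -> a =1 b.
Proof.
move=> [aM av] [bM bv]; apply: int_hom_ext => // i j _.
by rewrite av bv.
Qed.

Lemma has_weight_ext a v v' : (forall p q, v p q = v' p q) -> has_weight a v ->
  has_weight a v'.
Proof. by move=> e [aM av]; split=> // p q; rewrite av. Qed.

Lemma has_weightD a b v w : has_weight a v -> has_weight b w ->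
  has_weight (fun x => a x + b x) (fun p q => v p q + w p q).
Proof.
move=> [aM av] [bM bv]; split=> [x y|p q]; first by rewrite aM bM; ring.
by rewrite -av -bv.
Qed.

Lemma has_weightZ c a v : has_weight a v ->
  has_weight (fun x => c * a x) (fun p q => c * v p q).
Proof.
move=> [aM av]; split=> [x y|p q]; first by rewrite aM mulrDr.
by rewrite -av.
Qed.

Lemma triple_weights (i j k : 'I_m) : uniq [:: i; j; k] -> exists a b c,
  [/\ has_weight a (quad (Some i) (Some j) (Some k) None),
      has_weight b (quad (Some i) (Some k) (Some j) None)
    & realizes c (fun x y : P => a x * b y - a y * b x)].
Proof.
move=> u; have [a [b [c [aM bM cM cZ ab]]]] := triple_functionals u.
split_uniq u.
have u1 : uniq [:: Some i; Some j; Some k; None].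
  by rewrite /= !inE !(inj_eq (@Some_inj _)); neqs.
have u2 : uniq [:: Some i; Some k; Some j; None].
  by rewrite /= !inE !(inj_eq (@Some_inj _)); neqs.
have ind (p q r s : 'I_m) : r != s -> p != q ->
  pair_ind p q r s = (p == r)%:R * (q == s)%:R + (p == s)%:R * (q == r)%:R.
  move=> rs pq; rewrite /pair_ind.
  have [e|_] := eqVneq p r.
    by subst r; rewrite (negPf rs) /= mul1r mul0r addr0 orbF.
  by rewrite /= mul0r add0r; case: (p == s); rewrite ?mul1r ?mul0r.
exists a, b, c; split; last exact: realizes_heisenberg.
- split=> //; apply: (weight_ext m2 aM (balanced_quad u1)) => p q pq.
  rewrite /weight /= (ab p q pq).1 !ind // /quad /=.
  rewrite ![Some _ == Some _](inj_eq (@Some_inj _)) /=.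
  by ring.
- split=> //; apply: (weight_ext m2 bM (balanced_quad u2)) => p q pq.
  rewrite /weight /= (ab p q pq).2 !ind // /quad /=.
  rewrite ![Some _ == Some _](inj_eq (@Some_inj _)) /=.
  by ring.
Qed.

(** [quad i j k l] is the difference of [quad i j k None] and [quad i j l None]; the symmetries of
    [quad] move [None] into any other place. *)
Lemma exists_quad_hom i j k l : uniq [:: i; j; k; l] ->
  exists a, has_weight a (quad i j k l).
Proof.
have base (x y z : 'I_m) : uniq [:: x; y; z] ->
    exists a, has_weight a (quad (Some x) (Some y) (Some z) None).
  by move=> /triple_weights[a [b [c [h _ _]]]]; exists a.
have neg i' j' k' l' : (exists a, has_weight a (quad i' j' k' l')) ->
    exists a, has_weight a (quad i' j' l' k').
  move=> [a h]; exists (fun x => -1 * a x).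
  by apply: has_weight_ext (has_weightZ (-1) h) => p q; rewrite /quad; ring.
have sym i' j' k' l' : (exists a, has_weight a (quad i' j' k' l')) ->
    exists a, has_weight a (quad k' l' i' j').
  by move=> [a h]; exists a; apply: has_weight_ext h => p q; rewrite /quad; ring.
have uS (x y z : 'I_m) : Some x != Some y -> Some x != Some z -> Some y != Some z ->
    uniq [:: x; y; z].
  by rewrite !(inj_eq (@Some_inj _)) => xy xz yz; neqs.
have diff (x y z t : 'I_m) : uniq [:: x; y; z] -> uniq [:: x; y; t] ->
    exists a, has_weight a (quad (Some x) (Some y) (Some z) (Some t)).
  move=> /base[a ha] /base[b hb]; exists (fun x => a x + -1 * b x).
  apply: has_weight_ext (has_weightD ha (has_weightZ (-1) hb)) => p q.
  by rewrite /quad; ring.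
move=> u; have {u} : [/\ i != j, i != k & i != l] /\ [/\ j != k, j != l & k != l].
  by split_uniq u.
case: i => [i|]; case: j => [j|]; case: k => [k|]; case: l => [l|];
  move=> [[h1 h2 h3] [h4 h5 h6]]; try by [].
- by apply: diff; apply: uS.
- by apply: base; apply: uS.
- by apply: neg; apply: base; apply: uS.
- by apply: sym; apply: base; apply: uS => //; rewrite eq_sym.
- by apply: sym; apply: neg; apply: base; apply: uS => //; rewrite eq_sym.
Qed.

Definition quad_hom i j k l : P -> int :=
  if pselect (exists a, has_weight a (quad i j k l)) is left h then projT1 (cid h)
  else fun=> 0.

Lemma quad_homP i j k l : uniq [:: i; j; k; l] ->
  has_weight (quad_hom i j k l) (quad i j k l).
Proof.
move=> u; rewrite /quad_hom; case: pselect => [h|[]]; first by case: (cid h).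
exact: exists_quad_hom.
Qed.

(** A 2x2 minor of two homomorphisms that span the plane of the 4-set. It is alternating in i, j, k,
    l, hence determined by the 4-set up to sign. *)
Definition omega i j k l (x y : P) : int :=
  quad_hom i j k l x * quad_hom i k j l y - quad_hom i j k l y * quad_hom i k j l x.

Lemma quad_hom_comb (t t' t'' : T * T * T * T) (c c' : int) :
    uniq [:: t.1.1.1; t.1.1.2; t.1.2; t.2] ->
    uniq [:: t'.1.1.1; t'.1.1.2; t'.1.2; t'.2] ->
    uniq [:: t''.1.1.1; t''.1.1.2; t''.1.2; t''.2] ->
    (forall p q, quad t.1.1.1 t.1.1.2 t.1.2 t.2 p q =
       c * quad t'.1.1.1 t'.1.1.2 t'.1.2 t'.2 p q
       + c' * quad t''.1.1.1 t''.1.1.2 t''.1.2 t''.2 p q) ->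
  forall x, quad_hom t.1.1.1 t.1.1.2 t.1.2 t.2 x =
    c * quad_hom t'.1.1.1 t'.1.1.2 t'.1.2 t'.2 x
    + c' * quad_hom t''.1.1.1 t''.1.1.2 t''.1.2 t''.2 x.
Proof.
move=> u u' u'' e; apply: has_weight_unique (quad_homP u) _.
apply: has_weight_ext (has_weightD (has_weightZ c (quad_homP u'))
  (has_weightZ c' (quad_homP u''))) => p q.
by rewrite e.
Qed.

End QuadHomomorphisms.

Ltac quad_comb m2 t t' t'' c c' :=
  let e := fresh in have e := @quad_hom_comb _ m2 t t' t'' c c'; rewrite /= in e;
  rewrite e; [by ring | | | | by move=> p q; rewrite /quad; ring];
  by [assumption | neqs].

Section OmegaRealization.
Variable m : nat.
Hypothesis m2 : (1 < m)%N.
Local Notation P := (pure_braid m).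
Local Notation T := (option 'I_m).
Implicit Types (i j k l : T).

Lemma omega_realized i j k l : uniq [:: i; j; k; l] ->
  exists F, realizes F (omega i j k l).
Proof.
have base (x y z : 'I_m) : uniq [:: x; y; z] ->
    exists F, realizes F (omega (Some x) (Some y) (Some z) None).
  move=> u; have [a [b [c [ha hb hc]]]] := triple_weights m2 u; exists c.
  have u1 : uniq [:: Some x; Some y; Some z; None].
    by split_uniq u; rewrite /= !inE !(inj_eq (@Some_inj _)); neqs.
  have u2 : uniq [:: Some x; Some z; Some y; None].
    by split_uniq u; rewrite /= !inE !(inj_eq (@Some_inj _)); neqs.
  apply: realizes_ext hc => p q; rewrite /omega.
  by rewrite !(has_weight_unique m2 ha (quad_homP m2 u1), has_weight_unique m2 hb (quad_homP m2 u2)).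
have neg i' j' k' l' : uniq [:: i'; j'; k'; l'] ->
    (exists F, realizes F (omega i' j' k' l')) ->
    exists F, realizes F (omega i' j' l' k').
  move=> u [F hF]; exists (fun x => - F x); apply: realizes_ext (realizesN hF) => x y.
  split_uniq u; rewrite /omega.
  have e1 := @quad_hom_comb _ m2 (i', j', l', k') (i', j', k', l') (i', j', k', l') (-1) 0.
  have e2 := @quad_hom_comb _ m2 (i', l', j', k') (i', k', j', l') (i', j', k', l') 1 (-1).
  rewrite /= in e1 e2.
  rewrite !e1 ?e2; try by [neqs | move=> p q; rewrite /quad; ring].
  by ring.
have sym i' j' k' l' : uniq [:: i'; j'; k'; l'] ->
    (exists F, realizes F (omega i' j' k' l')) ->
    exists F, realizes F (omega k' l' i' j').
  move=> u [F hF]; exists F; apply: realizes_ext hF => x y.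
  split_uniq u; rewrite /omega.
  have e1 := @quad_hom_comb _ m2 (k', l', i', j') (i', j', k', l') (i', j', k', l') 1 0.
  have e2 := @quad_hom_comb _ m2 (k', i', l', j') (i', k', j', l') (i', j', k', l') 1 0.
  rewrite /= in e1 e2.
  rewrite !e1 ?e2; try by [neqs | move=> p q; rewrite /quad; ring].
  by ring.
have uS (x y z : 'I_m) : Some x != Some y -> Some x != Some z -> Some y != Some z ->
    uniq [:: x; y; z].
  by rewrite !(inj_eq (@Some_inj _)) => xy xz yz; neqs.
have uN (x y z : 'I_m) : Some x != Some y -> Some x != Some z -> Some y != Some z ->
    uniq [:: Some x; Some y; Some z; None].
  by move=> xy xz yz; neqs.
move=> u; have {u} : [/\ i != j, i != k & i != l] /\ [/\ j != k, j != l & k != l].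
  by split_uniq u.
case: i => [i|]; case: j => [j|]; case: k => [k|]; case: l => [l|];
  move=> [[h1 h2 h3] [h4 h5 h6]]; try by [].
(* Without [None] among the punctures, omega is the alternating sum of the four functionals in which
   one of i, j, k, l is dropped and [None] is added. *)
- have [F1 R1] := base i j k (uS _ _ _ h1 h2 h4).
  have [F2 R2] := base i j l (uS _ _ _ h1 h3 h5).
  have [F3 R3] := base i k l (uS _ _ _ h2 h3 h6).
  have [F4 R4] := base j k l (uS _ _ _ h4 h5 h6).
  have R := realizesD (realizesD R1 (realizesN R2)) (realizesD R3 (realizesN R4)).
  eexists; apply: realizes_ext R => x y; rewrite /omega.
  set I := Some i in h1 h2 h3 *; set J := Some j in h1 h4 h5 *.
  set K := Some k in h2 h4 h6 *; set L := Some l in h3 h5 h6 *.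
  have nI : I != None by []. have nJ : J != None by [].
  have nK : K != None by []. have nL : L != None by [].
  clearbody I J K L.
  have e1 z : quad_hom I J K L z = quad_hom I J K None z - quad_hom I J L None z.
    quad_comb m2 (I, J, K, L) (I, J, K, None : T) (I, J, L, None : T) (1 : int) (-1 : int).
  have e2 z : quad_hom I K J L z = quad_hom I K J None z - quad_hom I K L None z.
    quad_comb m2 (I, K, J, L) (I, K, J, None : T) (I, K, L, None : T) (1 : int) (-1 : int).
  have e3 z : quad_hom J L K None z = quad_hom I L K None z - quad_hom I J K None z.
    quad_comb m2 (J, L, K, None : T) (I, L, K, None : T) (I, J, K, None : T) (1 : int) (-1 : int).
  have e4 z : quad_hom J K L None z = quad_hom I K L None z - quad_hom I J L None z.
    quad_comb m2 (J, K, L, None : T) (I, K, L, None : T) (I, J, L, None : T) (1 : int) (-1 : int).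
  have e5 z : quad_hom K L J None z = quad_hom J L K None z - quad_hom J K L None z.
    quad_comb m2 (K, L, J, None : T) (J, L, K, None : T) (J, K, L, None : T) (1 : int) (-1 : int).
  have e6 z : quad_hom I L J None z = quad_hom I K J None z + quad_hom K L J None z.
    quad_comb m2 (I, L, J, None : T) (I, K, J, None : T) (K, L, J, None : T) (1 : int) (1 : int).
  rewrite !(e1, e2, e6, e5, e3, e4).
  by ring.
- by apply: base; apply: uS.
- by apply: neg; [apply: uN | apply: base; apply: uS].
- apply: sym; first by neqs.
  by apply: base; apply: uS => //; rewrite eq_sym.
- apply: sym; first by neqs.
  apply: neg; first by neqs.
  by apply: base; apply: uS => //; rewrite eq_sym.
Qed.

End OmegaRealization.

(** * Rigidity of automorphisms *)

Ltac quad_eval := rewrite /quad ?eqxx; repeat match goal with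
  | H : is_true (?x != ?y) |- _ =>
      rewrite ?(negPf H) ?[y == x]eq_sym ?(negPf H); clear H end; rewrite /=; try ring.

Lemma balanced_comb (T : finType) (u v w : T -> T -> int) (c d : int) :
    (forall p q, u p q = c * v p q + d * w p q) -> balanced v -> balanced w ->
  balanced u.
Proof.
move=> e [vC vd vs] [wC wd ws]; split=> [p q|p|p].
- by rewrite !e vC wC.
- by rewrite e vd wd !mulr0 addr0.
- by under eq_bigr do rewrite e; rewrite big_split /= -!mulr_sumr vs ws !mulr0 addr0.
Qed.

Section Rigidity.
Variable m : nat.
Hypothesis m4 : (4 < m)%N.
Local Notation P := (pure_braid m).
Local Notation T := (option 'I_m).
Implicit Types (a b : P -> int) (i j k l : T) (S : {set T}) (alpha : autg P).

Let m2 : (1 < m)%N. Proof. by lia. Qed.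

Lemma omega_edges i j k l p q r s : uniq [:: i; j; k; l] ->
  omega i j k l (edge_twist p q) (edge_twist r s) =
    quad i j k l p q * quad i k j l r s - quad i j k l r s * quad i k j l p q.
Proof.
move=> u; have u' : uniq [:: i; k; j; l] by split_uniq u; neqs.
have [_ e1] := quad_homP m2 u; have [_ e2] := quad_homP m2 u'.
by rewrite /omega -!e1 -!e2.
Qed.

Lemma resonant_quad_hom i j k l : uniq [:: i; j; k; l] ->
  resonant (quad_hom i j k l) (quad_hom i k j l).
Proof.
move=> u x y c; have [F [[FM _ _] Fw]] := omega_realized m2 u.
have F1 : F 1%g = 0 by have := FM 1%g 1%g gpred1 gpred1; rewrite mulg1; lia.
have xy1 : [~ x, y]%g = 1%g.
    by apply: (@mulgI _ (y * x)%g); rewrite -commgC c mulg1.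
have := Fw x y; rewrite xy1 F1 /omega => /esym/eqP.
by rewrite subr_eq0 => /eqP.
Qed.

Lemma omega_self i j k l : uniq [:: i; j; k; l] ->
  omega i j k l (edge_twist i j) (edge_twist j k) = 1.
Proof. by move=> u; rewrite omega_edges //; split_uniq u; quad_eval. Qed.

Lemma int_hom_autg a alpha : int_hom a -> int_hom (a \o alpha).
Proof. by move=> aM x y; rewrite /= gmulfM aM. Qed.

Definition carried S a :=
  [/\ int_hom a, balanced (weight a) & supported (weight a) S].

Lemma carried_quad i j k l a : uniq [:: i; j; k; l] ->
    carried [set i; j; k; l] a ->
  forall x, a x = weight a i k * quad_hom i j k l x + weight a i j * quad_hom i k j l x.
Proof.
move=> u [aM ba sa]; have u' : uniq [:: i; k; j; l] by split_uniq u; neqs.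
apply: (has_weight_unique m2 (v := weight a)); first by split.
apply: has_weight_ext (has_weightD (has_weightZ (weight a i k) (quad_homP m2 u))
  (has_weightZ (weight a i j) (quad_homP m2 u'))) => p q.
by rewrite -supported4_quad.
Qed.

(** The pulled back pair is resonant again, and [omega_self], read at the preimages of two twists,
    shows that it is not proportional. Hence [resonant_support] provides the new 4-set. *)
Lemma carried_image alpha S : #|S| = 4%N ->
  exists S', #|S'| = 4%N /\ forall a, carried S a -> carried S' (a \o alpha).
Proof.
move=> /set4_of_card[i [j [k [l [u ->]]]]].
have u' : uniq [:: i; k; j; l] by split_uniq u; neqs.
have [aM _] := quad_homP m2 u; have [bM _] := quad_homP m2 u'.
set a := quad_hom i j k l in aM *; set b := quad_hom i k j l in bM *.
have res : resonant (a \o alpha) (b \o alpha).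
  move=> x y c /=; apply: (resonant_quad_hom u).
  by rewrite /commute -!gmulfM c.
pose x := edge_twist i j; pose y := edge_twist j k.
have dxy : (a \o alpha) (alpha^-1%g x) * (b \o alpha) (alpha^-1%g y)
    - (a \o alpha) (alpha^-1%g y) * (b \o alpha) (alpha^-1%g x) != 0.
  by rewrite /= !autgKV -/(omega i j k l x y) omega_self.
have [ba bb [S' [cS' sa sb]]] :=
  resonant_support m2 (int_hom_autg alpha aM) (int_hom_autg alpha bM) res dxy.
exists S'; split=> // c hc; have cE := carried_quad u hc.
have [cM _ _] := hc; split; first exact: int_hom_autg.
  by apply: balanced_comb ba bb => p q; rewrite /weight /= cE.
move=> p q pS; rewrite /weight /= cE -/a -/b.
have := sa p q pS; have := sb p q pS; rewrite /weight /= => -> ->.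
by rewrite !mulr0 addr0.
Qed.

Definition quad_image alpha S : {set T} :=
  if pselect (exists S', #|S'| = 4%N /\
      forall a, carried S a -> carried S' (a \o alpha)) is left h
  then projT1 (cid h) else S.

Lemma quad_imageP alpha S : #|S| = 4%N ->
  #|quad_image alpha S| = 4%N /\
  forall a, carried S a -> carried (quad_image alpha S) (a \o alpha).
Proof.
move=> cS; rewrite /quad_image; case: pselect => [h|[]]; first by case: (cid h).
exact: carried_image.
Qed.

Lemma carried_quad_hom i j k l : uniq [:: i; j; k; l] ->
  carried [set i; j; k; l] (quad_hom i j k l).
Proof.
move=> u; have [aM av] := quad_homP m2 u.
have e : weight (quad_hom i j k l) = quad i j k l.
  by apply/funext => p; apply/funext => q.
by split; rewrite ?e //; [exact: balanced_quad | exact: supported_quad].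
Qed.

Lemma weight_quad_hom i j k l p q : uniq [:: i; j; k; l] ->
  weight (quad_hom i j k l) p q = quad i j k l p q.
Proof. by move=> u; have [_ ->] := quad_homP m2 u. Qed.

Lemma quad_imageK alpha S : #|S| = 4%N ->
  quad_image alpha^-1%g (quad_image alpha S) = S.
Proof.
move=> cS; have [cS' h] := quad_imageP alpha cS.
have [cS'' h'] := quad_imageP alpha^-1%g cS'.
have [i [j [k [l [u eS]]]]] := set4_of_card cS.
have ca := carried_quad_hom u; rewrite -eS in ca.
have [_ ba sa] := ca; have [_ _ sa'] := h' _ (h _ ca).
apply: (supported4_inj cS'' cS ba _ sa).
  move=> p q pS; rewrite -(sa' p q pS) /weight /=; congr (quad_hom _ _ _ _ _).
  by rewrite autgKV.
exists i, k; rewrite weight_quad_hom //; split_uniq u; quad_eval.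
Qed.

Lemma weight_autg_nz alpha a : int_hom a -> (exists p q, weight a p q != 0) ->
  exists p q, weight (a \o alpha) p q != 0.
Proof.
move=> aM [p [q apq]].
have [//|h] := pselect (exists p q, weight (a \o alpha) p q != 0).
case/eqP: apq; rewrite /weight -(autgKV alpha (edge_twist p q)).
apply: (int_hom_ext m2 (a := a \o alpha) (b := fun=> 0)) => //.
  exact: int_hom_autg.
move=> x y _; apply/eqP; apply: contra_notT h => h.
by exists (Some x), (Some y).
Qed.

(** The three sets omit a, b, c from a 5-set whose other points are d, e. From delta_b - delta_c =
    (delta_a - delta_c) + (delta_b - delta_a) comes a relation among their planes; it survives
    composition with [alpha], and [supported4_dependent] turns it back into a 5-set. *)
Lemma quad_image_triple alpha (A B C : {set T}) :
    #|A| = 4%N -> #|B| = 4%N -> #|C| = 4%N -> A != B -> A != C -> B != C ->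
    #|A :|: B :|: C| = 5%N ->
  #|quad_image alpha A :|: quad_image alpha B :|: quad_image alpha C| = 5%N.
Proof.
move=> cA cB cC nAB nAC nBC cU; set U := A :|: B :|: C in cU.
have minus S : #|S| = 4%N -> S \subset U -> exists2 x, x \in U & S = U :\ x.
  move=> cS sS; have : #|U :\: S| = 1%N by rewrite cardsD (setIidPr sS) cU cS.
  move/eqP/cards1P => [x ex]; exists x.
    by have := set11 x; rewrite -ex inE => /andP[].
  by rewrite -ex setDDr setDv set0U (setIidPr sS).
have [a aU eA] : exists2 x, x \in U & A = U :\ x.
  by apply: minus => //; rewrite /U -setUA subsetUl.
have [b bU eB] : exists2 x, x \in U & B = U :\ x.
  by apply: minus => //; rewrite /U setUAC subsetUr.
have [c cU' eC] : exists2 x, x \in U & C = U :\ x.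
  by apply: minus => //; rewrite /U subsetUr.
have ab : a != b by apply: contraNneq nAB => e; rewrite eA eB e.
have ac : a != c by apply: contraNneq nAC => e; rewrite eA eC e.
have bc : b != c by apply: contraNneq nBC => e; rewrite eB eC e.
clearbody U; have cV : #|U :\ a :\ b :\ c| = 2%N.
  have bU' : b \in U :\ a by rewrite !inE eq_sym ab bU.
  have cU'' : c \in U :\ a :\ b by rewrite !inE eq_sym bc eq_sym ac cU'.
  have c1 : #|U :\ a| = 4%N by have := cardsD1 a U; rewrite aU cU => -[].
  have c2 : #|U :\ a :\ b| = 3%N.
    by have := cardsD1 b (U :\ a); rewrite bU' c1 => -[].
  by have := cardsD1 c (U :\ a :\ b); rewrite cU'' c2 => -[].
have /cards2P[d [e [de eV]]] : #|U :\ a :\ b :\ c| == 2%N by rewrite cV.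
have memV x : (x \in U :\ a :\ b :\ c) = [|| x == d | x == e] by rewrite eV !inE.
have dV : d \in U :\ a :\ b :\ c by rewrite memV eqxx.
have eV' : e \in U :\ a :\ b :\ c by rewrite memV eqxx orbT.
move: dV eV'; rewrite !inE => /and4P[dc db da dU] /and4P[ec eb ea eU].
have EU x : (x \in U) = [|| x == a, x == b, x == c, x == d | x == e].
  have := memV x; rewrite !inE.
  case: (eqVneq x a) => [-> //|_]; case: (eqVneq x b) => [-> //|_].
  by case: (eqVneq x c) => [-> //|_].
have sA : A = [set b; c; d; e].
  apply/setP => x; rewrite eA !inE EU; case: (eqVneq x a) => [->|_] /=.
    by rewrite (negPf ab) (negPf ac) ![a == _]eq_sym (negPf da) (negPf ea).
  by rewrite !orbA.
have sB : B = [set a; c; d; e].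
  apply/setP => x; rewrite eB !inE EU; case: (eqVneq x b) => [->|_] /=.
    by rewrite [b == a]eq_sym (negPf ab) (negPf bc) ![b == _]eq_sym (negPf db) (negPf eb).
  by rewrite !orbA.
have sC : C = [set b; a; d; e].
  apply/setP => x; rewrite eC !inE EU; case: (eqVneq x c) => [->|_] /=.
    by rewrite ![c == _]eq_sym (negPf bc) (negPf ac) (negPf dc) (negPf ec).
  by rewrite -!orbA orbCA.
have uA : uniq [:: b; c; d; e] by neqs.
have uB : uniq [:: a; c; d; e] by neqs.
have uC : uniq [:: b; a; d; e] by neqs.
have [cA' hA] := quad_imageP alpha cA; have [cB' hB] := quad_imageP alpha cB.
have [cC' hC] := quad_imageP alpha cC.
have inj S S' : #|S| = 4%N -> #|S'| = 4%N -> S != S' ->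
    quad_image alpha S != quad_image alpha S'.
  move=> cS cS'; apply: contraNneq => eS.
  by rewrite -(quad_imageK alpha cS) eS quad_imageK.
have qA := carried_quad_hom uA; have qB := carried_quad_hom uB.
have qC := carried_quad_hom uC; rewrite -sA -sB -sC in qA qB qC.
have [aM _ _] := qA.
have [_ bA' sA'] := hA _ qA; have [_ bB' sB'] := hB _ qB; have [_ bC' sC'] := hC _ qC.
apply: (supported4_dependent cA' cB' cC' (inj _ _ cA cB nAB) (inj _ _ cA cC nAC)
  bA' bB' bC' sA' sB' sC').
  apply: weight_autg_nz => //; exists b, d; rewrite weight_quad_hom //.
  by split_uniq uA; quad_eval.
move=> x y; rewrite /weight /=; move: (alpha _) => z.
quad_comb m2 (b, c, d, e) (a, c, d, e) (b, a, d, e) (1 : int) (1 : int).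
Qed.



Lemma quad_image_union5 alpha (A B C : {set T}) :
    #|A| = 4%N -> #|B| = 4%N -> #|C| = 4%N -> #|A :|: B :|: C| = 5%N ->
  #|quad_image alpha A :|: quad_image alpha B :|: quad_image alpha C| = 5%N.
Proof.
move=> cA cB cC cU; set f := quad_image alpha.
have two (X Y : {set T}) : #|X| = 4%N -> #|Y| = 4%N -> #|X :|: Y| = 5%N ->
    #|f X :|: f Y| = 5%N.
  move=> cX cY cXY.
  have nXY : X != Y by apply: contra_eqN cXY => /eqP ->; rewrite setUid cY.
  have cI : #|X :&: Y| = 3%N by have := cardsUI X Y; rewrite cXY cX cY; lia.
  have /set0Pn[r rI] : X :&: Y != set0 by rewrite -cards_eq0 cI.
  move: (rI); rewrite inE => /andP[rX rY].
  (* A third 4-set inside the same 5-set reduces a pair to a triple of distinct sets. *)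
  pose Z := (X :|: Y) :\ r.
  have cZ : #|Z| = 4%N by have := cardsD1 r (X :|: Y); rewrite inE rX cXY => -[].
  have rZ : r \notin Z by rewrite !inE eqxx.
  have nXZ : X != Z by apply: contraNneq rZ => <-.
  have nYZ : Y != Z by apply: contraNneq rZ => <-.
  have eU : X :|: Y :|: Z = X :|: Y by apply/setUidPl/subsetDl.
  have := quad_image_triple alpha cX cY cZ nXY nXZ nYZ; rewrite eU cXY => /(_ erefl).
  rewrite -/f => le5; have : (#|f X :|: f Y| <= 5)%N.
    by rewrite -le5 subset_leq_card // subsetUl.
  rewrite leq_eqVlt => /orP[/eqP //|]; rewrite ltnS => le4.
  have [fX _] := quad_imageP alpha cX; have [fY _] := quad_imageP alpha cY.
  case/eqP: nXY; rewrite -(quad_imageK alpha cX) -(quad_imageK alpha cY).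
  congr quad_image; transitivity (f X :|: f Y).
    by apply/eqP; rewrite eqEcard subsetUl /= [X in (_ <= X)%N]fX.
  by apply/esym/eqP; rewrite eqEcard subsetUr /= [X in (_ <= X)%N]fY.
have [eAB|nAB] := eqVneq A B; first by subst B; rewrite !setUid in cU *; apply: two.
have [eAC|nAC] := eqVneq A C.
  subst C; rewrite setUAC setUid in cU; rewrite setUAC setUid; exact: two.
have [eBC|nBC] := eqVneq B C.
  subst C; rewrite -setUA setUid in cU; rewrite -setUA setUid; exact: two.
exact: quad_image_triple.
Qed.

Lemma quad_image_perm alpha :
  exists s : {perm T}, forall S, #|S| = 4%N -> quad_image alpha S = s @: S.
Proof.
apply: preserves_triples_perm; first by rewrite card_option card_ord; lia.
have fc S : #|S| = 4%N -> #|quad_image alpha S| = 4%N.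
  by move=> cS; have [] := quad_imageP alpha cS.
split=> // [A B cA cB e|A B C cA cB cC].
  by rewrite -(quad_imageK alpha cA) e quad_imageK.
apply/eqP/eqP; first exact: quad_image_union5.
move=> /(quad_image_union5 alpha^-1%g (fc _ cA) (fc _ cB) (fc _ cC)).
by rewrite !quad_imageK.
Qed.

Section FixedAutomorphism.
Variables (alpha : autg P) (s : {perm T}).
Hypothesis sE : forall S, #|S| = 4%N -> quad_image alpha S = s @: S.

Lemma carried_autg i j k l : uniq [:: i; j; k; l] ->
  carried [set s i; s j; s k; s l] (quad_hom i j k l \o alpha).
Proof.
move=> u; have [_ h] := quad_imageP alpha (card_set4 u).
have := h _ (carried_quad_hom u); rewrite sE ?card_set4 //.
by rewrite !imsetU !imset_set1.
Qed.

Lemma quad_hom_autg_scale i j k l : uniq [:: i; j; k; l] ->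
  exists c : int, forall x, quad_hom i j k l (alpha x) =
    c * quad_hom (s i) (s j) (s k) (s l) x.
Proof.
move=> u; have us : uniq [:: s i; s j; s k; s l].
  by rewrite -(map_inj_uniq (f := s)) in u => //; apply: perm_inj.
have h := carried_autg u; exists (weight (quad_hom i j k l \o alpha) (s i) (s k)).
move=> x; rewrite -[LHS]/((quad_hom i j k l \o alpha) x) (carried_quad us h).
suff -> : weight (quad_hom i j k l \o alpha) (s i) (s j) = 0 by rewrite mul0r addr0.
(* With a fifth puncture [r], the homomorphism is the sum of those of i, r, k, l and of r, j, k, l.
   The image of the first misses [s j], that of the second misses [s i], so neither has weight on
   the edge joining these points. *)
have [|r rN] := @exists_notin T [:: i; j; k; l].
  by rewrite card_option card_ord /=; lia.
have u1 : uniq [:: i; r; k; l] by split_uniq u; split_uniq rN; neqs.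
have u2 : uniq [:: r; j; k; l] by split_uniq u; split_uniq rN; neqs.
have -> : weight (quad_hom i j k l \o alpha) (s i) (s j) =
    weight (quad_hom i r k l \o alpha) (s i) (s j)
    + weight (quad_hom r j k l \o alpha) (s i) (s j).
  rewrite /weight /=; move: (alpha _) => z.
  quad_comb m2 (i, j, k, l) (i, r, k, l) (r, j, k, l) (1 : int) (1 : int).
have sinj := inj_eq (@perm_inj _ s).
have [_ [wC _ _] w1] := carried_autg u1; have [_ _ w2] := carried_autg u2.
rewrite wC w1 ?w2 ?addr0 //.
  by split_uniq u; split_uniq rN; rewrite !inE !sinj; neqs.
by split_uniq u; split_uniq rN; rewrite !inE !sinj; neqs.
Qed.

(** The three homomorphisms of a 4-set satisfy one linear relation, which [alpha] respects, so their
    scalars agree. The common scalar divides 1 because the first homomorphism takes the value 1 and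
    [alpha] is onto; omega picks up its square. *)
Lemma omega_autg i j k l : uniq [:: i; j; k; l] -> forall x y,
  omega i j k l (alpha x) (alpha y) = omega (s i) (s j) (s k) (s l) x y.
Proof.
move=> u; have us : uniq [:: s i; s j; s k; s l].
  by rewrite -(map_inj_uniq (f := s)) in u => //; apply: perm_inj.
have u2 : uniq [:: i; k; j; l] by split_uniq u; neqs.
have u3 : uniq [:: i; l; j; k] by split_uniq u; neqs.
have us2 : uniq [:: s i; s k; s j; s l] by split_uniq us; neqs.
have us3 : uniq [:: s i; s l; s j; s k] by split_uniq us; neqs.
have [c1 e1] := quad_hom_autg_scale u; have [c2 e2] := quad_hom_autg_scale u2.
have [c3 e3] := quad_hom_autg_scale u3.
have pl x : c1 * quad_hom (s i) (s j) (s k) (s l) x =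
    c2 * quad_hom (s i) (s k) (s j) (s l) x - c3 * quad_hom (s i) (s l) (s j) (s k) x.
  rewrite -e1 -e2 -e3; move: (alpha _) => z.
  quad_comb m2 (i, j, k, l) (i, k, j, l) (i, l, j, k) (1 : int) (-1 : int).
have q1 p q : quad_hom (s i) (s j) (s k) (s l) (edge_twist p q) = quad (s i) (s j) (s k) (s l) p q.
  exact: weight_quad_hom.
have q2 p q : quad_hom (s i) (s k) (s j) (s l) (edge_twist p q) = quad (s i) (s k) (s j) (s l) p q.
  exact: weight_quad_hom.
have q3 p q : quad_hom (s i) (s l) (s j) (s k) (edge_twist p q) = quad (s i) (s l) (s j) (s k) p q.
  exact: weight_quad_hom.
have c13 : c1 = c3.
  have := pl (edge_twist (s i) (s k)); rewrite q1 q2 q3.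
  have -> : quad (s i) (s j) (s k) (s l) (s i) (s k) = 1 by split_uniq us; quad_eval.
  have -> : quad (s i) (s k) (s j) (s l) (s i) (s k) = 0 by split_uniq us; quad_eval.
  have -> : quad (s i) (s l) (s j) (s k) (s i) (s k) = -1 by split_uniq us; quad_eval.
  lia.
have c23 : c2 = c3.
  have := pl (edge_twist (s i) (s j)); rewrite q1 q2 q3.
  have -> : quad (s i) (s j) (s k) (s l) (s i) (s j) = 0 by split_uniq us; quad_eval.
  have -> : quad (s i) (s k) (s j) (s l) (s i) (s j) = 1 by split_uniq us; quad_eval.
  have -> : quad (s i) (s l) (s j) (s k) (s i) (s j) = 1 by split_uniq us; quad_eval.
  lia.
have c1sq : c1 * c1 = 1.
  have := e1 (alpha^-1%g (edge_twist i k)); rewrite autgKV.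
  have -> : quad_hom i j k l (edge_twist i k) = 1.
    by rewrite -[LHS]/(weight _ _ _) weight_quad_hom //; split_uniq u; quad_eval.
  move: (quad_hom _ _ _ _ _) => z h.
  have : c1 = 1 \/ c1 = -1.
    have /esym/eqP := congr1 absz h; rewrite abszM muln_eq1 => /andP[/eqP e _].
    by move: e; clear; lia.
  by case=> ->.
move=> x y; rewrite /omega !e1 !e2 c23 -c13.
have -> (a b c d : int) : c1 * a * (c1 * b) - c1 * c * (c1 * d) = c1 * c1 * (a * b - c * d).
  by ring.
by rewrite c1sq mul1r.
Qed.

End FixedAutomorphism.

End Rigidity.

(** * The invariant functional and the eigenvalue *)

Section InvariantFunctional.
Variable m : nat.
Hypothesis m4 : (4 < m)%N.
Local Notation P := (pure_braid m).
Local Notation T := (option 'I_m).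
Implicit Types (i j k l : T).

Let m2 : (1 < m)%N. Proof. by lia. Qed.

Lemma realizes_sum (G : groupType) (w : nat -> G -> G -> int) N :
  (forall t, exists F, realizes F (w t)) ->
  exists F, realizes F (fun x y => \sum_(t < N) w t x y).
Proof.
move=> h; elim: N => [|N [F hF]].
  by exists (fun=> 0); apply: realizes_ext (realizes0 G) => x y; rewrite big_ord0.
have [F' hF'] := h N; exists (fun x => F x + F' x).
by apply: realizes_ext (realizesD hF hF') => x y; rewrite big_ord_recr.
Qed.

Lemma omega_off i j k l p q r : uniq [:: i; j; k; l] ->
    ~~ all [in [:: i; j; k; l]] [:: p; q; r] ->
  omega i j k l (edge_twist p q) (edge_twist q r) = 0.
Proof.
move=> u h; have u' : uniq [:: i; k; j; l] by split_uniq u; neqs.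
have [_ qC _] := balanced_quad u; have [qC1 _ _] := balanced_quad u.
have [qC2 _ _] := balanced_quad u'.
have z1 x y : x \notin [:: i; j; k; l] -> quad i j k l x y = 0.
  by move=> xN; rewrite supported_quad //; move: xN; rewrite !inE -!orbA.
have z2 x y : x \notin [:: i; j; k; l] -> quad i k j l x y = 0.
  move=> xN; rewrite supported_quad //; move: xN; rewrite !inE -!orbA.
  by rewrite [X in ~~ (_ || X) -> _]orbCA.
rewrite omega_edges //; move: h; rewrite /= andbT !negb_and => /or3P[] h.
- by rewrite (z1 p q) // (z2 p q) // mul0r mulr0.
- by rewrite (z1 q r) // (z2 q r) // mul0r mulr0.
- by rewrite (qC1 q r) (qC2 q r) (z1 r q) // (z2 r q) // mul0r mulr0.
Qed.

Lemma omega_rotation i j k l f : uniq [:: f i; f j; f k; l] -> rotates f i j k ->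
  omega (f i) (f j) (f k) l (edge_twist i j) (edge_twist j k) = 1.
Proof.
move=> u; case=> [] [e1 e2 e3]; rewrite e1 e2 e3 in u *; rewrite omega_edges //;
  by split_uniq u; quad_eval.
Qed.

Lemma exists_invariant_functional (alpha : autg P) : exists F,
  [/\ lcs2_functional F, forall x y, F [~ alpha x, alpha y]%g = F [~ x, y]%g
    & exists x y, F [~ x, y]%g != 0].
Proof.
have [s sE] := quad_image_perm m4 alpha.
have [i [j [k [l [u iso]]]]] : exists i j k l, uniq [:: i; j; k; l] /\ isolated_tuple s i j k l.
  by apply: exists_isolated_tuple; rewrite card_option card_ord; lia.
have ut t : uniq [:: iter t s i; iter t s j; iter t s k; iter t s l].
  rewrite -[[:: _; _; _; _]]/(map (iter t s) [:: i; j; k; l]) map_inj_uniq //.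
  by move=> x y; rewrite -!permX; apply: perm_inj.
pose w t := omega (iter t s i) (iter t s j) (iter t s k) (iter t s l).
have [F [hF Fw]] := @realizes_sum P w #[s]%g (fun t => omega_realized m2 (ut t)).
exists F; split=> //.
- move=> x y; rewrite !Fw.
  have h t : w t (alpha x) (alpha y) = w t.+1 x y by apply: (omega_autg m4 sE).
  under eq_bigr do rewrite h.
  (* Composition with [alpha] shifts the summation index by one, cyclically because of the order of
     [s]. *)
  case: #[s]%g (expg_order s) => [|N] sN; first by rewrite !big_ord0.
  rewrite big_ord_recr big_ord_recl /= addrC; congr (_ + _).
  by rewrite /w -!permX sN !perm1.
- exists (edge_twist i j), (edge_twist j k); rewrite Fw.
  (* By the choice of the tuple each term is 0 or 1, and the term at t = 0 is 1. *)
  have w0 t : 0 <= w t (edge_twist i j) (edge_twist j k).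
    have [h|h] := boolP (all [in map (iter t s) [:: i; j; k; l]] [:: i; j; k]).
      rewrite /w (@omega_rotation _ _ _ _ (iter t s)) //.
      by apply: iso; apply/allP.
    by rewrite /w omega_off.
  rewrite -(prednK (order_gt0 s)) big_ord_recl /=; apply: lt0r_neq0.
  by rewrite ltr_pwDl ?sumr_ge0 // /w omega_self.
Qed.

End InvariantFunctional.

(** * Integer coordinates in abelian groups *)

Section IntegerExponents.
Variable A : groupType.
Implicit Types (x y : A) (z : int).

Lemma intexp_succ x z : intexp x (z + 1) = (intexp x z * x)%g.
Proof.
case: z => [n|[|n]].
- by rewrite -[Posz n + 1]/(Posz (n + 1)) addn1 /= expgSr.
- by rewrite /= expg1 mulVg.
- have -> : Negz n.+1 + 1 = Negz n by lia.
  by rewrite /= [(x ^+ n.+2)%g]expgS invgM mulgVK.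
Qed.

Lemma intexp_pred x z : intexp x (z - 1) = (intexp x z * x^-1)%g.
Proof. by rewrite -{2}(subrK 1 z) intexp_succ mulgK. Qed.

Lemma intexpD x z z' : intexp x (z + z') = (intexp x z * intexp x z')%g.
Proof.
elim: z' => [|n IH|n IH]; first by rewrite addr0 /= mulg1.
- have -> : z + n.+1%:Z = z + n%:Z + 1 by lia.
  have -> : n.+1%:Z = n%:Z + 1 by lia.
  by rewrite !intexp_succ IH mulgA.
- have -> : z + - n.+1%:Z = z - n%:Z - 1 by lia.
  have -> : - n.+1%:Z = - n%:Z - 1 by lia.
  by rewrite !intexp_pred IH mulgA.
Qed.

Variable F : A -> int.
Hypothesis FM : forall x y, F (x * y)%g = F x + F y.

Lemma int_hom_intexp x z : F (intexp x z) = z * F x.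
Proof.
elim: z => [|n IH|n IH]; first by rewrite /= (int_hom1 FM) mul0r.
- have -> : n.+1%:Z = n%:Z + 1 by lia.
  by rewrite intexp_succ FM IH mulrDl mul1r.
- have -> : - n.+1%:Z = - n%:Z - 1 by lia.
  by rewrite intexp_pred FM (int_homV FM) IH mulrBl mul1r.
Qed.

Lemma int_hom_lincomb r (b : 'I_r -> A) (c : 'rV[int]_r) :
  F (lincomb b c) = \sum_i c ord0 i * F (b i).
Proof.
rewrite /lincomb; rewrite (big_morph F FM (int_hom1 FM)).
by apply: eq_bigr => i _; rewrite int_hom_intexp.
Qed.

End IntegerExponents.

Section LinearCombinations.
Variables (A : groupType) (r : nat) (b : 'I_r -> A).
Hypothesis AC : forall x y : A, commute x y.

Lemma lincombD c c' : lincomb b (c + c') = (lincomb b c * lincomb b c')%g.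
Proof.
rewrite /lincomb; apply: (big_rec3 (fun x y z => x = (y * z)%g)); first by rewrite mulg1.
move=> i x y z _ ->; rewrite mxE intexpD -!mulgA; congr (_ * _)%g.
by rewrite !mulgA; congr (_ * _)%g; apply: AC.
Qed.

Lemma lincomb0 : lincomb b 0 = 1%g.
Proof. by rewrite /lincomb big1 // => i _; rewrite mxE. Qed.

Lemma lincombN c : lincomb b (- c) = ((lincomb b c)^-1)%g.
Proof.
by apply: (@mulgI _ (lincomb b c)); rewrite -lincombD subrr lincomb0 mulgV.
Qed.

Lemma lincomb_delta i : lincomb b (delta_mx ord0 i) = b i.
Proof.
transitivity (\prod_(j < r | j == i) b j)%g; last exact: big_pred1_eq.
rewrite [RHS]big_mkcond /lincomb; apply: eq_bigr => j _.
by rewrite mxE eqxx /=; case: (j == i).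
Qed.

Variable dual : 'I_r -> A -> int.
Hypothesis dualM : forall i x y, dual i (x * y)%g = dual i x + dual i y.
Hypothesis dual_b : forall i j, dual i (b j) = (i == j)%:R.

(** The dual family recovers the coordinates, which gives injectivity. *)
Lemma lincomb_bij : (forall u, exists c, u = lincomb b c) -> zbasis b.
Proof.
move=> sp; split=> //; exists (fun u => sval (cid (sp u))) => [c|u].
  apply/rowP => i; case: cid => c' /= /(congr1 (dual i)).
  rewrite !(int_hom_lincomb (dualM i)) => e.
  have del (d : 'rV[int]_r) : \sum_j d ord0 j * dual i (b j) = d ord0 i.
    rewrite (bigD1 i) //= dual_b eqxx mulr1 big1 ?addr0 // => j ji.
    by rewrite dual_b eq_sym (negPf ji) mulr0.
  by rewrite !del in e.
by case: cid => c /= ->.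
Qed.

End LinearCombinations.

(** * A basis of the second lower central quotient *)

Section LcsBasis.
Variable m : nat.
Hypothesis m4 : (4 < m)%N.
Local Notation P := (pure_braid m).
Local Notation T := (option 'I_m).
Local Notation M := (lcs_quot (inng P) 2).

Let m2 : (1 < m)%N. Proof. by lia. Qed.

Definition comm_class (x y : P) : M := inng_class [~ x, y]%g.

Lemma comm_classE x y : comm_class x y = lcs2_class [~ inng_pi x, inng_pi y]%g.
Proof. by rewrite /comm_class /inng_class inng_piR. Qed.

Lemma comm_classMl x y z : comm_class (x * y)%g z = (comm_class x z * comm_class y z)%g.
Proof. by rewrite !comm_classE inng_piM lcs2_class_commMl. Qed.

Lemma comm_classMr x y z : comm_class x (y * z)%g = (comm_class x y * comm_class x z)%g.
Proof. by rewrite !comm_classE inng_piM lcs2_class_commMr. Qed.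

Lemma comm_classVl x y : comm_class x^-1%g y = ((comm_class x y)^-1)%g.
Proof. by rewrite !comm_classE inng_piV lcs2_class_commVl. Qed.

Lemma comm_classVr x y : comm_class x y^-1%g = ((comm_class x y)^-1)%g.
Proof. by rewrite !comm_classE inng_piV lcs2_class_commVr. Qed.

Lemma comm_classC x y : comm_class x y = ((comm_class y x)^-1)%g.
Proof. by rewrite !comm_classE lcs2_class_commC. Qed.

Lemma comm_class_commute x y : commute x y -> comm_class x y = 1%g.
Proof.
move=> c; rewrite /comm_class (_ : [~ x, y]%g = 1%g).
  by rewrite /inng_class inng_pi1 lcs2_class1.
by apply: (@mulgI _ (y * x)%g); rewrite -commgC c mulg1.
Qed.

Lemma comm_class_lcs2 x y : y \in @lcs P 2 -> comm_class x y = 1%g.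
Proof. by move=> y2; rewrite comm_classE lcs2_class_comm_lcs2 // inng_pi_lcs2. Qed.

Lemma comm_class_abeq x x' y y' : abeq x x' -> abeq y y' -> comm_class x y = comm_class x' y'.
Proof.
move=> ex ey; rewrite -(mulVKg x x') -(mulVKg y y').
rewrite comm_classMr comm_classMl (comm_class_lcs2 _ ey) mulg1 [comm_class (x^-1 * x')%g y]comm_classC.
by rewrite (comm_class_lcs2 _ ex) invg1 mulg1.
Qed.

Definition ascending (t : 'I_m * 'I_m * 'I_m) : bool := (t.1.1 < t.1.2 < t.2)%N.

Definition triples : {set 'I_m * 'I_m * 'I_m} := [set t | ascending t].

Definition triple_class (t : 'I_m * 'I_m * 'I_m) : M :=
  comm_class (twist (tperm t.1.1 t.1.2)) (twist (tperm t.1.2 t.2)).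

Definition triple_basis (i : 'I_#|triples|) : M := triple_class (enum_val i).

Section Spanning.
Variable Q : M -> Prop.
Hypotheses (Q1 : Q 1%g) (QM : forall u v, Q u -> Q v -> Q (u * v)%g)
  (QV : forall u, Q u -> Q (u^-1)%g)
  (Qb : forall t, ascending t -> Q (triple_class t)).

Local Notation tw p q := (twist (tperm p q)).

(** Expand the trivial class of the commutator of A_pq with A_pq A_pr A_qr, as provided by
    [twist_triple]. *)
Lemma comm_class_twist_swap (p q r : 'I_m) : uniq [:: p; q; r] ->
  comm_class (tw q p) (tw p r) = ((comm_class (tw p q) (tw q r))^-1)%g.
Proof.
move=> /twist_triple[x [y [c ex ey]]].
have := comm_class_abeq ex ey; rewrite comm_class_commute // !comm_classMr comm_class_commute //.
rewrite mul1g tpermC => /esym e; apply: (@mulIg _ (comm_class (tw q p) (tw q r))).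
by rewrite e mulVg.
Qed.

(** [flip] and [swap] generate all reorderings of p, q, r, each at the cost of an inversion; this
    reduces to ascending triples. *)
Lemma spanned_adjacent (p q r : 'I_m) : uniq [:: p; q; r] -> Q (comm_class (tw p q) (tw q r)).
Proof.
have flip (x y z : 'I_m) : Q (comm_class (tw x y) (tw y z)) -> Q (comm_class (tw z y) (tw y x)).
  by move=> h; rewrite comm_classC (tpermC z) (tpermC y x); apply: QV.
have swap (x y z : 'I_m) : uniq [:: x; y; z] -> Q (comm_class (tw x y) (tw y z)) ->
    Q (comm_class (tw y x) (tw x z)).
  by move=> u h; rewrite comm_class_twist_swap //; apply: QV.
have asc (x y z : 'I_m) : (x < y)%N -> (y < z)%N -> Q (comm_class (tw x y) (tw y z)).
  by move=> xy yz; apply: (Qb (t := (x, y, z))); rewrite /ascending xy.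
move=> u; have [npq npr nqr] : [/\ p != q, p != r & q != r] by split_uniq u.
case: (ltngtP p q) => [pq|qp|/val_inj e]; last by rewrite e eqxx in npq.
- case: (ltngtP q r) => [qr|rq|/val_inj e]; last by rewrite e eqxx in nqr.
    exact: asc.
  case: (ltngtP p r) => [pr|rp|/val_inj e]; last by rewrite e eqxx in npr.
    by apply/flip/swap; [neqs|]; apply/flip/asc.
  by apply: swap; [neqs|]; apply/flip/asc.
- case: (ltngtP p r) => [pr|rp|/val_inj e]; last by rewrite e eqxx in npr.
    by apply: swap; [neqs|]; apply: asc.
  case: (ltngtP q r) => [qr|rq|/val_inj e]; last by rewrite e eqxx in nqr.
    by apply/flip/swap; [neqs|]; apply: asc.
  exact/flip/asc.
Qed.

Lemma spanned_twists (p q r s : 'I_m) : p != q -> r != s -> Q (comm_class (tw p q) (tw r s)).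
Proof.
move=> pq rs; have [e|nqr] := eqVneq q r.
  subst r; have [->|nps] := eqVneq s p; first by rewrite tpermC comm_class_commute.
  by apply: spanned_adjacent; neqs.
have [e|npr] := eqVneq p r.
  subst r; have [->|nqs] := eqVneq s q; first by rewrite comm_class_commute.
  by rewrite (tpermC p q); apply: spanned_adjacent; neqs.
have [e|nqs] := eqVneq q s.
  by subst s; rewrite (tpermC r q); apply: spanned_adjacent; neqs.
have [e|nps] := eqVneq p s.
  by subst s; rewrite (tpermC p q) (tpermC r p); apply: spanned_adjacent; neqs.
have [|x [y [c ex ey]]] := @twist_far m p q r s; first by neqs.
by rewrite -(comm_class_abeq ex ey) comm_class_commute.
Qed.

Lemma spanned u : Q u.
Proof.
suff h : forall x y, Q (comm_class x y) by move: u; apply: inng_class_ind.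
apply: pure_braid_ind.
- by move=> y; rewrite comm_class_commute //; apply/commute_sym/commute1.
- by move=> x x' hx hx' y; rewrite comm_classMl; apply: QM.
- by move=> x hx y; rewrite comm_classVl; apply: QV.
move=> g i im; have [p [q [pq e]]] := pconj_sq_twist m2 g im.
apply: pure_braid_ind.
- by rewrite comm_class_commute //; apply: commute1.
- by move=> x x' hx hx'; rewrite comm_classMr; apply: QM.
- by move=> x hx; rewrite comm_classVr; apply: QV.
move=> h j jm; have [r [s [rs e']]] := pconj_sq_twist m2 h jm.
by rewrite (comm_class_abeq e e'); apply: spanned_twists.
Qed.

End Spanning.

(** The dual functional is induced by omega for i, j, k and [None]. A different ascending triple
    contains a strand outside i, j, k, and there omega vanishes by [omega_off]. *)
Lemma triple_dual (t : 'I_m * 'I_m * 'I_m) : ascending t ->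
  exists F : M -> int, (forall u v, F (u * v)%g = F u + F v) /\
    forall t', ascending t' -> F (triple_class t') = (t == t')%:R.
Proof.
case: t => [[i j] k] /andP[ij jk]; rewrite /= in ij jk.
have u : uniq [:: Some i; Some j; Some k; None].
  rewrite /= !inE !(inj_eq (@Some_inj _)) /= !orbF -!val_eqE /=.
  by rewrite !ltn_eqF // (ltn_trans ij).
have [F [[FM F3 FZ] Fw]] := omega_realized m2 u.
have [G [GM GF]] := lcs2_inng_functional FM F3 FZ.
exists G; split=> // -[[p q] r] /andP[/= pq qr].
rewrite /triple_class /comm_class GF ?commg_lcs2 // Fw /=.
have -> : omega (Some i) (Some j) (Some k) None (twist (tperm p q)) (twist (tperm q r)) =
   omega (Some i) (Some j) (Some k) None (edge_twist (Some p) (Some q)) (edge_twist (Some q) (Some r)).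
  by [].
have [[<- <- <-]|ne] := eqVneq (i, j, k) (p, q, r); first exact: omega_self.
apply: omega_off => //; apply: contra ne; rewrite /= !inE !(inj_eq (@Some_inj _)).
by rewrite !xpair_eqE -!val_eqE /= !orbF; lia.
Qed.

Lemma triple_zbasis : zbasis triple_basis.
Proof.
have asc (i : 'I_#|triples|) : ascending (enum_val i).
  by have := @enum_valP _ triples i; rewrite inE.
pose dual i := projT1 (cid (triple_dual (asc i))).
have dualP i : (forall u v, dual i (u * v)%g = dual i u + dual i v) /\
    forall t', ascending t' -> dual i (triple_class t') = (enum_val i == t')%:R.
  by rewrite /dual; case: (cid _).
apply: (@lincomb_bij _ _ _ _ dual) => [x y|i x y|i j|u].
- exact: lcs2_classC.
- by have [-> _] := dualP i.
- by have [_ ->] := dualP i; rewrite ?(inj_eq enum_val_inj).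
apply: (@spanned (fun u => exists c, u = lincomb triple_basis c)) => [|x y [c ->] [d ->]|x [c ->]|t tA].
- by exists 0; rewrite lincomb0.
- by exists (c + d); rewrite lincombD //; apply: lcs2_classC.
- by exists (- c); rewrite lincombN //; apply: lcs2_classC.
have tT : t \in triples by rewrite inE.
exists (delta_mx ord0 (enum_rank_in tT t)); rewrite lincomb_delta.
by rewrite /triple_basis enum_rankK_in.
Qed.

End LcsBasis.

(** [eigenvalue] refers to row vectors, but a nonzero column fixed by [A] makes [A - 1] singular
    just as well. *)
Lemma eigenvalue_of_column (r : nat) (A : 'M[int]_r) (v : 'I_r -> int) :
    (exists i, v i != 0) -> (forall i, \sum_j A i j * v j = v i) ->
  eigenvalue (map_mx intr A : 'M[algC]_r) 1.
Proof.
move=> [i vi] Av; rewrite /eigenvalue /eigenspace kermx_eq0 row_free_unit.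
apply: contra_neqN vi => uB; set B := (_ - _)%R in uB.
pose c : 'cV[algC]_r := \col_j (v j)%:~R.
have Bc : B *m c = 0.
  apply/matrixP => k l; rewrite mulmxBl mul1mx !mxE -[in X in _ - X]Av rmorph_sum /=.
  by apply/eqP; rewrite subr_eq0; apply/eqP/eq_bigr => j _; rewrite !mxE rmorphM.
have : c i ord0 = 0 by rewrite -[c](mulKmx uB) Bc mulmx0 mxE.
by rewrite mxE => /eqP; rewrite intr_eq0 => /eqP.
Qed.

Theorem theorem11 (n : nat) (hn : (6 <= n)%N)
    (alpha : autg (pure_braid n.-1)) :
  aut_eigenvalue (phi2 n.-1 alpha) (1%R : algC).
Proof.
have m4 : (4 < n.-1)%N by lia.
have [F [[FM F3 FZ] Falpha [x [y Fxy]]]] := exists_invariant_functional m4 alpha.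
have [G [GM GF]] := lcs2_inng_functional FM F3 FZ.
have G1 : G 1%g = 0 by apply: int_hom1.
have Ginv u : G (phi2 n.-1 alpha u) = G u.
  have pM : {morph phi2 n.-1 alpha : u v / (u * v)%g} by apply: gmulfM.
  have pV := autgV (phi2 n.-1 alpha); have p1 := autg1 (phi2 n.-1 alpha).
  move: u; apply: inng_class_ind.
  - move=> x' y'; rewrite -[phi2 _ _]/(lcs_autg 2 (inng_autg alpha)).
    by rewrite inng_class_autg ?commg_lcs2 // autgR !GF ?commg_lcs2.
  - by rewrite p1.
  - by move=> u v hu hv; rewrite pM !GM hu hv.
  - by move=> u hu; rewrite pV !(int_homV GM) hu.
have bas := triple_zbasis m4; set b := @triple_basis n.-1 in bas.
have [f bf fb] := bas.2.
exists _, b, (\matrix_(i, j) f (phi2 n.-1 alpha (b i)) ord0 j).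
have rowM i : row i (\matrix_(i, j) f (phi2 n.-1 alpha (b i)) ord0 j) = f (phi2 n.-1 alpha (b i)).
  by apply/rowP => j; rewrite !mxE.
split=> // [i|]; first by rewrite rowM fb.
(* The fixed column consists of the values of [G] on the basis. If they were all zero, [G] would
   vanish on the class of the commutator of [x] and [y]. *)
apply: (@eigenvalue_of_column _ _ (G \o b)) => [|i].
  have [//|h] := pselect (exists i, (G \o b) i != 0).
  have Gb i : G (b i) = 0 by apply/eqP; apply: contra_notT h => h; exists i.
  case/eqP: Fxy; rewrite -GF ?commg_lcs2 // -[inng_class _]fb.
  by rewrite (int_hom_lincomb GM) big1 // => i _; rewrite Gb mulr0.
rewrite /= -[RHS]Ginv -[phi2 n.-1 alpha (b i)]fb (int_hom_lincomb GM).
by apply: eq_bigr => j _; rewrite mxE.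
Qed.
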